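(* There is a constant $C>0$ such that for every $u\in C_0^\infty(M)$ (and $x\in M$) $$u(x)=\sum_{i=1}^3\int\big(Z_i\Gamma(x,y)+K_i(x,y)\big)\,Z_iu(y)\,|y|\,dy+\int\big(K_0(x,y)+f_x(y)\big)\,u(y)\,|y|\,dy,$$ where $K_0,K_1,K_2,K_3$ are suitable kernels such that $$|K_0(x,y)|\le C\,|x|^2\,d^{-Q+1}(y,x)\,d^{-Q+2}(y,0),\qquad |K_i(x,y)|\le C\,|x|^2\,d^{-Q+1}(x,y)\,d^{-Q+3}(y,0)$$ for every $i=1,2,3$.
   Context: The characteristic plane $M=\{(x,0):x\in\mathbb{R}^4\}$ of the Heisenberg group $\mathbb{H}^2=\mathbb{R}^4\times\mathbb{R}$ is identified with $\mathbb{R}^4$; its only characteristic point is $0$. $|\cdot|$ is the Euclidean norm, $dy$ is Lebesgue measure, and $M$ carries the measure $|y|\,dy$, with respect to which its homogeneous dimension is $Q=5$. The distance on $M$ is $$d(x,y)=\Big(|x-y|^4+4(x_1y_3-x_3y_1+x_2y_4-y_2x_4)^2\Big)^{1/4},$$ and $d^k(x,y)$ means $d(x,y)^k$; in particular $d(y,0)=|y|$. Vector fields in the variable $y$: $T_1=y_1\partial_{y_1}+y_2\partial_{y_2}+y_3\partial_{y_3}+y_4\partial_{y_4}$, $T_2=-y_4\partial_{y_1}+y_3\partial_{y_2}-y_2\partial_{y_3}+y_1\partial_{y_4}$, $T_3=-y_2\partial_{y_1}+y_1\partial_{y_2}+y_4\partial_{y_3}-y_3\partial_{y_4}$, and, for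 $y\neq0$, $Z_i=\frac{1}{|y|}T_i$ for $i=1,2,3$, which is an orthonormal basis of the horizontal tangent space of $M$ at $y$. Moreover $$Z_{4,y-x}=\frac1{|y|}\big(-(y-x)_3\partial_{y_1}-(y-x)_4\partial_{y_2}+(y-x)_1\partial_{y_3}+(y-x)_2\partial_{y_4}\big).$$ All derivatives are taken in the variable $y$, with $x$ fixed. $Z^*$ denotes the formal adjoint of a vector field $Z$ with respect to $dy$. The Laplace-type operator is $$\Delta_x=\sum_{i=1}^3\frac1{|y|}Z_i^*\big(|y|\,Z_i\big)+\frac1{|y|}Z_{4,y-x}^*\big(|y|\,Z_{4,y-x}\big).$$ The function $\Gamma$ is $$\Gamma(x,y)=\frac{1}{C_{\mathbb{H}\times\mathbb{R}}}\,d^{-Q+2}(x,y),\qquad C_{\mathbb{H}\times\mathbb{R}}=21\int_{\{x\in\mathbb{R}^4:\ (x_1^2+x_2^2+x_4^2)^2+x_3^2\le1\}}(x_2^2+x_4^2+x_1^2)\,dx.$$ The function $f_x$ is the remainder in the distributional identity $\Delta_x\Gamma(\cdot,x)=-\delta_x+f_x$ ($\delta_x$ the Dirac mass at $x$), that is, $f_x(y)=\Delta_x\Gamma(y,x)$ away from the pole $y=x$.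
   Formalization: The formula for u(x) is proved for x ≠ 0 only: at x = 0 the bounds force all K to vanish and the right side is (6π²/C_{H×R})u(0) ≠ u(0). Also Z* is taken as f ↦ +div(fZ), the sign that fits Δ_xΓ = −δ_x + f_x; with the usual adjoint sign the claim fails. *)

(* Defs.v *)
From HB Require Import structures.
From mathcomp Require Import all_boot all_order all_algebra.
From mathcomp Require Import all_classical all_reals all_analysis.
Set Implicit Arguments.
Unset Strict Implicit.
Unset Printing Implicit Defensive.
Import Order.TTheory GRing.Theory Num.Theory.
Import numFieldNormedType.Exports.
Local Open Scope classical_set_scope.
Local Open Scope ring_scope.

(* Points of M = R^4 are row vectors, with coordinates numbered from 1. *)
Definition crd (R : realType) (y : 'rV[R]_4) (k : nat) : R :=
  y ord0 (inord k.-1).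

Definition vec4 (R : realType) (a b c e : R) : 'rV[R]_4 :=
  \row_(j < 4) [:: a; b; c; e]`_j.

(* The library norm of 'rV[R]_4 is the sup norm; this is the Euclidean one. *)
Definition enorm (R : realType) (y : 'rV[R]_4) : R :=
  Num.sqrt (\sum_(1 <= k < 5) crd y k ^+ 2).

Definition Q : int := 5.

Definition dist (R : realType) (x y : 'rV[R]_4) : R :=
  (enorm (x - y) ^+ 4
   + 4 * (crd x 1 * crd y 3 - crd x 3 * crd y 1
          + crd x 2 * crd y 4 - crd y 2 * crd x 4) ^+ 2) `^ (4^-1).

(* Lebesgue measure on R^4 is the product measure on R * R * R * R, carried to
   row vectors by [point]. *)
Definition leb4 (R : realType) :=
  ((((@lebesgue_measure R) \x (@lebesgue_measure R))
     \x (@lebesgue_measure R)) \x (@lebesgue_measure R))%E.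

Definition point (R : realType) (p : R * R * R * R) : 'rV[R]_4 :=
  vec4 p.1.1.1 p.1.1.2 p.1.2 p.2.

Definition integrable4 (R : realType) (F : 'rV[R]_4 -> R) : Prop :=
  (@leb4 R).-integrable [set: _] (fun p => (F (point p))%:E).

Definition integral4 (R : realType) (D : set 'rV[R]_4) (F : 'rV[R]_4 -> R) : R :=
  \int[@leb4 R]_(p in [set p | D (point p)]) F (point p).

Definition CHR (R : realType) : R :=
  21 * integral4
    [set x : 'rV[R]_4 |
      (crd x 1 ^+ 2 + crd x 2 ^+ 2 + crd x 4 ^+ 2) ^+ 2 + crd x 3 ^+ 2 <= 1]
    (fun x => crd x 2 ^+ 2 + crd x 4 ^+ 2 + crd x 1 ^+ 2).

Definition Gam (R : realType) (x y : 'rV[R]_4) : R :=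
  (CHR R)^-1 * dist x y ^ (- Q + 2).

(* A vector field is the map sending y to its coefficient vector at y. *)
Definition vfield (R : realType) := 'rV[R]_4 -> 'rV[R]_4.

Definition vact (R : realType) (Z : vfield R) (f : 'rV[R]_4 -> R) :
  'rV[R]_4 -> R := fun y => 'D_(Z y) f y.

(* Z^* f = \sum_j d_j (Z_j f), so that \int (Z^* f) g dy = - \int f (Z g) dy:
   the adjoint is normalized by the sign for which Delta_x is a sum of squares
   plus lower order terms, the one compatible with
   Delta_x Gamma = - delta_x + f_x.  With the opposite sign Delta_x would be
   nonnegative and the Dirac mass would appear with a plus sign. *)
Definition vadj (R : realType) (Z : vfield R) (f : 'rV[R]_4 -> R) :
  'rV[R]_4 -> R :=
  fun y => \sum_(j < 4) 'D_(delta_mx ord0 j) (fun z => Z z ord0 j * f z) y.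

Definition T1 (R : realType) : vfield R := fun y =>
  vec4 (crd y 1) (crd y 2) (crd y 3) (crd y 4).
Definition T2 (R : realType) : vfield R := fun y =>
  vec4 (- crd y 4) (crd y 3) (- crd y 2) (crd y 1).
Definition T3 (R : realType) : vfield R := fun y =>
  vec4 (- crd y 2) (crd y 1) (crd y 4) (- crd y 3).

(* The index i : 'I_3 stands for i + 1 in {1, 2, 3}. *)
Definition T (R : realType) (i : 'I_3) : vfield R :=
  nth (@T1 R) [:: @T1 R; @T2 R; @T3 R] i.

Definition Z (R : realType) (i : 'I_3) : vfield R :=
  fun y => (enorm y)^-1 *: T i y.

Definition Z4 (R : realType) (x : 'rV[R]_4) : vfield R := fun y =>
  let h := y - x in
  (enorm y)^-1 *: vec4 (- crd h 3) (- crd h 4) (crd h 1) (crd h 2).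

Definition Delta (R : realType) (x : 'rV[R]_4) (f : 'rV[R]_4 -> R) :
  'rV[R]_4 -> R := fun y =>
  \sum_(i < 3)
    (enorm y)^-1 * vadj (Z i) (fun z => enorm z * vact (Z i) f z) y
  + (enorm y)^-1 * vadj (Z4 x) (fun z => enorm z * vact (Z4 x) f z) y.

Definition frem (R : realType) (x : 'rV[R]_4) : 'rV[R]_4 -> R :=
  Delta x (fun y => Gam y x).

Definition iter_partial (R : realType) (s : seq 'I_4) (u : 'rV[R]_4 -> R) :
  'rV[R]_4 -> R :=
  foldr (fun j (g : 'rV[R]_4 -> R) y => 'D_(delta_mx ord0 j) g y) u s.

Definition Cinfty0 (R : realType) (u : 'rV[R]_4 -> R) : Prop :=
  (forall (s : seq 'I_4) (y : 'rV[R]_4), differentiable (iter_partial s u) y)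
  /\ compact (closure [set y | u y != 0]).

(* Main.v *)
(* Write r = |y|, h = y - x, rho = d(x,y)^4, s = |x|^4, and fix x <> 0.  Only
   Z_i Gamma + K_i and f_x + K_0 enter the representation, so it is enough to
   represent u by kernels close to Z_i Gamma and f_x; in particular the value
   of C_{HxR} plays no role.
   The function Psi = (rho + s)^(-3/4) / C_{HxR} is smooth, so integration by
   parts gives 0 when Psi replaces Gamma, and the differences of the horizontal
   derivatives of Psi and Gamma already satisfy the two bounds.  The value u(x)
   comes from an explicit horizontal field a = sum_i a_i T_i, regularized by
   eps: its divergence is
     5 r^2 eps (rho + eps)^(-9/4) (rho + s)^(-1)
   plus a remainder, and the a_i and the remainder are bounded by a multiple of
   r / ((rho + eps) (rho + s)), hence by the locally integrable 1 / rho.  As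
   eps tends to 0 the leading term concentrates at x, with a mass bounded below
   by a multiple of |x|^-3; dividing by this mass yields u(x). *)
Require Import Defs.
From HB Require Import structures.
From mathcomp Require Import all_boot all_order all_algebra.
From mathcomp Require Import all_classical all_reals all_analysis.
From mathcomp Require Import measurable_realfun lebesgue_integral_fubini ring lra.
Set Implicit Arguments.
Unset Strict Implicit.
Unset Printing Implicit Defensive.
Import Order.TTheory GRing.Theory Num.Theory.
Import numFieldNormedType.Exports.
Local Open Scope classical_set_scope.
Local Open Scope ring_scope.

(** Origin of the field a. Put [Jz = (-z3, -z4, z1, z2)] and [w = <Jx, y>]. The vectors [T_1 y],
    [T_2 y], [T_3 y], [Jy] are orthogonal of length r, so [r^2 h = sum_i b_i T_i y + w Jy] with
    [b_i = <h, T_i y>]. Giving weight 1 to the first three directions and 2 to the last,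
    [X = sum_i b_i T_i + 2 w Jy] is r^2 times an approximate dilation about x: up to smaller terms
    [div X = 5 r^2] and [X rho = 4 r^2 rho], where 5 = 3 + 2 = Q. This is why the power -5/4 leaves
    only a divergence proportional to eps. The obstacle is that Jy is not horizontal, while only Z_1
    u, Z_2 u, Z_3 u may occur. Since [[T_2, T_3] = 2 Jy], the part along Jy can be exchanged for a
    horizontal field of the same divergence. The factor [(rho + s)^(-1)] serves the bounds: it is at
    most a multiple of [|x|^-1 r^-3], so that |x|^3 times the field is bounded by a multiple of
    [|x|^2 d^-4 r^-2]. Convergence of the masses is not established beforehand: the flux identity
    for a single u with u(x) nonzero implies it. *)

Definition irt {R : realType} (t : R) : R := t `^ (- 4^-1).

(** * Calculus of the inverse fourth root *)

Section InverseFourthRoot.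
Variable R : realType.
Implicit Types t : R.

Lemma irt_gt0 t : 0 < t -> 0 < irt t.
Proof. by move=> t0; rewrite /irt powR_gt0. Qed.

Lemma irt_ge0 t : 0 <= irt t.
Proof. exact: powR_ge0. Qed.

Lemma irtX t n : 0 < t -> irt t ^+ n = t `^ (- (n%:R / 4)).
Proof.
move=> t0; rewrite /irt -powR_mulrn ?powR_ge0// -powRrM; congr (_ `^ _); lra.
Qed.

Lemma irt4 t : 0 < t -> irt t ^+ 4 * t = 1.
Proof.
move=> t0; rewrite irtX//; have -> : - (4%:R / 4 : R) = - 1 by lra.
by rewrite powR_inv1 ?mulVf ?gt_eqF// ltW.
Qed.

(** [powR] sends 0 to 0 for a nonzero exponent, in agreement with [0^-1 = 0]; formulas such as
    [enorm_inv] and [dist0] therefore persist at the origin. *)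
Lemma irt0 : irt 0 = 0 :> R.
Proof. by rewrite /irt powR0//; apply/eqP; lra. Qed.

Lemma is_derive_irt t : 0 < t -> is_derive t 1 (@irt R) (- 4^-1 * irt t ^+ 5).
Proof.
move=> t0; have := is_derive1_powR (- 4^-1) t0.
by rewrite (irtX 5 t0); have -> : - 4^-1 - 1 = - (5%:R / 4) :> R by lra.
Qed.

Lemma diff_irt t v : 0 < t ->
  differentiable (@irt R) t /\ 'd (@irt R) t v = - 4^-1 * irt t ^+ 5 * v.
Proof.
move=> /is_derive_irt [dt Dt].
have dfl : differentiable (@irt R) t by apply/derivable1_diffP.
split=> //; rewrite [in LHS](_ : v = v *: (1 : R^o)); last by rewrite [RHS]mulr1.
by rewrite linearZ /= -deriveE// Dt [LHS]mulrC.
Qed.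

Lemma irt_le s t : 0 < s -> s <= t -> irt t <= irt s.
Proof.
move=> s0 st; have t0 : 0 < t by exact: lt_le_trans s0 st.
rewrite -(@ler_pXn2r _ 4) ?nnegrE ?irt_ge0//.
have /(canRL (mulfK (lt0r_neq0 t0))) -> := irt4 t0.
have /(canRL (mulfK (lt0r_neq0 s0))) -> := irt4 s0.
by rewrite !mul1r lef_pV2.
Qed.

End InverseFourthRoot.

(* A reified class of functions on R^4, closed under partial derivatives, in
   which derivatives are computed by reduction. *)
Inductive ex (R : Type) :=
  | EC of R | EX of nat | EAdd of ex R & ex R | EMul of ex R & ex R
  | EIrt of ex R.
Arguments EX {R}.

Declare Scope ex_scope.
Delimit Scope ex_scope with E4.
Bind Scope ex_scope with ex.
Notation "a + b" := (EAdd a b) : ex_scope.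
Notation "a * b" := (EMul a b) : ex_scope.

(** * Evaluation, smoothness and symbolic differentiation of expressions *)

Section Expressions.
Variable R : realType.
Implicit Types (e : ex R) (y v : 'rV[R]_4).

Fixpoint ev e y : R :=
  match e with
  | EC c => c
  | EX k => y ord0 (inord k)
  | EAdd a b => ev a y + ev b y
  | EMul a b => ev a y * ev b y
  | EIrt a => irt (ev a y)
  end.

(** The last case multiplies by [- 4^-1 * irt ^+ 5], the derivative of [t^(-1/4)], spelled out
    because expressions have no powers. [eqn] reduces on numerals, so evaluated derivatives contain
    no leftover tests. *)
Fixpoint dv e (k : nat) : ex R :=
  match e with
  | EC c => EC 0
  | EX j => EC (if eqn j k then 1 else 0)
  | EAdd a b => EAdd (dv a k) (dv b k)
  | EMul a b => EAdd (EMul (dv a k) b) (EMul a (dv b k))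
  | EIrt a => EMul (EMul (EC (- 4^-1)) (EMul (EIrt a) (EMul (EMul (EIrt a) (EIrt a))
                     (EMul (EIrt a) (EIrt a))))) (dv a k)
  end.

(* Where an expression is smooth: variables exist, radicands are positive. *)
Fixpoint ok e y : Prop :=
  match e with
  | EC c => True
  | EX k => (k < 4)%N
  | EAdd a b => ok a y /\ ok b y
  | EMul a b => ok a y /\ ok b y
  | EIrt a => ok a y /\ 0 < ev a y
  end.

Lemma ok_dv e y k : ok e y -> ok (dv e k) y.
Proof.
elim: e => //= [a iha b ihb [oa ob]|a iha b ihb [oa ob]|a iha [oa a0]].
- by split; auto.
- by split; split; auto.
- by do ![split=> //]; auto.
Qed.

Lemma big_ord4 (V : nmodType) (F : 'I_4 -> V) :
  \sum_(j < 4) F j = F (inord 0) + F (inord 1) + F (inord 2) + F (inord 3).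
Proof.
rewrite !big_ord_recl big_ord0 addr0 !addrA.
by congr (_ + _ + _ + _); congr F; apply/val_inj; rewrite /= inordK.
Qed.

Lemma inord_eq4 j k : (j < 4)%N -> (k < 4)%N ->
  ((inord j : 'I_4) == inord k) = eqn j k.
Proof.
by move: j k; do 5?[case=> //]; do 5?[case=> //] => _ _;
  rewrite -val_eqE /= !inordK.
Qed.

Lemma ev_diff e y v : ok e y ->
  differentiable (ev e) y /\
  'd (ev e) y v = \sum_(k < 4) v ord0 k * ev (dv e k) y.
Proof.
elim: e => [c|k|a iha b ihb|a iha b ihb|a iha].
- move=> _; have -> : ev (EC c) = cst c by [].
  split; first exact: differentiable_cst.
  by rewrite diff_cst big1 // => i _ /=; rewrite mulr0.
- move=> k4; have dk := @differentiable_coord R 1 4 y ord0 (inord k).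
  split=> //; rewrite -deriveE// -[ev (EX k)]/(fun N : 'rV[R]_4 => N ord0 (inord k)).
  have -> : 'D_v (fun N : 'rV[R]_4 => N ord0 (inord k)) y = v ord0 (inord k).
    have f_lin : linear (fun N : 'rV[R]_4 => N ord0 (inord k) : R^o).
      by move=> c p q; rewrite !mxE.
    pose f := GRing.isLinear.Build _ _ _ _ _ f_lin.
    pose L : {linear 'rV[R]_4 -> R^o} := HB.pack (fun N : 'rV[R]_4 => N ord0 (inord k) : R^o) f.
    rewrite deriveE // -[X in 'd X y]/(L : 'rV[R]_4 -> R^o) diff_lin//.
    exact: coord_continuous.
  rewrite /= (bigD1 (inord k))//= big1; last first.
    move=> i ik; rewrite [eqn k i](_ : _ = false) ?mulr0//.
    by apply/negbTE; apply: contra ik => /eqnP ->; rewrite inord_val.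
  by rewrite inordK// eqnE eqxx mulr1 addr0.
- move=> [/iha[da Da] /ihb[db Db]].
  have -> : ev (a + b)%E4 = ev a + ev b :> (_ -> R) by [].
  split; first exact: differentiableD.
  rewrite diffD// -[LHS]/('d (ev a) y v + 'd (ev b) y v) Da Db -big_split /=.
  by apply: eq_bigr => i _; rewrite /= mulrDr.
- move=> [/iha[da Da] /ihb[db Db]].
  have -> : ev (a * b)%E4 = ev a * ev b :> (_ -> R) by [].
  split; first exact: differentiableM.
  rewrite diffM// -[LHS]/(ev a y * 'd (ev b) y v + ev b y * 'd (ev a) y v) Da Db.
  rewrite !mulr_sumr -big_split; apply: eq_bigr => i _ /=; ring.
- move=> [/iha[da Da] a0].
  have [di Di] := diff_irt ('d (ev a) y v) a0.
  have -> : ev (EIrt a) = @irt R \o ev a by [].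
  split; first exact: differentiable_comp.
  rewrite diff_comp// -[LHS]/('d (@irt R) (ev a y) ('d (ev a) y v)) Di Da.
  by rewrite !mulr_sumr; apply: eq_bigr => i _ /=; ring.
Qed.

Lemma ev_differentiable e y : ok e y -> differentiable (ev e) y.
Proof. by move=> /(ev_diff 0)[]. Qed.

Lemma ev_derive e y v : ok e y ->
  'D_v (ev e) y = \sum_(k < 4) v ord0 k * ev (dv e k) y.
Proof. by move=> o; rewrite deriveE; [exact: (ev_diff v o).2|exact: ev_differentiable]. Qed.

Lemma ev_partial e y k : (k < 4)%N -> ok e y ->
  'D_(delta_mx ord0 (inord k)) (ev e) y = ev (dv e k) y.
Proof.
move=> k4 o; rewrite ev_derive// (bigD1 (inord k))//= big1 ?addr0 => [|i ik].
  by rewrite mxE !eqxx mul1r inordK.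
by rewrite mxE (negbTE ik) andbF mul0r.
Qed.

Lemma ev_continuous e y : ok e y -> {for y, continuous (ev e)}.
Proof. by move=> o; apply: differentiable_continuous; exact: ev_differentiable. Qed.

End Expressions.

(* [point] alone now denotes the default element of a pointed type. *)
Notation pt := Defs.point.

(** * Measurability of continuous functions on R^4 viewed as an iterated product *)

Section JointMeasurability.
Variable R : realType.

Lemma cvg_floor_div (t : R) :
  (Num.floor (n.+1%:R * t))%:~R / n.+1%:R @[n --> \oo] --> t.
Proof.
apply: (@squeeze_cvgr _ _ _ _ (fun n => t - n.+1%:R^-1) (cst t)).
- apply: nearW => n; rewrite ler_pdivrMr ?ltr0n// ler_pdivlMr ?ltr0n//.
  rewrite mulrBl mulVf ?pnatr_eq0//= [t * _]mulrC.
  rewrite floor_le ?num_real// andbT lerBlDr.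
  by rewrite ltW// (lt_le_trans (floorD1_gt _)) ?num_real// intrD.
- rewrite -[X in _ --> X]subr0; apply: cvgB; first exact: cvg_cst.
  exact: cvg_harmonic.
- exact: cvg_cst.
Qed.

Lemma measurable_floor_fiber (c : R) (k : int) : 0 < c ->
  measurable [set t : R | Num.floor (c * t) = k].
Proof.
move=> c0; rewrite [X in measurable X](_ : _ = `[(k%:~R / c), ((k + 1)%:~R / c)[%classic).
  exact: measurable_itv.
apply/seteqP; split => t /=; rewrite in_itv /= ler_pdivrMr// ltr_pdivlMr// mulrC.
- by move=> <-; rewrite floor_le ?num_real// floorD1_gt ?num_real.
- by move=> kt; apply: floor_def.
Qed.

(* Carathéodory functions are jointly measurable: round the second variable. *)
Lemma measurable_caratheodory d (A : measurableType d) (F : A * R -> R) :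
  (forall t, measurable_fun setT (fun a => F (a, t))) ->
  (forall a, continuous (fun t => F (a, t))) ->
  measurable_fun setT F.
Proof.
move=> mF cF.
pose h n (p : A * R) := F (p.1, (Num.floor (n.+1%:R * p.2))%:~R / n.+1%:R).
have cvgh (a : A) (t : R) : h n (a, t) @[n --> \oo] --> F (a, t).
  exact: (continuous_cvg _ (cF a t) (@cvg_floor_div t)).
apply: (@measurable_fun_cvg _ _ _ _ h) => [n _ B mB|[a t] _]; last first.
  exact: cvgh.
rewrite setTI [X in measurable X](_ : _ = \bigcup_(k : int)
  ([set a | B (F (a, k%:~R / n.+1%:R))] `*`
   [set t : R | Num.floor (n.+1%:R * t) = k])).
  apply: countable_bigcupT_measurable => // k; apply: measurableX.
    by have := mF (k%:~R / n.+1%:R) measurableT B mB; rewrite setTI.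
  by apply: measurable_floor_fiber; rewrite ltr0n.
apply/seteqP; split => [[a t] /= hB|[a t] [k _ [/= hB fk]]]; last by rewrite /h /preimage /= fk.
by exists (Num.floor (n.+1%:R * t)).
Qed.

Lemma continuous_slot (k : nat) (y : 'rV[R]_4) (f : 'rV[R]_4 -> R) :
  continuous f ->
  continuous (fun t => f (\row_j if j == inord k then t else y ord0 j)).
Proof.
move=> cf; pose row (s : R) : 'rV[R]_4 := \row_j if j == inord k then s else y ord0 j.
suff rowc (t : R) : row s @[s --> t] --> row t.
  by move=> t; exact: (continuous_cvg _ (cf _) (rowc t)).
move=> U [V nV VU]; apply: (@filterS _ _ _ [set s : R | forall i j,
  V i j (row s i j)]).
  by move=> s; exact: VU.
suff rV (i : 'I_1) (j : 'I_4) : \forall s \near t, V i j (row s i j).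
  have rV' i : \forall s \near t, forall j, V i j (row s i j).
    exact: (@filter_forall _ _ (fun j s => V i j (row s i j)) _ _ (rV i)).
  exact: (@filter_forall _ _ (fun i s => forall j, V i j (row s i j)) _ _ rV').
have rE s : row s i j = if j == inord k then s else y ord0 j by rewrite mxE.
have := nV i j; rewrite rE; case: ifP => jk Vy.
  by apply: filterS Vy => s; rewrite rE jk.
by apply: filterE => s; rewrite rE jk; exact: nbhs_singleton Vy.
Qed.

Lemma pt_coord (p : R * R * R * R) k : (k < 4)%N ->
  pt p ord0 (inord k) = [:: p.1.1.1; p.1.1.2; p.1.2; p.2]`_k.
Proof. by move=> k4; rewrite mxE inordK. Qed.

Lemma row4P (y z : 'rV[R]_4) :
  (forall k, (k < 4)%N -> y ord0 (inord k) = z ord0 (inord k)) -> y = z.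
Proof.
by move=> yz; apply/rowP => j; have := yz j (ltn_ord j); rewrite inord_val.
Qed.

(** Continuity refers to row vectors and measurability to nested pairs. The slots are freed one at a
    time by [measurable_caratheodory], until a continuous function of one real variable is left. *)
Lemma measurable_continuous (f : 'rV[R]_4 -> R) : continuous f ->
  measurable_fun setT (fun p => f (pt p)).
Proof.
move=> cf.
have slotE (k : nat) (q : R -> R * R * R * R) t : (k < 4)%N ->
    (forall s, [:: (q s).1.1.1; (q s).1.1.2; (q s).1.2; (q s).2]
      = set_nth 0 [:: (q t).1.1.1; (q t).1.1.2; (q t).1.2; (q t).2] k s) ->
    continuous (fun s => f (pt (q s))).
  move=> k4 qE; have := @continuous_slot k (pt (q t)) f cf.
  set g := (X in continuous X -> _); set g' := (X in _ -> continuous X).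
  have -> // : g = g'; apply/funext => s; congr f; apply: row4P => l l4.
  rewrite pt_coord// qE mxE inord_eq4// nth_set_nth /= pt_coord//.
apply: measurable_caratheodory => [d|q]; last by apply: (@slotE 3%N _ 0).
apply: (@measurable_caratheodory _ _ (fun p => f (pt (p, d)))) => [c|q]; last first.
  by apply: (@slotE 2%N (fun t => ((q, t), d)) 0).
apply: (@measurable_caratheodory _ _ (fun p => f (pt ((p, c), d)))) => [b|a]; last first.
  by apply: (@slotE 1%N (fun t => (((a, t), c), d)) 0).
apply: continuous_measurable_fun.
by apply: (@slotE 0%N (fun t => (((t, b), c), d)) 0).
Qed.

End JointMeasurability.

(** * Invariance of Lebesgue measure on R^4 under exchange of coordinates *)

Section SlotInvariance.
Local Open Scope ereal_scope.
Variable R : realType.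

(* Canonical structure inference finds for [m1 \x m2] only the instances meant
   for subprobabilities, hence this explicit packing. *)
Definition prod_sigma_finite d1 d2 (A : measurableType d1) (B : measurableType d2)
    (m1 : {sigma_finite_measure set A -> \bar R})
    (m2 : {sigma_finite_measure set B -> \bar R}) :
    {sigma_finite_measure set (A * B)%type -> \bar R} :=
  HB.pack (m1 \x m2)
   (@lebesgue_integral_fubini.measure_function_Measure_isSigmaFinite__to__measure_function_isSigmaFinite _ _ _ _ R m1 m2)
   (@lebesgue_integral_fubini.measure_function_Measure_isSigmaFinite__to__measure_function_isSFinite _ _ _ _ R m1 m2).

Local Notation L := (@lebesgue_measure R).
Local Notation MR := (measurableTypeR R).
Local Notation LL := (prod_sigma_finite L L).
Local Notation LLL := (prod_sigma_finite LL L).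
Local Notation R4 := (MR * MR * MR * MR)%type.

Lemma integral_swap (G : MR * MR -> \bar R) : measurable_fun setT G ->
  (forall p, 0 <= G p) ->
  \int[L \x L]_p G p = \int[L \x L]_p G (p.2, p.1).
Proof.
move=> mG G0.
have mG' : measurable_fun setT (fun p : MR * MR => G (p.2, p.1)).
  by apply: (measurableT_comp mG); exact: measurable_swap.
by rewrite (fubini_tonelli1 _ mG G0) (fubini_tonelli2 _ mG' (fun p => G0 (p.2, p.1))).
Qed.

Lemma integral_swap_last d (A : measurableType d)
    (m : {sigma_finite_measure set A -> \bar R}) (G : A * MR * MR -> \bar R) :
  measurable_fun setT G -> (forall p, 0 <= G p) ->
  \int[(m \x L) \x L]_p G p = \int[(m \x L) \x L]_p G ((p.1.1, p.2), p.1.2).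
Proof.
move=> mG G0.
have mG' : measurable_fun setT (fun p : A * MR * MR => G ((p.1.1, p.2), p.1.2)).
  apply: (measurableT_comp mG); apply: measurable_fun_pair => /=; last first.
    by apply: measurableT_comp; [exact: measurable_snd|exact: measurable_fst].
  apply: measurable_fun_pair; last exact: measurable_snd.
  by apply: measurableT_comp; [exact: measurable_fst|exact: measurable_fst].
have G0' (p : A * MR * MR) : 0 <= G ((p.1.1, p.2), p.1.2) by exact: G0.
have ige0 (H : A * MR * MR -> \bar R) : (forall p, 0 <= H p) ->
  forall q, 0 <= fubini_F L H q by move=> H0 q; apply: integral_ge0.
have mF := measurable_fun_fubini_tonelli_F (m2 := L) _ mG G0.
have mF' := measurable_fun_fubini_tonelli_F (m2 := L) _ mG' G0'.
have -> := fubini_tonelli1 (m1 := prod_sigma_finite m L) _ mG G0.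
have -> := fubini_tonelli1 (m1 := prod_sigma_finite m L) _ mG' G0'.
have -> := fubini_tonelli1 (m1 := m) _ mF (ige0 _ G0).
have -> := fubini_tonelli1 (m1 := m) _ mF' (ige0 _ G0').
apply: eq_integral => a _; rewrite /fubini_F/=.
apply: (fubini_tonelli (fun p : MR * MR => G ((a, p.1), p.2))) => //=.
apply: (measurableT_comp mG); apply: measurable_fun_pair => /=; last exact: measurable_snd.
by apply: measurable_fun_pair; [exact: measurable_cst|exact: measurable_fst].
Qed.

Definition swap34 (p : R4) : R4 := (p.1.1, p.2, p.1.2).
Definition swap23 (p : R4) : R4 := (p.1.1.1, p.1.2, p.1.1.2, p.2).
Definition swap12 (p : R4) : R4 := (p.1.1.2, p.1.1.1, p.1.2, p.2).

(* Exchanges slot [j] with the last one. *)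
Definition slot (j : nat) : R4 -> R4 :=
  match j with
  | 0 => swap12 \o (swap34 \o swap23 \o swap34) \o swap12
  | 1 => swap34 \o swap23 \o swap34
  | 2 => swap34
  | _ => id
  end.

Let m34 : measurable_fun setT swap34.
Proof.
apply: measurable_fun_pair => /=; last first.
  by apply: measurableT_comp; [exact: measurable_snd|exact: measurable_fst].
apply: measurable_fun_pair; last exact: measurable_snd.
by apply: measurableT_comp; [exact: measurable_fst|exact: measurable_fst].
Qed.

Let m23 : measurable_fun setT swap23.
Proof.
apply: measurable_fun_pair => /=; last exact: measurable_snd.
apply: measurable_fun_pair; last first.
  apply: measurableT_comp; [exact: measurable_snd|].
  by apply: measurableT_comp; [exact: measurable_fst|exact: measurable_fst].
apply: measurable_fun_pair; last first.
  by apply: measurableT_comp; [exact: measurable_snd|exact: measurable_fst].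
apply: measurableT_comp; [exact: measurable_fst|].
by apply: measurableT_comp; [exact: measurable_fst|exact: measurable_fst].
Qed.

Let m12 : measurable_fun setT swap12.
Proof.
apply: measurable_fun_pair => /=; last exact: measurable_snd.
apply: measurable_fun_pair; last first.
  by apply: measurableT_comp; [exact: measurable_snd|exact: measurable_fst].
have m11 : measurable_fun setT (fun p : R4 => p.1.1).
  by apply: measurableT_comp; [exact: measurable_fst|exact: measurable_fst].
apply: measurable_fun_pair.
  exact: (measurableT_comp measurable_snd m11).
exact: (measurableT_comp measurable_fst m11).
Qed.

Lemma measurable_slot j : measurable_fun setT (slot j).
Proof.
case: j => [|[|[|j]]].
- apply: (measurableT_comp (measurableT_comp m12 _) m12).
  exact: (measurableT_comp (measurableT_comp m34 m23) m34).
- exact: (measurableT_comp (measurableT_comp m34 m23) m34).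
- exact: m34.
- exact: measurable_id.
Qed.

Lemma ge0_integral_swap34 (F : R4 -> \bar R) : measurable_fun setT F ->
  (forall p, 0 <= F p) ->
  \int[@leb4 R]_p F p = \int[@leb4 R]_p F (swap34 p).
Proof. by move=> mF F0; exact: (integral_swap_last LL mF F0). Qed.

Lemma ge0_integral_swap23 (F : R4 -> \bar R) : measurable_fun setT F ->
  (forall p, 0 <= F p) ->
  \int[@leb4 R]_p F p = \int[@leb4 R]_p F (swap23 p).
Proof.
move=> mF F0.
have mF' : measurable_fun setT (F \o swap23) by exact: (measurableT_comp mF m23).
have -> := fubini_tonelli1 (m1 := LLL) (m2 := L) _ mF F0.
have -> := fubini_tonelli1 (m1 := LLL) (m2 := L) _ mF' (fun p => F0 (swap23 p)).
have mG := measurable_fun_fubini_tonelli_F (m2 := L) F mF F0.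
by apply: (integral_swap_last L mG) => p; apply: integral_ge0.
Qed.

Lemma ge0_integral_swap12 (F : R4 -> \bar R) : measurable_fun setT F ->
  (forall p, 0 <= F p) ->
  \int[@leb4 R]_p F p = \int[@leb4 R]_p F (swap12 p).
Proof.
move=> mF F0.
have mF' : measurable_fun setT (F \o swap12) by exact: (measurableT_comp mF m12).
have F0' p : 0 <= (F \o swap12) p by exact: F0.
have mG := measurable_fun_fubini_tonelli_F (m2 := L) F mF F0.
have mG' := measurable_fun_fubini_tonelli_F (m2 := L) _ mF' F0'.
have G0 q : 0 <= fubini_F L F q by apply: integral_ge0.
have G0' q : 0 <= fubini_F L (F \o swap12) q by apply: integral_ge0.
have -> := fubini_tonelli1 (m1 := LLL) (m2 := L) _ mF F0.
have -> := fubini_tonelli1 (m1 := LLL) (m2 := L) _ mF' F0'.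
have -> := fubini_tonelli1 (m1 := LL) (m2 := L) _ mG G0.
have -> := fubini_tonelli1 (m1 := LL) (m2 := L) _ mG' G0'.
have mH := measurable_fun_fubini_tonelli_F (m2 := L) _ mG G0.
by apply: (integral_swap mH) => p; apply: integral_ge0.
Qed.

(** Integration by parts and the estimates near the pole both single out one coordinate; in the last
    slot it becomes the inner variable of Tonelli's theorem. *)
Lemma ge0_integral_slot j (F : R4 -> \bar R) : measurable_fun setT F ->
  (forall p, 0 <= F p) ->
  \int[@leb4 R]_p F p = \int[@leb4 R]_p F (slot j p).
Proof.
move=> mF F0.
have slot1 (G : R4 -> \bar R) : measurable_fun setT G -> (forall p, 0 <= G p) ->
    \int[@leb4 R]_p G p = \int[@leb4 R]_p G ((swap34 \o swap23 \o swap34) p).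
  move=> mG G0; rewrite (ge0_integral_swap34 mG G0).
  have mG1 : measurable_fun setT (G \o swap34) by exact: (measurableT_comp mG m34).
  rewrite (ge0_integral_swap23 mG1 (fun p => G0 _)).
  have mG2 : measurable_fun setT (G \o swap34 \o swap23) by exact: (measurableT_comp mG1 m23).
  by rewrite (ge0_integral_swap34 mG2 (fun p => G0 _)).
case: j => [|[|[|j]]].
- rewrite (ge0_integral_swap12 mF F0).
  have mF1 : measurable_fun setT (F \o swap12) by exact: (measurableT_comp mF m12).
  rewrite (slot1 _ mF1 (fun p => F0 _)).
  have mF2 : measurable_fun setT (F \o (swap12 \o (swap34 \o swap23 \o swap34))).
    exact: (measurableT_comp mF1 (measurableT_comp (measurableT_comp m34 m23) m34)).
  by rewrite (ge0_integral_swap12 mF2 (fun p => F0 _)).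
- exact: slot1.
- exact: ge0_integral_swap34.
- by [].
Qed.

Lemma integral_slot j (F : R4 -> \bar R) : measurable_fun setT F ->
  \int[@leb4 R]_p F p = \int[@leb4 R]_p F (slot j p).
Proof.
move=> mF; rewrite integralE [RHS]integralE.
congr (_ - _); (etransitivity; last first).
- by apply: eq_integral => p _; rewrite [RHS]funeposE -funeposE.
- exact: (ge0_integral_slot j (measurable_funepos mF) (fun p => funepos_ge0 F p)).
- by apply: eq_integral => p _; rewrite [RHS]funenegE -funenegE.
- exact: (ge0_integral_slot j (measurable_funeneg mF) (fun p => funeneg_ge0 F p)).
Qed.

End SlotInvariance.

(** * Boxes, and integrals of partial derivatives with compact support *)

Section Integration.
Variable R : realType.
Local Notation L := (@lebesgue_measure R).
Local Notation MR := (measurableTypeR R).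
Local Notation LL := (prod_sigma_finite L L).
Local Notation LLL := (prod_sigma_finite LL L).
Local Notation R4 := (MR * MR * MR * MR)%type.
Implicit Types (y : 'rV[R]_4) (F : 'rV[R]_4 -> R).

Definition box (B : R) : set 'rV[R]_4 :=
  [set y | forall k, (k < 4)%N -> `|y ord0 (inord k)| <= B].

Definition cube (B : R) : set R4 :=
  ((`[- B, B] `*` `[- B, B]) `*` `[- B, B]) `*` `[- B, B].

Lemma cubeP B p : cube B p <-> box B (pt p).
Proof.
rewrite /cube /box /=; split.
- by case=> [[[h0 h1] h2] h3] [|[|[|[|//]]]] _; rewrite pt_coord//= ler_norml; [move: h0|move: h1|move: h2|move: h3]; rewrite /= in_itv.
- move=> h; have hk k (k4 : (k < 4)%N) := h k k4.
  have := (hk 0%N isT, hk 1%N isT, hk 2%N isT, hk 3%N isT).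
  rewrite !pt_coord//= !ler_norml => -[[[h0 h1] h2] h3].
  by do ![split]; rewrite /= in_itv.
Qed.

Lemma measurable_cube B : measurable (cube B).
Proof. by do ![apply: measurableX => //]. Qed.

Lemma cube_fin B : (@leb4 R (cube B) < +oo)%E.
Proof.
pose I := (`[- B, B]%classic : set MR).
have mI : measurable I by exact: measurable_itv.
have LI : (L I < +oo)%E.
  by rewrite lebesgue_measure_itv /=; case: ifP => _; rewrite ?ltry// -EFinB ltry.
have mI2 := measurableX mI mI; have mI3 := measurableX mI2 mI.
have -> : @leb4 R (cube B) = (LLL ((I `*` I) `*` I) * L I)%E.
  exact: (product_measure1E LLL L mI3 mI).
have -> : LLL ((I `*` I) `*` I) = (LL (I `*` I) * L I)%E.
  exact: (product_measure1E LL L mI2 mI).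
have -> : LL (I `*` I) = (L I * L I)%E by exact: (product_measure1E L L mI mI).
have LIf : L I \is a fin_num by rewrite ge0_fin_numE.
by rewrite ltey_eq !fin_numM.
Qed.

Lemma integrable_box F B M : measurable_fun setT (F \o @pt R) ->
  (forall y, box B y -> `|F y| <= M) -> (forall y, ~ box B y -> F y = 0) ->
  integrable4 F.
Proof.
move=> mF FM F0; rewrite /integrable4.
have -> : (fun p => (F (pt p))%:E) = (EFin \o (F \o @pt R)) \_ (cube B).
  apply/funext => p; rewrite /patch; case: ifPn => // pB.
  by rewrite F0// => /cubeP/mem_set; rewrite (negbTE pB).
apply/(integrable_mkcond _ (measurable_cube B)).
apply: measurable_bounded_integrable; first exact: measurable_cube.
- exact: cube_fin.
- exact: measurable_funTS.
exists M; split; first exact: num_real.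
by move=> c Mc p /= /cubeP pB; apply: le_trans (FM _ pB) (ltW Mc).
Qed.

Lemma integral_deriv_compact (f df : R -> R) (B : R) : 0 <= B ->
  (forall t : R, is_derive t (1 : R) f (df t)) -> continuous df ->
  (forall t, B < `|t| -> f t = 0 /\ df t = 0) ->
  (\int[L]_t (df t)%:E = 0)%E.
Proof.
(* [f] is known to vanish only for [B < |t|], strictly, so the endpoints of the interval are moved
   outwards. *)
move=> B0 fdf cdf f0; pose a := B + 1.
have aB : B < a by rewrite /a ltrDl.
have a0 : 0 < a by exact: le_lt_trans B0 aB.
have dff (t : R) : derivable f t (1 : R) by have [] := fdf t.
have cf : continuous f by move=> t; apply: differentiable_continuous; apply/derivable1_diffP.
transitivity (\int[L]_(t in `[(- a)%R, a]) (df t)%:E)%E.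
  rewrite [RHS]integral_mkcond; apply: eq_integral => t _.
  rewrite /patch; case: ifPn => //; rewrite notin_setE /= in_itv /= -ler_norml.
  by move/negP; rewrite -ltNge => ta; rewrite (f0 t _).2// (lt_trans aB).
rewrite (@continuous_FTC2 _ _ f)//.
- by rewrite (f0 a _).1 ?(f0 (- a) _).1 ?subee// ?normrN gtr0_norm.
- by rewrite (lt_trans _ a0)// oppr_lt0.
- by apply: continuous_subspaceT.
- split; first by move=> t _; exact: dff.
  + by apply: cvg_at_right_filter; exact: cf.
  + by apply: cvg_at_left_filter; exact: cf.
- by move=> t _; rewrite derive1E; have [_ ->] := fdf t.
Qed.

Lemma pt_slot_coord j (p : R4) k : (j < 4)%N -> (k < 4)%N ->
  pt (slot j p) ord0 (inord k) =
    if k == j then p.2 else if k == 3%N then pt p ord0 (inord j) else pt p ord0 (inord k).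
Proof.
move=> j4 k4; rewrite !pt_coord//.
by move: j j4 k k4; do 4?[case=> [|]//]; move=> _; do 4?[case=> [|]//].
Qed.

Lemma pt_slotE j (q : MR * MR * MR) (t : MR) : (j < 4)%N ->
  pt (slot j (q, t)) = pt (slot j (q, 0)) + t *: delta_mx ord0 (inord j).
Proof.
move=> j4; apply: row4P => k k4;
rewrite [RHS]mxE [X in _ = _ + X]mxE [X in _ = _ + _ * X]mxE eqxx /= inord_eq4//.
rewrite !pt_slot_coord// !pt_coord//.
case: j j4 => [|[|[|[|//]]]] _; case: k k4 => [|[|[|[|//]]]] _ //=;
  by rewrite ?mulr0 ?mulr1 ?addr0 ?add0r.
Qed.

Lemma measurable_pt_slot j F : measurable_fun setT (F \o @pt R) ->
  measurable_fun setT (fun p : R4 => F (pt (slot j p))).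
Proof. by move=> mF; exact: (measurableT_comp mF (@measurable_slot R j)). Qed.

Lemma is_derive_line (g : 'rV[R]_4 -> R) z v (t : R) : differentiable g (z + t *: v) ->
  is_derive t (1 : R) (fun s : R => g (z + s *: v)) ('D_v g (z + t *: v)).
Proof.
move=> dg; have dgv : derivable g (z + t *: v) v by exact: diff_derivable.
have E : (fun h : R => h^-1 *: (((fun s : R => g (z + s *: v)) \o shift t) (h *: 1) - g (z + t *: v)))
    = (fun h : R => h^-1 *: ((g \o shift (z + t *: v)) (h *: v) - g (z + t *: v))).
  apply/funext => h; congr (_ *: (g _ - _)).
  by rewrite /= [h *: 1]mulr1 scalerDl addrCA.
by split; [rewrite /derivable E|rewrite /derive E].
Qed.

(** After [slot j] the differentiated direction is the inner variable of Fubini's theorem, and each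
    inner integral is that of the derivative of a compactly supported function of one variable. *)
Lemma integral_partial0 (j : nat) (g dg : 'rV[R]_4 -> R) B : (j < 4)%N -> 0 <= B ->
  (forall y, differentiable g y /\ 'D_(delta_mx ord0 (inord j)) g y = dg y) ->
  continuous dg -> (forall y, ~ box B y -> g y = 0 /\ dg y = 0) ->
  integrable4 dg -> (\int[@leb4 R]_p (dg (pt p))%:E = 0)%E.
Proof.
move=> j4 B0 gdg cdg g0 idg.
have mdg := measurable_continuous cdg.
have mdgE : measurable_fun setT (fun p : R4 => (dg (pt p))%:E) by exact/measurable_EFinP.
rewrite (integral_slot j mdgE).
have mdgs := measurable_pt_slot j mdg.
have idgs : (@leb4 R).-integrable setT (fun p : R4 => (dg (pt (slot j p)))%:E).
  apply/integrableP; split; first exact/measurable_EFinP.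
  have /integrableP[_] := idg; congr (_ < _)%E.
  apply: (ge0_integral_slot j) => //.
  by apply/measurable_EFinP; exact: measurableT_comp.
have <- := integral12_prod_meas1 (m1 := LLL) (m2 := L) idgs.
apply: integral0_eq => q _; rewrite /fubini_F.
pose v : 'rV[R]_4 := delta_mx ord0 (inord j); pose z := pt (slot j (q, 0)).
have ptE t : pt (slot j (q, t)) = z + t *: v by exact: pt_slotE.
have zt t : B < `|t| -> ~ box B (z + t *: v).
  move=> Bt /(_ j j4); rewrite -ptE pt_slot_coord// eqxx /=.
  by rewrite leNgt Bt.
under eq_integral do rewrite ptE.
apply: (@integral_deriv_compact (fun t => g (z + t *: v)) (fun t => dg (z + t *: v)) B) => //.
- by move=> t; have [dg1 <-] := gdg (z + t *: v); exact: is_derive_line.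
- move=> t; apply: (@continuous_cvg _ _ _ _ _ _ dg); first exact: cdg.
  apply: cvgD; first exact: cvg_cst.
  by apply: cvgZr_tmp; exact: cvg_id.
- by move=> t Bt; apply: g0; exact: zt.
Qed.

End Integration.

(** * Test functions and the divergence formula *)

Section TestFunctions.
Variable R : realType.
Implicit Types (y : 'rV[R]_4) (u : 'rV[R]_4 -> R) (F : nat -> ex R).

Definition par (k : nat) u : 'rV[R]_4 -> R :=
  fun y => 'D_(delta_mx ord0 (inord k)) u y.

(** The support is controlled by an explicit box and not by a compact closure: [B] enters the
    estimates and can be enlarged at will. *)
Definition C1c (B : R) u : Prop :=
  [/\ 0 <= B, forall y, differentiable u y,
      forall k, (k < 4)%N -> continuous (par k u)
    & forall y, ~ box B y -> u y = 0].

Lemma box_compact (B : R) : compact (@box R B).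
Proof.
have -> : @box R B = [set v : 'rV[R]_4 | forall i, `[- B, B]%classic (v ord0 i)].
  apply/seteqP; split => v /= h.
    by move=> i; have := h i (ltn_ord i); rewrite inord_val in_itv /= ler_norml.
  by move=> k _; have := h (inord k); rewrite /= in_itv /= ler_norml.
apply: (@rV_compact _ 4 (fun=> `[- B, B]%classic)) => i; exact: segment_compact.
Qed.

Lemma not_box_open (B : R) y : ~ box B y -> \forall z \near y, ~ box B z.
Proof.
move=> /existsNP[k] /not_implyP[k4] /negP; rewrite -ltNge => Bk.
have ck : {for y, continuous (fun z : 'rV[R]_4 => `|z ord0 (inord k)|)}.
  apply: (@continuous_comp _ _ _ (fun z : 'rV[R]_4 => z ord0 (inord k)) Num.norm).
    exact: coord_continuous.
  exact: norm_continuous.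
apply: (@filterS _ _ (nbhs_filter y) _ _ _ (cvgr_gt _ ck _ Bk)) => z Bz /(_ k k4).
by rewrite leNgt Bz.
Qed.

Lemma Cinfty0_C1c u : Cinfty0 u -> exists B, C1c B u.
Proof.
move=> [du cu].
have [M [Mr MP]] := compact_bounded cu.
pose B := `|M| + 1.
have BP y : ~ box B y -> u y = 0.
  move=> By; apply: contrapT => /eqP uy; apply: By => k k4.
  have /(_ B) := MP; rewrite /globally /=.
  have -> : M < B by rewrite /B (le_lt_trans (ler_norm _))// ltrDl.
  move=> /(_ isT y) h; apply: le_trans (h _).
    rewrite [leRHS]mx_normrE; exact: (le_bigmax _ (fun ij => `|y ij.1 ij.2|) (ord0, inord k)).
  by apply: subset_closure.
exists B; split => //.
- by rewrite /B addr_ge0.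
- by move=> y; exact: (du [::] y).
- by move=> k k4 y; apply: differentiable_continuous; exact: (du [:: inord k] y).
Qed.

Lemma C1c_par B u k y : C1c B u -> ~ box B y -> par k u y = 0.
Proof.
move=> [_ _ _ u0] By; rewrite /par (@near_eq_derive _ _ _ u (cst 0)) ?derive_cst//.
by apply: (@filterS _ _ (nbhs_filter y) _ _ _ (not_box_open By)) => z; exact: u0.
Qed.

Lemma compact_support_bounded (f : 'rV[R]_4 -> R) (B : R) : 0 <= B -> continuous f ->
  (forall y, ~ box B y -> f y = 0) -> exists2 M, 0 <= M & forall y, `|f y| <= M.
Proof.
move=> B0 cf f0.
have cnf : continuous (fun y => `|f y|).
  by move=> y; apply: continuous_comp; [exact: cf|exact: norm_continuous].
have b0 : @box R B !=set0 by exists 0 => k _; rewrite mxE normr0.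
have [c _ cP] := EVT_max_rV b0 (@box_compact B) (continuous_subspaceT cnf).
exists `|f c| => // y.
by case: (pselect (box B y)) => [By|/f0 ->]; [apply: cP; rewrite inE|rewrite normr0].
Qed.

Lemma C1c_bounded B u : C1c B u -> exists2 M, 0 <= M &
  forall y, `|u y| <= M /\ forall k, (k < 4)%N -> `|par k u y| <= M.
Proof.
move=> uC; have [B0 du pu u0] := uC.
have cu : continuous u by move=> y; exact: differentiable_continuous.
have [M M0 uM] := compact_support_bounded B0 cu u0.
have H k (k4 : (k < 4)%N) := compact_support_bounded B0 (pu k k4) (fun y => @C1c_par B u k y uC).
have [M1 M10 p0] := H 0%N isT; have [M2 M20 p1] := H 1%N isT.
have [M3 M30 p2] := H 2%N isT; have [M4 M40 p3] := H 3%N isT.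
exists (M + M1 + M2 + M3 + M4); first by rewrite !addr_ge0.
move=> y; split; first by have := uM y; lra.
case=> [|[|[|[|//]]]] _.
- by have := p0 y; lra.
- by have := p1 y; lra.
- by have := p2 y; lra.
- by have := p3 y; lra.
Qed.

Lemma derive_par u y v : differentiable u y ->
  'D_v u y = \sum_(k < 4) v ord0 k * par k u y.
Proof.
move=> du; rewrite deriveE// [in LHS](row_sum_delta v) linear_sum.
apply: eq_bigr => k _; rewrite linearZ /= /par inord_val deriveE//.
Qed.

Lemma integrable_continuous (f : 'rV[R]_4 -> R) (B : R) : 0 <= B -> continuous f ->
  (forall y, ~ box B y -> f y = 0) -> integrable4 f.
Proof.
move=> B0 cf f0; have [M _ fM] := compact_support_bounded B0 cf f0.
by apply: (@integrable_box _ f B M) => //; exact: measurable_continuous.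
Qed.

(** Each summand over [k] is the exact k-th partial derivative of [ev (F k) * u], hence has integral
    0. *)
Lemma divergence_formula B u F : C1c B u ->
  (forall k y, (k < 4)%N -> ok (F k) y) ->
  integral4 [set: _] (fun y => \sum_(k < 4) ev (F k) y * par k u y
     + (\sum_(k < 4) ev (dv (F k) k) y) * u y) = 0.
Proof.
move=> uC okF; have [B0 du pu u0] := uC.
have cu : continuous u by move=> y; exact: differentiable_continuous.
have cev e : (forall y, ok e y) -> continuous (ev e) by move=> oe y; exact: ev_continuous.
pose dg k := fun y => ev (F k) y * par k u y + ev (dv (F k) k) y * u y.
have cdg k : (k < 4)%N -> continuous (dg k).
  move=> k4 y; apply: (@continuousD _ _ _ (fun y => ev (F k) y * par k u y)
    (fun y => ev (dv (F k) k) y * u y)); apply: continuousM.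
  - by apply: cev => z; exact: okF.
  - exact: pu.
  - by apply: cev => z; apply: ok_dv; exact: okF.
  - exact: cu.
have dg0 k y : ~ box B y -> dg k y = 0.
  by move=> By; rewrite /dg (C1c_par k uC By) (u0 _ By) !mulr0 addr0.
have idg k : (k < 4)%N -> integrable4 (dg k).
  by move=> k4; apply: integrable_continuous B0 (cdg k k4) _ => y; exact: dg0.
have Idg k : (k < 4)%N -> (\int[@leb4 R]_p (dg k (pt p))%:E = 0)%E.
  move=> k4; apply: (@integral_partial0 _ k (fun y => ev (F k) y * u y) _ B) => //.
  - move=> y; have dF : differentiable (ev (F k)) y by apply: ev_differentiable; exact: okF.
    have dFu : differentiable (fun y => ev (F k) y * u y) y by exact: differentiableM.
    split=> //.
    rewrite (@deriveM _ _ (ev (F k)) u); [|exact: diff_derivable|exact: diff_derivable].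
    rewrite ev_partial//; last exact: okF.
    by rewrite /dg /par; congr (_ + _); exact: mulrC.
  - exact: cdg.
  - by move=> y By; rewrite u0// mulr0 dg0.
  - exact: idg.
rewrite /integral4 /Rintegral.
have -> : (\int[@leb4 R]_(p in [set p | [set: 'rV[R]_4] (pt p)])
   (\sum_(k < 4) ev (F k) (pt p) * par k u (pt p) + (\sum_(k < 4) ev (dv (F k) k) (pt p)) * u (pt p))%:E
   = \int[@leb4 R]_p \sum_(k < 4) (dg k (pt p))%:E)%E.
  apply: eq_integral => p _; rewrite mulr_suml -big_split /=.
  by rewrite -sumEFin.
rewrite integral_sum//; first by rewrite big1// => k _; exact: Idg.
by move=> k; exact: idg.
Qed.

End TestFunctions.

(** * Derivatives of expressions along vector fields *)

Section LieDerivative.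
Variable R : realType.
Implicit Types (e g : ex R) (c : nat -> ex R) (y : 'rV[R]_4).

(* Lie derivative along the vector field with coefficients [c]. *)
Fixpoint ld c e : ex R :=
  match e with
  | EC _ => EC 0
  | EX k => c k
  | EAdd a b => EAdd (ld c a) (ld c b)
  | EMul a b => EAdd (EMul (ld c a) b) (EMul a (ld c b))
  | EIrt a => EMul (EMul (EC (- 4^-1)) (EMul (EIrt a) (EMul (EMul (EIrt a) (EIrt a))
                     (EMul (EIrt a) (EIrt a))))) (ld c a)
  end.

Lemma ev_ld c e y : ok e y ->
  ev (ld c e) y = \sum_(k < 4) ev (c k) y * ev (dv e k) y.
Proof.
elim: e => [r|j|a iha b ihb|a iha b ihb|a iha] /=.
- by rewrite big1 // => k _; rewrite mulr0.
- move=> j4; rewrite (bigD1 (Ordinal j4))//= eqnE eqxx mulr1 big1 ?addr0// => k kj.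
  by move: kj; rewrite -val_eqE /= eq_sym => /negbTE ->; rewrite mulr0.
- move=> [/iha -> /ihb ->]; rewrite -big_split /=.
  by apply: eq_bigr => k _; ring.
- move=> [/iha -> /ihb ->]; rewrite mulr_suml mulr_sumr -big_split /=.
  by apply: eq_bigr => k _; ring.
- move=> [/iha -> _]; rewrite mulr_sumr.
  by apply: eq_bigr => k _; ring.
Qed.

Lemma ok_ld c e y : (forall k, (k < 4)%N -> ok (c k) y) -> ok e y -> ok (ld c e) y.
Proof.
move=> oc; elim: e => //= [a iha b ihb [oa ob]|a iha b ihb [oa ob]|a iha [oa a0]].
- by split; auto.
- by do ![split]; auto.
- by do ![split=> //]; auto.
Qed.

Lemma div_mul c g y : (forall k, (k < 4)%N -> ok (c k) y) -> ok g y ->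
  \sum_(k < 4) ev (dv (c k * g)%E4 k) y =
  ev (ld c g) y + (\sum_(k < 4) ev (dv (c k) k) y) * ev g y.
Proof.
move=> oc og; rewrite ev_ld// mulr_suml -big_split /=.
by apply: eq_bigr => k _; rewrite addrC.
Qed.

End LieDerivative.

(** * Algebraic invariants of the fields T_1, T_2, T_3 and Z_4 *)

Section Geometry.
Variable R : realType.
Implicit Types (x y : 'rV[R]_4) (k : nat).

Local Notation co x k := ((x : 'rV[R]_4) ord0 (inord k)).

Definition hE x k : ex R := (EX k + EC (- co x k))%E4.
Definition hsqE x : ex R :=
  (hE x 0 * hE x 0 + hE x 1 * hE x 1 + hE x 2 * hE x 2 + hE x 3 * hE x 3)%E4.
(** The symplectic form [<Jx, y>]. As [<Jx, x> = 0], it also equals [<Jx, h>], and as [<Jy, y> = 0],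
    it equals [<h, Jy>]; it is thus small both near [x] and near the origin. *)
Definition omE x : ex R :=
  (EC (co x 0) * EX 2 + EC (- co x 2) * EX 0 + EC (co x 1) * EX 3 + EC (- co x 3) * EX 1)%E4.
Definition rhoE x : ex R := (hsqE x * hsqE x + EC 4 * (omE x * omE x))%E4.
Definition rsqE : ex R := (EX 0 * EX 0 + EX 1 * EX 1 + EX 2 * EX 2 + EX 3 * EX 3)%E4.
Definition xhE x : ex R :=
  (EC (co x 0) * hE x 0 + EC (co x 1) * hE x 1 + EC (co x 2) * hE x 2 + EC (co x 3) * hE x 3)%E4.
Definition msq x : R := co x 0 ^+ 2 + co x 1 ^+ 2 + co x 2 ^+ 2 + co x 3 ^+ 2.

Local Notation nE k := (EC (-1) * EX k)%E4.

(* Coefficients of T_1, T_2, T_3 and of |y| Z_{4,y-x}. *)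
Definition tc (i : nat) : nat -> ex R := nth (fun=> EC 0)
  [:: nth (EC 0) [:: EX 0; EX 1; EX 2; EX 3];
      nth (EC 0) [:: nE 3; EX 2; nE 1; EX 0];
      nth (EC 0) [:: nE 1; EX 0; EX 3; nE 2]] i.
Definition wc x : nat -> ex R := nth (EC 0)
  [:: (EC (-1) * hE x 2)%E4; (EC (-1) * hE x 3)%E4; hE x 0; hE x 1].

(* <h, T_i y> and <Jh, T_i y>, where |y| Z_4 = Jh. *)
Definition bE x i : ex R :=
  (hE x 0 * tc i 0 + hE x 1 * tc i 1 + hE x 2 * tc i 2 + hE x 3 * tc i 3)%E4.
Definition cE x i : ex R :=
  (wc x 0 * tc i 0 + wc x 1 * tc i 1 + wc x 2 * tc i 2 + wc x 3 * tc i 3)%E4.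

Lemma rsq_eq x y : ev rsqE y = msq x + 2 * ev (xhE x) y + ev (hsqE x) y.
Proof. rewrite /= /msq; ring. Qed.

Lemma b0_eq x y : ev (bE x 0) y = ev (xhE x) y + ev (hsqE x) y.
Proof. rewrite /=; ring. Qed.

(** [Jy] is orthogonal to every [T_i y], so [<Jx, T_i y> = - <Jh, T_i y>]. *)
Lemma ld_om x i y : (i < 3)%N -> ev (ld (tc i) (omE x)) y = - ev (cE x i) y.
Proof. by case: i => [|[|[|//]]] _ /=; ring. Qed.

Lemma ld_hsq x i y : (i < 3)%N -> ev (ld (tc i) (hsqE x)) y = 2 * ev (bE x i) y.
Proof. by case: i => [|[|[|//]]] _ /=; ring. Qed.

Lemma c0_eq x y : ev (cE x 0) y = - ev (omE x) y.
Proof. rewrite /=; ring. Qed.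

(** Parseval in the orthogonal basis [T_1 y, T_2 y, T_3 y, Jy] of vectors of length [|y|]: here for
    [h], whose product with [Jy] is [w]; in [sum_c2] for [Jh], with [<Jh, Jy> = <h, y>]; in [sum_bc]
    for the pair, with [<h, Jh> = 0]. *)
Lemma sum_b2 x y : ev (bE x 0) y ^+ 2 + ev (bE x 1) y ^+ 2 + ev (bE x 2) y ^+ 2
  = ev rsqE y * ev (hsqE x) y - ev (omE x) y ^+ 2.
Proof. rewrite /=; ring. Qed.

Lemma sum_c2 x y : ev (cE x 0) y ^+ 2 + ev (cE x 1) y ^+ 2 + ev (cE x 2) y ^+ 2
  = ev rsqE y * ev (hsqE x) y - (ev (xhE x) y + ev (hsqE x) y) ^+ 2.
Proof. rewrite /=; ring. Qed.

Lemma sum_bc x y : ev (bE x 0) y * ev (cE x 0) y + ev (bE x 1) y * ev (cE x 1) y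
    + ev (bE x 2) y * ev (cE x 2) y
  = - ev (omE x) y * (ev (xhE x) y + ev (hsqE x) y).
Proof. rewrite /=; ring. Qed.

Lemma ldld_hsq x y : ev (ld (tc 0) (ld (tc 0) (hsqE x))) y
    + ev (ld (tc 1) (ld (tc 1) (hsqE x))) y + ev (ld (tc 2) (ld (tc 2) (hsqE x))) y
  = 6 * ev rsqE y - 2 * ev (bE x 0) y.
Proof. rewrite /=; ring. Qed.

Lemma ldld_om x y : ev (ld (tc 0) (ld (tc 0) (omE x))) y
    + ev (ld (tc 1) (ld (tc 1) (omE x))) y + ev (ld (tc 2) (ld (tc 2) (omE x))) y
  = - ev (omE x) y.
Proof. rewrite /=; ring. Qed.

Lemma wc_om x y : ev (ld (wc x) (omE x)) y = ev (xhE x) y.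
Proof. rewrite /=; ring. Qed.

Lemma wc_xh x y : ev (ld (wc x) (ld (wc x) (omE x))) y = - ev (omE x) y.
Proof. rewrite /=; ring. Qed.

Lemma wc_hsq x y : ev (ld (wc x) (hsqE x)) y = 0.
Proof. rewrite /=; ring. Qed.

Lemma wc_wc_hsq x y : ev (ld (wc x) (ld (wc x) (hsqE x))) y = 0.
Proof. rewrite /=; ring. Qed.

Lemma wc_rsq x y : ev (ld (wc x) rsqE) y = - 2 * ev (omE x) y.
Proof. rewrite /=; ring. Qed.

Lemma tc_rsq i y : (i < 3)%N ->
  ev (ld (tc i) rsqE) y = if i == 0%N then 2 * ev rsqE y else 0.
Proof. by case: i => [|[|[|//]]] _ /=; ring. Qed.

(* [T_2, T_3] = 2 Jy. *)
Lemma commutator_om x y :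
  ev (ld (tc 1) (ld (tc 2) (omE x))) y - ev (ld (tc 2) (ld (tc 1) (omE x))) y
  = 2 * (ev (xhE x) y + msq x).
Proof. rewrite /= /msq; ring. Qed.

Lemma commutator_hsq x y :
  ev (ld (tc 1) (ld (tc 2) (hsqE x))) y - ev (ld (tc 2) (ld (tc 1) (hsqE x))) y
  = 4 * ev (omE x) y.
Proof. rewrite /=; ring. Qed.

Lemma ok_tc i k y : ok (tc i k) y.
Proof. by case: i => [|[|[|i]]]; case: k => [|[|[|[|k]]]]; rewrite /tc /= ?nth_nil //=. Qed.

Lemma ok_wc x k y : ok (wc x k) y.
Proof. by case: k => [|[|[|[|k]]]]; rewrite /wc /= ?nth_nil //=. Qed.

Lemma ev_tc (i : 'I_3) y (k : 'I_4) : T i y ord0 k = ev (tc i k) y.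
Proof.
rewrite -[k in LHS]inord_val.
case: i => -[|[|[|//]]] i3; rewrite /T /tc /= ?/T1 ?/T2 ?/T3 mxE inordK//;
  by case: k => -[|[|[|[|//]]]] k4 /=; rewrite /crd //= mulN1r.
Qed.

Lemma ev_wc x y (k : 'I_4) : Z4 x y ord0 k = (enorm y)^-1 * ev (wc x k) y.
Proof.
rewrite mxE; congr (_ * _); rewrite mxE /wc /hE.
by case: k => -[|[|[|[|//]]]] k4 /=; rewrite /crd !mxE //= mulN1r.
Qed.

Lemma div_tc i y : \sum_(k < 4) ev (dv (tc i k) k) y = if i == 0%N then 4 else 0.
Proof.
by rewrite big_ord4 !inordK//; case: i => [|[|[|[|i]]]]; rewrite /tc /=; ring.
Qed.

Lemma div_wc x y : \sum_(k < 4) ev (dv (wc x k) k) y = 0.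
Proof. by rewrite big_ord4 !inordK//= /wc /=; ring. Qed.

Lemma ev_hsqE x y : ev (hsqE x) y =
  (co y 0 - co x 0) ^+ 2 + (co y 1 - co x 1) ^+ 2 + (co y 2 - co x 2) ^+ 2
  + (co y 3 - co x 3) ^+ 2.
Proof. by []. Qed.

Lemma ev_rsqE y : ev rsqE y = co y 0 ^+ 2 + co y 1 ^+ 2 + co y 2 ^+ 2 + co y 3 ^+ 2.
Proof. by []. Qed.

Lemma ev_omE x y : ev (omE x) y =
  co x 0 * co y 2 - co x 2 * co y 0 + co x 1 * co y 3 - co x 3 * co y 1.
Proof. by rewrite /= !mulNr. Qed.

Lemma sum_tc_b x y : ev (ld (tc 0) (bE x 0)) y + ev (ld (tc 1) (bE x 1)) y
  + ev (ld (tc 2) (bE x 2)) y = 3 * ev rsqE y - ev (bE x 0) y.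
Proof. rewrite /=; ring. Qed.

Lemma ok_hsq x y : ok (hsqE x) y.
Proof. by do ![split]. Qed.

Lemma ok_om x y : ok (omE x) y.
Proof. by do ![split]. Qed.

Lemma ok_rsq y : ok rsqE y.
Proof. by do ![split]. Qed.

Lemma ok_b x i y : ok (bE x i) y.
Proof. by rewrite /bE /=; do ![split=> //]; exact: ok_tc. Qed.

End Geometry.

Arguments tc {R} i _.
Arguments rsqE {R}.
Opaque hsqE omE rsqE xhE bE cE tc wc.

Lemma big_ord3 (V : nmodType) (F : 'I_3 -> V) : \sum_(i < 3) F i
  = F (@Ordinal 3 0 isT) + F (@Ordinal 3 1 isT) + F (@Ordinal 3 2 isT).
Proof.
rewrite !big_ord_recl big_ord0 addr0 addrA.
by congr (F _ + F _ + F _); exact/val_inj.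
Qed.

(** * Derivatives of [rho], from the invariants alone and without coordinates *)

Section RhoCalculus.
Variable R : realType.
Implicit Types (x y : 'rV[R]_4) (k : nat) (g : ex R).
Local Notation H x y := (ev (hsqE x) y).
Local Notation w x y := (ev (omE x) y).
Local Notation b x i y := (ev (bE x i) y).
Local Notation c x i y := (ev (cE x i) y).
Local Notation r2 y := (ev rsqE y).
Local Notation xh x y := (ev (xhE x) y).
Local Notation rho x y := (ev (rhoE x) y).

Lemma rho_eq x y : rho x y = H x y ^+ 2 + 4 * w x y ^+ 2.
Proof. rewrite /rhoE /=; ring. Qed.

Lemma ld_rho x i y : (i < 3)%N ->
  ev (ld (tc i) (rhoE x)) y = 4 * H x y * b x i y - 8 * w x y * c x i y.
Proof. by move=> i3; rewrite /rhoE /= ld_hsq// ld_om//; ring. Qed.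

Lemma sum_ld_rho2 x y : ev (ld (tc 0) (rhoE x)) y ^+ 2 + ev (ld (tc 1) (rhoE x)) y ^+ 2
    + ev (ld (tc 2) (rhoE x)) y ^+ 2
  = 16 * r2 y * H x y * rho x y - 16 * w x y ^+ 2 * (H x y + 2 * xh x y) ^+ 2.
Proof.
rewrite !ld_rho//; set b0 := b x 0 y; set c0 := c x 0 y.
transitivity (16 * H x y ^+ 2 * (b0 ^+ 2 + b x 1 y ^+ 2 + b x 2 y ^+ 2)
  - 64 * H x y * w x y * (b0 * c0 + b x 1 y * c x 1 y + b x 2 y * c x 2 y)
  + 64 * w x y ^+ 2 * (c0 ^+ 2 + c x 1 y ^+ 2 + c x 2 y ^+ 2)); first by ring.
rewrite sum_b2 sum_bc sum_c2 rho_eq (rsq_eq x); ring.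
Qed.

(** [T_1^2 + T_2^2 + T_3^2 + 3 T_1] is [|y|^2] times the part of [Delta] built from Z_1, Z_2, Z_3:
    the divergence of the Euler field T_1 contributes 4 and the derivative of the weight [1/|y|]
    contributes -1. *)
Lemma sum_ldld_rho x y : ev (ld (tc 0) (ld (tc 0) (rhoE x))) y
    + ev (ld (tc 1) (ld (tc 1) (rhoE x))) y + ev (ld (tc 2) (ld (tc 2) (rhoE x))) y
    + 3 * ev (ld (tc 0) (rhoE x)) y
  = 20 * H x y * r2 y + 8 * msq x * r2 y + 8 * w x y ^+ 2
    - 8 * (msq x + xh x y) ^+ 2 + 8 * H x y * (xh x y + H x y).
Proof.
rewrite ld_rho// /rhoE /= !ld_hsq// !ld_om//.
transitivity (8 * (b x 0 y ^+ 2 + b x 1 y ^+ 2 + b x 2 y ^+ 2)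
  + 2 * H x y * (ev (ld (tc 0) (ld (tc 0) (hsqE x))) y
    + ev (ld (tc 1) (ld (tc 1) (hsqE x))) y + ev (ld (tc 2) (ld (tc 2) (hsqE x))) y)
  + 8 * (c x 0 y ^+ 2 + c x 1 y ^+ 2 + c x 2 y ^+ 2)
  + 8 * w x y * (ev (ld (tc 0) (ld (tc 0) (omE x))) y
    + ev (ld (tc 1) (ld (tc 1) (omE x))) y + ev (ld (tc 2) (ld (tc 2) (omE x))) y)
  + 3 * (4 * H x y * b x 0 y - 8 * w x y * c x 0 y)); first by ring.
rewrite sum_b2 sum_c2 ldld_hsq ldld_om b0_eq c0_eq (rsq_eq x); ring.
Qed.

Lemma wc_rho x y : ev (ld (wc x) (rhoE x)) y = 8 * w x y * xh x y.
Proof. by rewrite /rhoE /= wc_hsq wc_om; ring. Qed.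

Lemma wc_wc_rho x y : ev (ld (wc x) (ld (wc x) (rhoE x))) y
  = 8 * xh x y ^+ 2 - 8 * w x y ^+ 2.
Proof. by rewrite /rhoE /= wc_wc_hsq wc_hsq wc_om wc_xh; ring. Qed.

Lemma commutator_rho x y :
  ev (ld (tc 1) (ld (tc 2) (rhoE x))) y = ev (ld (tc 2) (ld (tc 1) (rhoE x))) y
  + 8 * H x y * w x y + 16 * w x y * (xh x y + msq x).
Proof.
have E1 : ev (ld (tc 1) (ld (tc 2) (hsqE x))) y
  = ev (ld (tc 2) (ld (tc 1) (hsqE x))) y + 4 * w x y.
  by rewrite -(commutator_hsq x y); ring.
have E2 : ev (ld (tc 1) (ld (tc 2) (omE x))) y
  = ev (ld (tc 2) (ld (tc 1) (omE x))) y + 2 * (xh x y + msq x).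
  by rewrite -(commutator_om x y); ring.
rewrite /rhoE /= E1 E2; ring.
Qed.

Lemma ok_rho x y : ok (rhoE x) y.
Proof. by do ![split]; try exact: ok_hsq; exact: ok_om. Qed.

(* The horizontal field with components [g0 g1 g2] along T_1, T_2, T_3. *)
Definition comb g0 g1 g2 k : ex R := (tc 0 k * g0 + tc 1 k * g1 + tc 2 k * g2)%E4.

Lemma ok_comb g0 g1 g2 k y : ok g0 y -> ok g1 y -> ok g2 y -> ok (comb g0 g1 g2 k) y.
Proof. by move=> o0 o1 o2; rewrite /comb /=; do ![split=> //]; exact: ok_tc. Qed.

Lemma div_comb g0 g1 g2 y : ok g0 y -> ok g1 y -> ok g2 y ->
  \sum_(k < 4) ev (dv (comb g0 g1 g2 k) k) y =
  ev (ld (tc 0) g0) y + ev (ld (tc 1) g1) y + ev (ld (tc 2) g2) y + 4 * ev g0 y.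
Proof.
move=> o0 o1 o2.
have E i g : ok g y -> \sum_(k < 4) ev (dv (tc i k * g)%E4 k) y =
  ev (ld (tc i) g) y + (\sum_(k < 4) ev (dv (tc i k) k) y) * ev g y.
  by move=> og; apply: div_mul => // k _; exact: ok_tc.
transitivity (\sum_(k < 4) ev (dv (tc 0 k * g0)%E4 k) y
  + \sum_(k < 4) ev (dv (tc 1 k * g1)%E4 k) y + \sum_(k < 4) ev (dv (tc 2 k * g2)%E4 k) y).
  by rewrite -!big_split.
rewrite !E// !div_tc /=; ring.
Qed.

End RhoCalculus.

Opaque rhoE.

Opaque hsqE omE rsqE xhE bE cE tc wc rhoE.

(** * The two regularized fields and their divergences *)

Section Fields.
Variable R : realType.
Implicit Types (x y : 'rV[R]_4) (k : nat) (e s d : R).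
Local Notation H x y := (ev (hsqE x) y).
Local Notation w x y := (ev (omE x) y).
Local Notation b x i y := (ev (bE x i) y).
Local Notation c x i y := (ev (cE x i) y).
Local Notation r2 y := (ev (@rsqE R) y).
Local Notation xh x y := (ev (xhE x) y).
Local Notation rho x y := (ev (rhoE x) y).

Definition irE x e : ex R := EIrt (rhoE x + EC e)%E4.
Definition psiE x s : ex R := (irE x s * (irE x s * irE x s))%E4.
(** [(|y|^2 + d)^(-1/2)], which smooths the weight [1/|y|] at the characteristic point. *)
Definition wE d : ex R := (EIrt (rsqE + EC d) * EIrt (rsqE + EC d))%E4.
(** [(rho + e)^(-5/4) (rho + s)^(-1)]: the first exponent is Q/4, the second factor provides the
    decay in [|y|] that the kernel bounds require. *)
Definition phiE x e s : ex R :=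
  ((irE x e * irE x e) * (irE x e * (irE x e * irE x e))
   * ((irE x s * irE x s) * (irE x s * irE x s)))%E4.
(* For [f := omE x * phiE x e s] the field [(T_3 f) T_2 - (T_2 f) T_3] has
   divergence [T_2, T_3] f = 2 Jy f: it supplies the direction that is missing
   from the span of T_1, T_2, T_3. *)
Definition aE x e s (i : nat) : ex R := nth (EC 0)
  [:: (phiE x e s * bE x 0)%E4;
      (phiE x e s * bE x 1 + ld (tc 2) (omE x * phiE x e s))%E4;
      (phiE x e s * bE x 2 + EC (-1) * ld (tc 1) (omE x * phiE x e s))%E4] i.
Definition gE x s d (i : nat) : ex R := (wE d * ld (tc i) (psiE x s))%E4.

Definition lap_psi x s y : R := let S := irt (rho x y + s) in
  - 21 * r2 y * H x y * s * S ^+ 11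
  + 6 * S ^+ 7 * (H x y * xh x y + xh x y ^+ 2 - w x y ^+ 2)
  - 21 * S ^+ 11 * w x y ^+ 2 * (H x y + 2 * xh x y) ^+ 2.

(* The part of the divergence of the field [aE] that stays integrable as
   [e] tends to 0; the other part concentrates at [x]. *)
Definition div_rest x e s y : R :=
  let E := irt (rho x y + e) in let S := irt (rho x y + s) in
  E ^+ 5 * S ^+ 4 * b x 0 y - 4 * r2 y * rho x y * E ^+ 5 * S ^+ 8
  - (5 / 4 * E ^+ 9 * S ^+ 4 + E ^+ 5 * S ^+ 8)
    * (4 * H x y * w x y ^+ 2 - 8 * w x y ^+ 2 * b x 0 y).

Lemma rho_ge0 x y : 0 <= rho x y.
Proof. by rewrite rho_eq; have := sqr_ge0 (H x y); have := sqr_ge0 (w x y); lra. Qed.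

Lemma ev_ld_psi (c : nat -> ex R) x s y :
  ev (ld c (psiE x s)) y =
    - (3 / 4) * irt (rho x y + s) ^+ 7 * ev (ld c (rhoE x)) y.
Proof. rewrite /psiE /irE /=; by field. Qed.

Lemma ev_ld_ld_psi c x s y :
  ev (ld c (ld c (psiE x s))) y =
    21 / 16 * irt (rho x y + s) ^+ 11 * ev (ld c (rhoE x)) y ^+ 2
    - 3 / 4 * irt (rho x y + s) ^+ 7 * ev (ld c (ld c (rhoE x))) y.
Proof. rewrite /psiE /irE /=; by field. Qed.

Lemma lap_psiE x s y : 0 < rho x y + s ->
  ev (ld (tc 0) (ld (tc 0) (psiE x s))) y + ev (ld (tc 1) (ld (tc 1) (psiE x s))) y
  + ev (ld (tc 2) (ld (tc 2) (psiE x s))) y + 3 * ev (ld (tc 0) (psiE x s)) y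
  = lap_psi x s y.
Proof.
move=> /irt4; rewrite ev_ld_psi !ev_ld_ld_psi /lap_psi; set S := irt _ => S4.
transitivity (21 / 16 * S ^+ 11 * (ev (ld (tc 0) (rhoE x)) y ^+ 2
    + ev (ld (tc 1) (rhoE x)) y ^+ 2 + ev (ld (tc 2) (rhoE x)) y ^+ 2)
  - 3 / 4 * S ^+ 7 * (ev (ld (tc 0) (ld (tc 0) (rhoE x))) y
    + ev (ld (tc 1) (ld (tc 1) (rhoE x))) y + ev (ld (tc 2) (ld (tc 2) (rhoE x))) y
    + 3 * ev (ld (tc 0) (rhoE x)) y)); first by field.
rewrite sum_ld_rho2 sum_ldld_rho.
(* Trading [S^11 rho] for [S^7] exposes the cancellation of the principal part: [(21 - 15) H |y|^2]
   meets [- 6 |x|^2 H - 6 H^2 - 6 H xh], and by [rsq_eq] only [6 H xh] is left. *)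
have S4' : S ^+ 11 * rho x y = S ^+ 7 * (1 - S ^+ 4 * s) by rewrite -S4; ring.
transitivity (21 * r2 y * H x y * (S ^+ 11 * rho x y)
  - 21 * S ^+ 11 * w x y ^+ 2 * (H x y + 2 * xh x y) ^+ 2
  - 3 / 4 * S ^+ 7 * (20 * H x y * r2 y + 8 * msq x * r2 y + 8 * w x y ^+ 2
    - 8 * (msq x + xh x y) ^+ 2 + 8 * H x y * (xh x y + H x y))); first by field.
by rewrite S4' (rsq_eq x); field.
Qed.

(** With [w_d = ev (wE d) y] one has [T_1 w_d = - |y|^2 w_d^3]. This lowers the coefficient 4 of
    [T_1 psi] to 3 up to the factor [1 - |y|^2 w_d^2], which tends to 0 with [d] away from the
    origin. *)
Lemma div_g x s d y : 0 < rho x y + s -> 0 < r2 y + d ->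
  ev (ld (tc 0) (gE x s d 0)) y + ev (ld (tc 1) (gE x s d 1)) y
  + ev (ld (tc 2) (gE x s d 2)) y + 4 * ev (gE x s d 0) y
  = ev (wE d) y * (lap_psi x s y
     + (1 - r2 y * ev (wE d) y ^+ 2) * ev (ld (tc 0) (psiE x s)) y).
Proof.
move=> /lap_psiE <- _; rewrite /gE /wE /=.
rewrite (tc_rsq y (i := 0) isT) (tc_rsq y (i := 1) isT) (tc_rsq y (i := 2) isT) /=.
by field.
Qed.

Lemma div_a x e s y : 0 < rho x y + e -> 0 < rho x y + s ->
  ev (ld (tc 0) (aE x e s 0)) y + ev (ld (tc 1) (aE x e s 1)) y
  + ev (ld (tc 2) (aE x e s 2)) y + 4 * ev (aE x e s 0) y
  = 5 * r2 y * e * irt (rho x y + e) ^+ 9 * irt (rho x y + s) ^+ 4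
    + div_rest x e s y.
Proof.
move=> /irt4 E4 /irt4 S4; rewrite /aE /phiE /irE /= /div_rest.
rewrite commutator_rho.
set E := irt _ in E4 *; set S := irt _ in S4 *.
have EC : ev (ld (tc 1) (ld (tc 2) (omE x))) y
  = ev (ld (tc 2) (ld (tc 1) (omE x))) y + 2 * (xh x y + msq x).
  by rewrite -(commutator_om x y); ring.
rewrite EC.
pose r i := ev (ld (tc i) (rhoE x)) y.
pose dP := - (5 / 4 * E ^+ 9 * S ^+ 4 + E ^+ 5 * S ^+ 8).
(* [phi div X + (d phi / d rho) X rho] for [X = sum_i b_i T_i + 2 w Jy]: here
   [2 Jy w = 2 (xh + |x|^2)], [2 Jy rho] is given by the commutator, and [dP] is [d phi / d rho]. *)
transitivity (E ^+ 5 * S ^+ 4 * (ev (ld (tc 0) (bE x 0)) y + ev (ld (tc 1) (bE x 1)) y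
    + ev (ld (tc 2) (bE x 2)) y + 4 * b x 0 y + 2 * (xh x y + msq x))
  + dP * (r 0%N * b x 0 y + r 1%N * b x 1 y + r 2%N * b x 2 y
    + w x y * (8 * H x y * w x y + 16 * w x y * (xh x y + msq x)))); first by rewrite /r /dP; field.
rewrite sum_tc_b /r !ld_rho//.
transitivity (E ^+ 5 * S ^+ 4 * (3 * r2 y - b x 0 y + 4 * b x 0 y + 2 * (xh x y + msq x))
  + dP * (4 * H x y * (b x 0 y ^+ 2 + b x 1 y ^+ 2 + b x 2 y ^+ 2)
    - 8 * w x y * (b x 0 y * c x 0 y + b x 1 y * c x 1 y + b x 2 y * c x 2 y)
    + w x y * (8 * H x y * w x y + 16 * w x y * (xh x y + msq x)))); first by ring.
rewrite sum_b2 sum_bc.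
have -> : xh x y + msq x = r2 y - b x 0 y by rewrite b0_eq (rsq_eq x); ring.
have -> : xh x y + H x y = b x 0 y by rewrite b0_eq.
(* The term [5 r^2] of [div X] and the term [4 r^2 rho] of [X rho] cancel except for the part
   proportional to [e]. *)
have E9 : 5 * r2 y * (E ^+ 9 * S ^+ 4 * (rho x y + e)) = 5 * r2 y * (E ^+ 5 * S ^+ 4).
  by rewrite -[in RHS](mulr1 (E ^+ 5)) -E4; ring.
have -> : 5 * r2 y * e * E ^+ 9 * S ^+ 4 = 5 * r2 y * (E ^+ 9 * S ^+ 4 * (rho x y + e))
  - 5 * r2 y * rho x y * E ^+ 9 * S ^+ 4 by ring.
by rewrite E9 /dP rho_eq; field.
Qed.

End Fields.

(** * The remainder [f_x] in closed form *)

Section Remainder.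
Variable R : realType.
Implicit Types (x y : 'rV[R]_4) (k : nat) (e s d : R).
Local Notation H x y := (ev (hsqE x) y).
Local Notation w x y := (ev (omE x) y).
Local Notation r2 y := (ev (@rsqE R) y).
Local Notation xh x y := (ev (xhE x) y).
Local Notation rho x y := (ev (rhoE x) y).

Lemma sumsq_eq0 (h0 h1 h2 h3 : R) : (h0 ^+ 2 + h1 ^+ 2 + h2 ^+ 2 + h3 ^+ 2 == 0) =
  [&& h0 == 0, h1 == 0, h2 == 0 & h3 == 0].
Proof. by rewrite !paddr_eq0 ?addr_ge0 ?sqr_ge0// !sqrf_eq0 -!andbA. Qed.

Lemma rsq_ge0 y : 0 <= r2 y.
Proof. by rewrite ev_rsqE !addr_ge0 ?sqr_ge0. Qed.

Lemma hsq_ge0 x y : 0 <= H x y.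
Proof. by rewrite ev_hsqE !addr_ge0 ?sqr_ge0. Qed.

Lemma hsq_gt0 x y : (0 < H x y) = (y != x).
Proof.
rewrite lt0r hsq_ge0 andbT; congr (~~ _); rewrite ev_hsqE sumsq_eq0 !subr_eq0.
apply/idP/eqP => [/and4P[/eqP y0 /eqP y1 /eqP y2 /eqP y3]|->]; last by rewrite !eqxx.
by apply: row4P => -[|[|[|[|//]]]] _.
Qed.

Lemma rsq_gt0 y : (0 < r2 y) = (y != 0).
Proof. by rewrite -hsq_gt0 ev_hsqE ev_rsqE !mxE !subr0. Qed.

Lemma rho_gt0 x y : (0 < rho x y) = (y != x).
Proof.
apply/idP/idP; last first.
  by rewrite -hsq_gt0 rho_eq => h0; have := sqr_ge0 (w x y); have := exprn_gt0 2 h0; lra.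
apply: contraTneq => ->; rewrite -leNgt.
by rewrite rho_eq ev_hsqE ev_omE; nra.
Qed.

Lemma enormE y : enorm y = Num.sqrt (r2 y).
Proof.
by rewrite /enorm ev_rsqE /crd 4?big_ltn// big_geq// addr0 !addrA.
Qed.

Lemma enorm_inv y : (enorm y)^-1 = ev (wE 0) y.
Proof.
rewrite enormE /wE /= addr0 -expr2.
have [->|y0] := eqVneq y 0.
  have -> : r2 0 = 0 by rewrite ev_rsqE !mxE; ring.
  by rewrite sqrtr0 invr0 irt0 expr0n.
have r0 : 0 < r2 y by rewrite rsq_gt0.
apply: (@pexpIrn _ 2); rewrite // ?nnegrE ?invr_ge0 ?sqrtr_ge0 ?sqr_ge0//.
rewrite exprVn sqr_sqrtr ?ltW// -exprM; apply: (mulIf (lt0r_neq0 r0)).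
by rewrite mulVf ?irt4 ?lt0r_neq0.
Qed.

Lemma dist_rho x y : dist x y = (irt (rho x y))^-1 /\ dist y x = (irt (rho x y))^-1.
Proof.
have E4 z : enorm z ^+ 4 = r2 z ^+ 2.
  by rewrite enormE -[4%N]/(2 * 2)%N exprM sqr_sqrtr// rsq_ge0.
rewrite /dist !E4 /irt powRN !invrK rho_eq.
by split; congr (_ `^ _); rewrite ev_rsqE ev_hsqE ev_omE !mxE /crd; ring.
Qed.

Definition gamE x : ex R := (EC (CHR R)^-1 * psiE x 0)%E4.

Lemma Gam_ev x y : Gam x y = ev (gamE x) y /\ Gam y x = ev (gamE x) y.
Proof.
rewrite /Gam /gamE /psiE /irE /= addr0; have [-> ->] := dist_rho x y.
by have -> : - Q + 2 = - 3%:Z by []; rewrite -exprnN exprVn invrK !exprS expr0 mulr1.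
Qed.

Lemma ok_irE x e y : 0 < rho x y + e -> ok (irE x e) y.
Proof. by move=> re; do ![split=> //]; exact: ok_rho. Qed.

Lemma ok_psi x s y : 0 < rho x y + s -> ok (psiE x s) y.
Proof. by move=> rs; do ![split=> //]; exact: ok_rho. Qed.

Lemma ok_w d y : 0 < r2 y + d -> ok (wE d) y.
Proof. by move=> rd; do ![split=> //]; exact: ok_rsq. Qed.

Lemma ok_ldt i (g : ex R) y : ok g y -> ok (ld (tc i) g) y.
Proof. by apply: ok_ld => k _; exact: ok_tc. Qed.

Lemma derive_scaled (c : nat -> ex R) (g : ex R) y (v : 'rV[R]_4) a : (forall k : 'I_4, v ord0 k = a * ev (c k) y) -> ok g y ->
  'D_v (ev g) y = a * ev (ld c g) y.
Proof.
move=> vc oe; rewrite ev_derive// ev_ld// mulr_sumr.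
by apply: eq_bigr => k _; rewrite vc mulrA.
Qed.

Lemma near_neq (x y : 'rV[R]_4) : y != x -> \forall z \near y, z != x.
Proof.
rewrite -hsq_gt0 => h0; apply: (@filterS _ _ (nbhs_filter y) _ _ _
  (cvgr_gt _ (ev_continuous (ok_hsq x y)) _ h0)) => z.
by rewrite hsq_gt0.
Qed.

Lemma vadj_vact (V : vfield R) (c : nat -> ex R) x y :
  (forall z k, ok (c k) z) -> (forall z (k : 'I_4), V z ord0 k = (enorm z)^-1 * ev (c k) z) ->
  y != x -> y != 0 ->
  vadj V (fun z => enorm z * vact V (fun z' => Gam z' x) z) y =
  ev (ld c (wE 0 * ld c (gamE x))%E4) y
  + (\sum_(k < 4) ev (dv (c k) k) y) * ev (wE 0 * ld c (gamE x))%E4 y.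
Proof.
move=> oc Vc yx y0.
have GE : (fun z' => Gam z' x) = ev (gamE x) by apply/funext => z; exact: (Gam_ev x z).2.
have okg z : z != x -> z != 0 -> ok (wE 0 * ld c (gamE x))%E4 z.
  move=> zx z0; split; first by apply: ok_w; rewrite addr0 rsq_gt0.
  by apply: ok_ld => //; split=> //; apply: ok_psi; rewrite addr0 rho_gt0.
rewrite -div_mul//; last exact: okg.
rewrite /vadj; apply: eq_bigr => k _.
rewrite -ev_partial ?inord_val//; last by split; [exact: oc|exact: okg].
(* The function agrees with an expression only away from [x] and 0; a neighbourhood of [y] is enough
   for its derivative. *)
apply: near_eq_derive.
near=> z.
have zx : z != x by near: z; exact: near_neq.
have z0 : z != 0 by near: z; exact: near_neq.
rewrite GE Vc /vact (@derive_scaled c _ _ _ (enorm z)^-1)//; last first.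
  by split=> //; apply: ok_psi; rewrite addr0 rho_gt0.
have en0 : enorm z != 0 by rewrite enormE sqrtr_eq0 -ltNge rsq_gt0.
rewrite -[RHS]/(ev (c k) z * (ev (wE 0) z * ev (ld c (gamE x)) z)) -enorm_inv.
by rewrite mulVKf//; ring.
Unshelve. all: by end_near.
Qed.

(** The terms [6 D^7 (xh^2 - w^2)] and [- 84 D^11 w^2 xh^2] of [lap_psi x 0], of order [d^-5] near
    [x], are cancelled by the Z_4 part of [Delta]. What survives is of order at most [d^-4]. *)
Definition frem_val x y : R := let D := irt (rho x y) in
  6 * D ^+ 7 * xh x y * (H x y - w x y ^+ 2 / r2 y)
  - 21 * D ^+ 11 * w x y ^+ 2 * H x y * (H x y + 4 * xh x y).

Lemma frem_eq x y : y != x -> y != 0 ->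
  frem x y = (CHR R)^-1 / r2 y * frem_val x y.
Proof.
move=> yx y0.
have r0 : r2 y != 0 by rewrite lt0r_neq0// rsq_gt0.
have P2 : ev (wE 0) y ^+ 2 = (r2 y)^-1.
  by rewrite -enorm_inv exprVn enormE sqr_sqrtr// rsq_ge0.
rewrite /frem /Delta big_ord3.
have Ti (i : 'I_3) (z : 'rV[R]_4) (k : 'I_4) :
    Z i z ord0 k = (enorm z)^-1 * ev (tc i k) z by rewrite mxE ev_tc.
have VT i (i3 : (i < 3)%N) :=
  vadj_vact (fun z k => ok_tc i k z) (Ti (Ordinal i3)) yx y0.
rewrite !VT (vadj_vact (fun z k => ok_wc x k z) (ev_wc x) yx y0) div_wc.
have D0 : \sum_(k < 4) ev (dv (tc 0 k) k) y = 4 := div_tc 0 y.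
have D1 : \sum_(k < 4) ev (dv (tc 1 k) k) y = 0 := div_tc 1 y.
have D2 : \sum_(k < 4) ev (dv (tc 2 k) k) y = 0 := div_tc 2 y.
rewrite D0 D1 D2 {D0 D1 D2}.
rewrite enorm_inv; set P := ev (wE 0) y in P2 *.
have LD c : ev (ld c (wE 0 * ld c (gamE x))%E4) y = (CHR R)^-1 *
    (- (1 / 2) * P ^+ 3 * ev (ld c rsqE) y * ev (ld c (psiE x 0)) y
     + P * ev (ld c (ld c (psiE x 0))) y).
  by rewrite /P /gamE; set ka := (CHR R)^-1; rewrite /psiE /irE /wE /=; field.
have PL c : ev (wE 0 * ld c (gamE x))%E4 y = P * ((CHR R)^-1 * ev (ld c (psiE x 0)) y).
  by rewrite /P /gamE /=; ring.
have T0 : ev (ld (tc 0) rsqE) y = 2 * r2 y := tc_rsq y (i := 0) isT.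
have T1 : ev (ld (tc 1) rsqE) y = 0 := tc_rsq y (i := 1) isT.
have T2 : ev (ld (tc 2) rsqE) y = 0 := tc_rsq y (i := 2) isT.
rewrite !LD !PL T0 T1 T2 wc_rsq /frem_val.
have rho0 : 0 < rho x y + 0 by rewrite addr0 rho_gt0.
have := lap_psiE rho0; rewrite /lap_psi.
have -> : ev (ld (wc x) (ld (wc x) (psiE x 0))) y =
  84 * irt (rho x y + 0) ^+ 11 * w x y ^+ 2 * xh x y ^+ 2
  - 6 * irt (rho x y + 0) ^+ 7 * (xh x y ^+ 2 - w x y ^+ 2).
  by rewrite ev_ld_ld_psi wc_rho wc_wc_rho; field.
have -> : ev (ld (wc x) (psiE x 0)) y = - 6 * irt (rho x y + 0) ^+ 7 * w x y * xh x y.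
  by rewrite ev_ld_psi wc_rho; field.
rewrite addr0; set D := irt (rho x y).
set L0 := ev (ld (tc 0) (psiE x 0)) y; set L00 := ev (ld (tc 0) (ld (tc 0) (psiE x 0))) y.
set L11 := ev (ld (tc 1) (ld (tc 1) (psiE x 0))) y.
set L22 := ev (ld (tc 2) (ld (tc 2) (psiE x 0))) y => LE.
(* The coefficient [4 - P^2 |y|^2] of [L0] is written [3 + (1 - P^2 |y|^2)]: the 3 belongs to
   [lap_psiE], the bracket vanishes since [P = 1/|y|]. *)
transitivity ((CHR R)^-1 * P ^+ 2 * (L00 + L11 + L22 + 3 * L0
    + (1 - P ^+ 2 * r2 y) * L0
    + 84 * D ^+ 11 * w x y ^+ 2 * xh x y ^+ 2 - 6 * D ^+ 7 * (xh x y ^+ 2 - w x y ^+ 2)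
    - P ^+ 2 * w x y * (6 * D ^+ 7 * w x y * xh x y))); first by set ka := (CHR R)^-1; field.
rewrite LE P2 mulVf//; set ka := (CHR R)^-1; field.
exact: r0.
Qed.

End Remainder.

(** * Products of factors in the unit interval *)

Section UnitInterval.
Variable R : realType.

Lemma sqr_normr (x : R) : `|x| ^+ 2 = x ^+ 2.
Proof. by rewrite real_normK ?num_real. Qed.

Lemma mul_le1 (A X : R) : 0 <= A <= 1 -> 0 <= X -> A * X <= X.
Proof. by move=> /andP[A0 A1] X0; rewrite ler_piMl. Qed.

Lemma in01M (A B : R) : 0 <= A <= 1 -> 0 <= B <= 1 -> 0 <= A * B <= 1.
Proof. by move=> /andP[A0 A1] /andP[B0 B1]; rewrite mulr_ge0//= mulr_ile1. Qed.

Lemma in01X (A : R) k : 0 <= A <= 1 -> 0 <= A ^+ k <= 1.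
Proof. by move=> /andP[A0 A1]; rewrite exprn_ge0//= exprn_ile1. Qed.

End UnitInterval.

Ltac in01 := solve [repeat first [assumption
  | match goal with
    | |- is_true (0 <= _ ^+ _ <= 1) => apply: in01X
    | |- is_true (0 <= _ * _ <= 1) => apply: in01M
    end]].

(** * Homogeneous estimates in real variables *)

Section ScalarBounds.
Variable R : realType.
Implicit Types n r m w xh b c E S D s : R.

(** Every monomial is the bound [r E^4 S^4] times a product of the quantities [E n], [E^2 |w|],
    [S n], [S^2 |w|], all in [0, 1]. The constant 30 rounds up 1 + 1 + 5 + 10 + 4 + 8. *)
Lemma field_bound n r w E S b (c0 t : R) :
  0 <= n -> 0 <= r -> 0 <= E -> 0 <= S -> E * n <= 1 -> E ^+ 2 * `|w| <= 1 ->
  S * n <= 1 -> S ^+ 2 * `|w| <= 1 -> `|b| <= r * n -> `|c0| <= r * n ->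
  `|t| <= 4 * n ^+ 2 * (r * n) + 8 * `|w| * (r * n) ->
  `|E ^+ 5 * S ^+ 4 * b| + `|E ^+ 5 * S ^+ 4 * c0|
    + `|w| * (5 / 4 * E ^+ 9 * S ^+ 4 + E ^+ 5 * S ^+ 8) * `|t|
  <= 30 * (r * E ^+ 4 * S ^+ 4).
Proof.
move=> n0 r0 E0 S0 En Ew Sn Sw bn cn tn.
have w0 := normr_ge0 w; set v := `|w| in w0 Ew Sw tn *.
have B0 : 0 <= r * E ^+ 4 * S ^+ 4 by rewrite !mulr_ge0 ?exprn_ge0.
set B := r * E ^+ 4 * S ^+ 4 in B0 *.
have En1 : 0 <= E * n <= 1 by rewrite mulr_ge0.
have Sn1 : 0 <= S * n <= 1 by rewrite mulr_ge0.
have Ew1 : 0 <= E ^+ 2 * v <= 1 by rewrite mulr_ge0 ?exprn_ge0.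
have Sw1 : 0 <= S ^+ 2 * v <= 1 by rewrite mulr_ge0 ?exprn_ge0.
have EB (a : R) : `|a| <= r * n -> `|E ^+ 5 * S ^+ 4 * a| <= B.
  move=> an; rewrite normrM ger0_norm ?mulr_ge0 ?exprn_ge0//.
  apply: (@le_trans _ _ (E ^+ 5 * S ^+ 4 * (r * n))).
    by rewrite ler_wpM2l// mulr_ge0 ?exprn_ge0.
  have -> : E ^+ 5 * S ^+ 4 * (r * n) = (E * n) * B by rewrite /B; ring.
  exact: mul_le1.
have h1 := EB _ bn; have h2 := EB _ cn.
set u := 5 / 4 * E ^+ 9 * S ^+ 4 + E ^+ 5 * S ^+ 8.
have u0 : 0 <= u by rewrite /u addr_ge0// !mulr_ge0 ?exprn_ge0//; lra.
have h3 : v * u * `|t| <= v * u * (4 * n ^+ 2 * (r * n) + 8 * v * (r * n)).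
  by rewrite ler_wpM2l// mulr_ge0.
have k1 : v * (E ^+ 9 * S ^+ 4) * (n ^+ 2 * (r * n)) <= B.
  have -> : v * (E ^+ 9 * S ^+ 4) * (n ^+ 2 * (r * n)) = ((E ^+ 2 * v) * (E * n) ^+ 3) * B.
    by rewrite /B; ring.
  by apply: mul_le1; [in01|].
have k2 : v * (E ^+ 9 * S ^+ 4) * (v * (r * n)) <= B.
  have -> : v * (E ^+ 9 * S ^+ 4) * (v * (r * n)) = ((E ^+ 2 * v) ^+ 2 * (E * n)) * B.
    by rewrite /B; ring.
  by apply: mul_le1; [in01|].
have k3 : v * (E ^+ 5 * S ^+ 8) * (n ^+ 2 * (r * n)) <= B.
  have -> : v * (E ^+ 5 * S ^+ 8) * (n ^+ 2 * (r * n)) =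
      ((S ^+ 2 * v) * (S * n) ^+ 2 * (E * n)) * B by rewrite /B; ring.
  by apply: mul_le1; [in01|].
have k4 : v * (E ^+ 5 * S ^+ 8) * (v * (r * n)) <= B.
  have -> : v * (E ^+ 5 * S ^+ 8) * (v * (r * n)) = ((S ^+ 2 * v) ^+ 2 * (E * n)) * B.
    by rewrite /B; ring.
  by apply: mul_le1; [in01|].
have h4 : v * u * (4 * n ^+ 2 * (r * n) + 8 * v * (r * n)) =
   5 * (v * (E ^+ 9 * S ^+ 4) * (n ^+ 2 * (r * n)))
   + 10 * (v * (E ^+ 9 * S ^+ 4) * (v * (r * n)))
   + 4 * (v * (E ^+ 5 * S ^+ 8) * (n ^+ 2 * (r * n)))
   + 8 * (v * (E ^+ 5 * S ^+ 8) * (v * (r * n))) by rewrite /u; field.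
lra.
Qed.

(** As in [field_bound], with [S r <= 2] to absorb the surplus powers of [r] in [r^2 rho]. The
    constant is 1 + 8 + 64 + 5 + 4 + 10 + 8 = 100. *)
Lemma rest_bound n r w E S b :
  0 <= n -> 0 <= r -> 0 <= E -> 0 <= S -> E * n <= 1 -> E ^+ 2 * `|w| <= 1 ->
  S * n <= 1 -> S ^+ 2 * `|w| <= 1 -> S * r <= 2 -> `|b| <= r * n -> `|w| <= r * n ->
  `|E ^+ 5 * S ^+ 4 * b - 4 * r ^+ 2 * (n ^+ 4 + 4 * w ^+ 2) * E ^+ 5 * S ^+ 8
   - (5 / 4 * E ^+ 9 * S ^+ 4 + E ^+ 5 * S ^+ 8)
     * (4 * n ^+ 2 * w ^+ 2 - 8 * w ^+ 2 * b)| <= 100 * (r * E ^+ 4 * S ^+ 4).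
Proof.
move=> n0 r0 E0 S0 En Ew Sn Sw Sr bn wn.
have w0 := normr_ge0 w; rewrite -(sqr_normr w); set v := `|w| in w0 Ew Sw wn *.
have B0 : 0 <= r * E ^+ 4 * S ^+ 4 by rewrite !mulr_ge0 ?exprn_ge0.
set B := r * E ^+ 4 * S ^+ 4 in B0 *.
have En1 : 0 <= E * n <= 1 by rewrite mulr_ge0.
have Sn1 : 0 <= S * n <= 1 by rewrite mulr_ge0.
have Ew1 : 0 <= E ^+ 2 * v <= 1 by rewrite mulr_ge0 ?exprn_ge0.
have Sw1 : 0 <= S ^+ 2 * v <= 1 by rewrite mulr_ge0 ?exprn_ge0.
have Sr1 : 0 <= S * r / 2 <= 1 by rewrite mulr_ge0 ?mulr_ge0// ler_pdivrMr// mul1r.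
have h1 : `|E ^+ 5 * S ^+ 4 * b| <= B.
  rewrite normrM ger0_norm ?mulr_ge0 ?exprn_ge0//.
  apply: (@le_trans _ _ (E ^+ 5 * S ^+ 4 * (r * n))).
    by rewrite ler_wpM2l// mulr_ge0 ?exprn_ge0.
  have -> : E ^+ 5 * S ^+ 4 * (r * n) = (E * n) * B by rewrite /B; ring.
  exact: mul_le1.
have k1 : r ^+ 2 * n ^+ 4 * E ^+ 5 * S ^+ 8 <= 2 * B.
  have -> : r ^+ 2 * n ^+ 4 * E ^+ 5 * S ^+ 8 =
    ((E * n) * (S * n) ^+ 3 * (S * r / 2)) * (2 * B) by rewrite /B; field.
  by apply: mul_le1; [in01|rewrite mulr_ge0].
have k2 : r ^+ 2 * v ^+ 2 * E ^+ 5 * S ^+ 8 <= 4 * B.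
  apply: (@le_trans _ _ (r ^+ 2 * (v * (r * n)) * E ^+ 5 * S ^+ 8)).
    rewrite ler_wpM2r ?exprn_ge0// ler_wpM2r ?exprn_ge0// ler_wpM2l ?exprn_ge0//.
    by rewrite expr2 ler_wpM2l.
  have -> : r ^+ 2 * (v * (r * n)) * E ^+ 5 * S ^+ 8 =
    ((E * n) * (S ^+ 2 * v) * (S * r / 2) ^+ 2) * (4 * B) by rewrite /B; field.
  by apply: mul_le1; [in01|rewrite mulr_ge0].
have k3 : E ^+ 9 * S ^+ 4 * (n ^+ 2 * v ^+ 2) <= B.
  apply: (@le_trans _ _ (E ^+ 9 * S ^+ 4 * (n ^+ 2 * (v * (r * n))))).
    rewrite ler_wpM2l ?mulr_ge0 ?exprn_ge0// ler_wpM2l ?exprn_ge0//.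
    by rewrite expr2 ler_wpM2l.
  have -> : E ^+ 9 * S ^+ 4 * (n ^+ 2 * (v * (r * n))) =
    ((E * n) ^+ 3 * (E ^+ 2 * v)) * B by rewrite /B; ring.
  by apply: mul_le1; [in01|].
have k4 : E ^+ 5 * S ^+ 8 * (n ^+ 2 * v ^+ 2) <= B.
  apply: (@le_trans _ _ (E ^+ 5 * S ^+ 8 * (n ^+ 2 * (v * (r * n))))).
    rewrite ler_wpM2l ?mulr_ge0 ?exprn_ge0// ler_wpM2l ?exprn_ge0//.
    by rewrite expr2 ler_wpM2l.
  have -> : E ^+ 5 * S ^+ 8 * (n ^+ 2 * (v * (r * n))) =
    ((E * n) * (S * n) ^+ 2 * (S ^+ 2 * v)) * B by rewrite /B; ring.
  by apply: mul_le1; [in01|].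
have k5 : E ^+ 9 * S ^+ 4 * (v ^+ 2 * (r * n)) <= B.
  have -> : E ^+ 9 * S ^+ 4 * (v ^+ 2 * (r * n)) =
    ((E * n) * (E ^+ 2 * v) ^+ 2) * B by rewrite /B; ring.
  by apply: mul_le1; [in01|].
have k6 : E ^+ 5 * S ^+ 8 * (v ^+ 2 * (r * n)) <= B.
  have -> : E ^+ 5 * S ^+ 8 * (v ^+ 2 * (r * n)) =
    ((E * n) * (S ^+ 2 * v) ^+ 2) * B by rewrite /B; ring.
  by apply: mul_le1; [in01|].
have bl : - (r * n) <= b <= r * n by rewrite -ler_norml.
have EB (c : R) : 0 <= c -> `|c * (v ^+ 2 * b)| <= c * (v ^+ 2 * (r * n)).
  move=> c0; rewrite normrM (ger0_norm c0) normrM ger0_norm ?exprn_ge0//.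
  by rewrite ler_wpM2l// ler_wpM2l ?exprn_ge0.
have h5 := EB (E ^+ 9 * S ^+ 4) (mulr_ge0 (exprn_ge0 _ E0) (exprn_ge0 _ S0)).
have h6 := EB (E ^+ 5 * S ^+ 8) (mulr_ge0 (exprn_ge0 _ E0) (exprn_ge0 _ S0)).
have l1 : 0 <= r ^+ 2 * n ^+ 4 * E ^+ 5 * S ^+ 8 by rewrite !mulr_ge0 ?exprn_ge0.
have l2 : 0 <= r ^+ 2 * v ^+ 2 * E ^+ 5 * S ^+ 8 by rewrite !mulr_ge0 ?exprn_ge0.
have l3 : 0 <= E ^+ 9 * S ^+ 4 * (n ^+ 2 * v ^+ 2) by rewrite !mulr_ge0 ?exprn_ge0.
have l4 : 0 <= E ^+ 5 * S ^+ 8 * (n ^+ 2 * v ^+ 2) by rewrite !mulr_ge0 ?exprn_ge0.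
have -> : E ^+ 5 * S ^+ 4 * b - 4 * r ^+ 2 * (n ^+ 4 + 4 * v ^+ 2) * E ^+ 5 * S ^+ 8
   - (5 / 4 * E ^+ 9 * S ^+ 4 + E ^+ 5 * S ^+ 8)
     * (4 * n ^+ 2 * v ^+ 2 - 8 * v ^+ 2 * b) =
   E ^+ 5 * S ^+ 4 * b - 4 * (r ^+ 2 * n ^+ 4 * E ^+ 5 * S ^+ 8)
   - 16 * (r ^+ 2 * v ^+ 2 * E ^+ 5 * S ^+ 8)
   - 5 * (E ^+ 9 * S ^+ 4 * (n ^+ 2 * v ^+ 2)) - 4 * (E ^+ 5 * S ^+ 8 * (n ^+ 2 * v ^+ 2))
   + 10 * (E ^+ 9 * S ^+ 4 * (v ^+ 2 * b)) + 8 * (E ^+ 5 * S ^+ 8 * (v ^+ 2 * b)) by field.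
move: h1 h5 h6; rewrite !ler_norml => /andP[? ?] /andP[? ?] /andP[? ?].
by apply/andP; split; lra.
Qed.

Section PowerDifferences.
Variables (D S m rho : R).
Hypotheses (D0 : 0 < D) (S0 : 0 < S) (SD : S <= D).
Hypotheses (D4 : D ^+ 4 * rho = 1) (S4 : S ^+ 4 * (rho + m ^+ 4) = 1).

(** [D^4 - S^4 = D^4 S^4 m^4] dominates [D^3 (D - S)]. The gain [S^4 m^4] is what makes the
    derivatives of Psi and Gamma close. *)
Lemma sub_irt : D - S <= D * (S ^+ 4 * m ^+ 4).
Proof.
have E1 : D ^+ 4 - S ^+ 4 = D ^+ 3 * (D * (S ^+ 4 * m ^+ 4)).
  rewrite -[in LHS](mulr1 (D ^+ 4)) -S4 -[X in _ - X]mulr1 -D4; ring.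
have D3 : 0 < D ^+ 3 by rewrite exprn_gt0.
rewrite -(ler_pM2l D3) -E1.
have : S * S ^+ 3 <= S * D ^+ 3 by rewrite ler_pM2l// lerXn2r// nnegrE ltW.
rewrite mulrBr -!exprS -exprSr => h; have : D ^+ 3 * S = S * D ^+ 3 by ring.
by move=> ->; lra.
Qed.

Lemma subX_irt k : `|D ^+ k - S ^+ k| <= k%:R * (D ^+ k * (S ^+ 4 * m ^+ 4)).
Proof.
have DS k' : S ^+ k' <= D ^+ k' by rewrite lerXn2r// nnegrE ltW.
rewrite ger0_norm ?subr_ge0//; elim: k => [|k ih]; first by rewrite !expr0 subrr mul0r.
have m4 : 0 <= S ^+ 4 * m ^+ 4.
  by rewrite mulr_ge0 ?exprn_even_ge0.
have -> : D ^+ k.+1 - S ^+ k.+1 = D * (D ^+ k - S ^+ k) + S ^+ k * (D - S).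
  by rewrite !exprS; ring.
have h1 : D * (D ^+ k - S ^+ k) <= D * (k%:R * (D ^+ k * (S ^+ 4 * m ^+ 4))).
  by rewrite ler_pM2l.
have h2 : S ^+ k * (D - S) <= D ^+ k * (D * (S ^+ 4 * m ^+ 4)).
  by apply: ler_pM; rewrite ?exprn_ge0 ?subr_ge0 ?(ltW S0)//; exact: sub_irt.
apply: (le_trans (lerD h1 h2)).
by rewrite -natr1 (exprS D k) le_eqVlt; apply/orP; left; apply/eqP; ring.
Qed.

End PowerDifferences.

Lemma lap_frem_bound n r m w xh D S :
  0 <= n -> 0 < r -> 0 <= m -> 0 < D -> 0 < S -> S <= D -> D * n <= 1 -> D ^+ 2 * `|w| <= 1 ->
  S * n <= 1 -> S ^+ 2 * `|w| <= 1 -> S * r <= 2 -> S * m <= 1 ->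
  `|w| <= r * n -> `|w| <= m * n -> `|xh| <= m * n ->
  (forall k, `|D ^+ k - S ^+ k| <= k%:R * (D ^+ k * (S ^+ 4 * m ^+ 4))) ->
  r * `|(- 21 * r ^+ 2 * n ^+ 2 * m ^+ 4 * S ^+ 11
    + 6 * S ^+ 7 * (n ^+ 2 * xh + xh ^+ 2 - w ^+ 2)
    - 21 * S ^+ 11 * w ^+ 2 * (n ^+ 2 + 2 * xh) ^+ 2)
   - (6 * D ^+ 7 * xh * (n ^+ 2 - w ^+ 2 / r ^+ 2)
      - 21 * D ^+ 11 * w ^+ 2 * n ^+ 2 * (n ^+ 2 + 4 * xh))| <= 3000 * (m ^+ 2 * D ^+ 4).
Proof.
move=> n0 r0' m0 D0' S0' SD Dn Dw Sn Sw Sr Sm wrn wmn xmn dX.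
have [[r0 D0] S0] := (ltW r0', ltW D0', ltW S0').
have w0 := normr_ge0 w; have X0 := normr_ge0 xh.
have B0 : 0 <= m ^+ 2 * D ^+ 4 by rewrite mulr_ge0 ?exprn_ge0.
have Dn1 : 0 <= D * n <= 1 by rewrite mulr_ge0.
have Sn1 : 0 <= S * n <= 1 by rewrite mulr_ge0.
have Sm1 : 0 <= S * m <= 1 by rewrite mulr_ge0.
have Dw1 : 0 <= D ^+ 2 * `|w| <= 1 by rewrite mulr_ge0 ?exprn_ge0.
have Sw1 : 0 <= S ^+ 2 * `|w| <= 1 by rewrite mulr_ge0 ?exprn_ge0.
have Sr1 : 0 <= S * r / 2 <= 1 by rewrite mulr_ge0 ?mulr_ge0// ler_pdivrMr// mul1r.
have SB : m ^+ 2 * S ^+ 4 <= m ^+ 2 * D ^+ 4.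
  by rewrite ler_wpM2l ?exprn_ge0// lerXn2r ?nnegrE.
have SB0 : 0 <= m ^+ 2 * S ^+ 4 by rewrite mulr_ge0 ?exprn_ge0.
set B := m ^+ 2 * D ^+ 4 in B0 SB *.
(* [tB], [tE1], [tE2] pair equal terms of both operators and gain from [subX_irt]. [tC1], [tC2],
   [tE3] have no partner in [frem_val], where Z_4 cancels them, but carry powers of [S] only. The
   bounds below add up to 2760. *)
pose tA := 21 * r ^+ 2 * n ^+ 2 * m ^+ 4 * S ^+ 11.
pose tB := 6 * (D ^+ 7 - S ^+ 7) * (n ^+ 2 * xh).
pose tC1 := 6 * S ^+ 7 * xh ^+ 2.
pose tC2 := 6 * S ^+ 7 * w ^+ 2.
pose tD := 6 * D ^+ 7 * xh * (w ^+ 2 / r ^+ 2).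
pose tE1 := 21 * (D ^+ 11 - S ^+ 11) * (w ^+ 2 * n ^+ 4).
pose tE2 := 84 * (D ^+ 11 - S ^+ 11) * (w ^+ 2 * n ^+ 2 * xh).
pose tE3 := 84 * S ^+ 11 * (w ^+ 2 * xh ^+ 2).
rewrite (_ : _ - _ = - tA - tB + tC1 - tC2 + tD + tE1 + tE2 - tE3); last first.
  by rewrite /tA /tB /tC1 /tC2 /tD /tE1 /tE2 /tE3; ring.
have hA : r * `|tA| <= 168 * B.
  rewrite ger0_norm /tA ?mulr_ge0 ?exprn_ge0// ?ler0n//.
  have -> : r * (21 * r ^+ 2 * n ^+ 2 * m ^+ 4 * S ^+ 11) =
    ((S * r / 2) ^+ 3 * (S * n) ^+ 2 * (S * m) ^+ 2) * (168 * (m ^+ 2 * S ^+ 4)) by field.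
  apply: (@le_trans _ _ (168 * (m ^+ 2 * S ^+ 4))); last by rewrite ler_wpM2l ?ler0n.
  by apply: mul_le1; [in01|rewrite mulr_ge0 ?ler0n].
have xw2 : xh ^+ 2 <= m ^+ 2 * n ^+ 2.
  by rewrite -(sqr_normr xh) -exprMn lerXn2r ?nnegrE ?mulr_ge0.
have ww2 : w ^+ 2 <= m ^+ 2 * n ^+ 2.
  by rewrite -(sqr_normr w) -exprMn lerXn2r ?nnegrE ?mulr_ge0.
have hC (t : R) : 0 <= t -> t <= m ^+ 2 * n ^+ 2 -> r * `|6 * S ^+ 7 * t| <= 12 * B.
  move=> t0 tm; rewrite ger0_norm ?mulr_ge0 ?exprn_ge0//.
  apply: (@le_trans _ _ (r * (6 * S ^+ 7 * (m ^+ 2 * n ^+ 2)))).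
    by rewrite ler_wpM2l// ler_wpM2l// mulr_ge0 ?exprn_ge0.
  have -> : r * (6 * S ^+ 7 * (m ^+ 2 * n ^+ 2)) =
    ((S * n) ^+ 2 * (S * r / 2)) * (12 * (m ^+ 2 * S ^+ 4)) by field.
  apply: (@le_trans _ _ (12 * (m ^+ 2 * S ^+ 4))); last by rewrite ler_wpM2l ?ler0n.
  by apply: mul_le1; [in01|rewrite mulr_ge0 ?ler0n].
have hC1 := hC _ (sqr_ge0 xh) xw2; have hC2 := hC _ (sqr_ge0 w) ww2.
have hB : r * `|tB| <= 84 * B.
  rewrite /tB 2!normrM (ger0_norm (ler0n R 6)) normrM (ger0_norm (exprn_ge0 2 n0)).
  apply: (@le_trans _ _ (r * (6 * (7%:R * (D ^+ 7 * (S ^+ 4 * m ^+ 4))) * (n ^+ 2 * (m * n))))).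
    rewrite ler_wpM2l//; apply: ler_pM; rewrite ?mulr_ge0 ?exprn_ge0//.
      by rewrite ler_pM2l.
    by rewrite ler_wpM2l ?exprn_ge0.
  have -> : r * (6 * (7%:R * (D ^+ 7 * (S ^+ 4 * m ^+ 4))) * (n ^+ 2 * (m * n))) =
    ((D * n) ^+ 3 * (S * m) ^+ 3 * (S * r / 2)) * (84 * B) by rewrite /B; field.
  by apply: mul_le1; [in01|rewrite mulr_ge0 ?ler0n].
have hD : r * `|tD| <= 6 * B.
  have w2r : 0 <= w ^+ 2 / r ^+ 2 by rewrite mulr_ge0 ?invr_ge0 ?sqr_ge0.
  have D7 : 0 <= 6 * D ^+ 7 by rewrite mulr_ge0 ?exprn_ge0.
  rewrite /tD normrM (ger0_norm w2r) normrM (ger0_norm D7).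
  apply: (@le_trans _ _ (r * (6 * D ^+ 7 * (m * n) * ((r * n) * (m * n) / r ^+ 2)))).
    rewrite ler_wpM2l//; apply: ler_pM => //; first by rewrite mulr_ge0.
      by rewrite ler_wpM2l.
    rewrite ler_wpM2r ?invr_ge0 ?sqr_ge0// -(sqr_normr w) expr2.
    exact: ler_pM.
  have -> : r * (6 * D ^+ 7 * (m * n) * ((r * n) * (m * n) / r ^+ 2)) =
    (D * n) ^+ 3 * (6 * B) by rewrite /B; field; rewrite gt_eqF.
  by apply: mul_le1; [in01|rewrite mulr_ge0 ?ler0n].
have hE1 : r * `|tE1| <= 462 * B.
  rewrite /tE1 2!normrM (ger0_norm (ler0n R 21)).
  have wn4 : 0 <= w ^+ 2 * n ^+ 4 by rewrite mulr_ge0 ?sqr_ge0// exprn_ge0.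
  rewrite (ger0_norm wn4).
  apply: (@le_trans _ _ (r * (21 * (11%:R * (D ^+ 11 * (S ^+ 4 * m ^+ 4)))
      * ((`|w| * (m * n)) * n ^+ 4)))).
    rewrite ler_wpM2l//; apply: ler_pM => //; first by rewrite ler_pM2l.
    by rewrite ler_wpM2r ?exprn_ge0// -(sqr_normr w) expr2 ler_wpM2l.
  have -> : r * (21 * (11%:R * (D ^+ 11 * (S ^+ 4 * m ^+ 4))) * ((`|w| * (m * n)) * n ^+ 4)) =
    ((D ^+ 2 * `|w|) * (D * n) ^+ 5 * (S * m) ^+ 3 * (S * r / 2)) * (462 * B).
    by rewrite /B; field.
  by apply: mul_le1; [in01|rewrite mulr_ge0 ?ler0n].
have hE2 : r * `|tE2| <= 1848 * B.
  rewrite /tE2 2!normrM (ger0_norm (ler0n R 84)).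
  have wn2 : 0 <= w ^+ 2 * n ^+ 2 by rewrite mulr_ge0 ?sqr_ge0.
  rewrite [`|_ * xh|]normrM (ger0_norm wn2).
  apply: (@le_trans _ _ (r * (84 * (11%:R * (D ^+ 11 * (S ^+ 4 * m ^+ 4)))
      * (w ^+ 2 * n ^+ 2 * (m * n))))).
    rewrite ler_wpM2l//; apply: ler_pM => //; [by rewrite mulr_ge0| |].
      by rewrite ler_pM2l.
    by rewrite ler_wpM2l.
  rewrite -(sqr_normr w).
  have -> : r * (84 * (11%:R * (D ^+ 11 * (S ^+ 4 * m ^+ 4))) * (`|w| ^+ 2 * n ^+ 2 * (m * n))) =
    ((D ^+ 2 * `|w|) ^+ 2 * (D * n) ^+ 3 * (S * m) ^+ 3 * (S * r / 2)) * (1848 * B).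
    by rewrite /B; field.
  by apply: mul_le1; [in01|rewrite mulr_ge0 ?ler0n].
have hE3 : r * `|tE3| <= 168 * B.
  have wx2 : 0 <= w ^+ 2 * xh ^+ 2 by rewrite mulr_ge0 ?sqr_ge0.
  have S11 : 0 <= 84 * S ^+ 11 by rewrite mulr_ge0 ?ler0n ?exprn_ge0.
  rewrite /tE3 ger0_norm; last exact: mulr_ge0.
  apply: (@le_trans _ _ (r * (84 * S ^+ 11 * (w ^+ 2 * (m ^+ 2 * n ^+ 2))))).
    by rewrite ler_wpM2l// ler_wpM2l ?mulr_ge0 ?exprn_ge0// ler_wpM2l ?sqr_ge0.
  rewrite -(sqr_normr w).
  have -> : r * (84 * S ^+ 11 * (`|w| ^+ 2 * (m ^+ 2 * n ^+ 2))) =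
    ((S ^+ 2 * `|w|) ^+ 2 * (S * n) ^+ 2 * (S * r / 2)) * (168 * (m ^+ 2 * S ^+ 4)) by field.
  apply: (@le_trans _ _ (168 * (m ^+ 2 * S ^+ 4))); last by rewrite ler_wpM2l ?ler0n.
  by apply: mul_le1; [in01|rewrite mulr_ge0 ?ler0n].
have tri : `|- tA - tB + tC1 - tC2 + tD + tE1 + tE2 - tE3| <=
   `|tA| + `|tB| + `|tC1| + `|tC2| + `|tD| + `|tE1| + `|tE2| + `|tE3|.
  rewrite -(normrN tA) -(normrN tB) -(normrN tC2) -(normrN tE3).
  by do 7![apply: (le_trans (ler_normD _ _)); rewrite lerD2r].
apply: (le_trans (ler_wpM2l r0 tri)); rewrite !mulrDr.
by move: hC1 hC2; rewrite -/tC1 -/tC2 => hC1 hC2; lra.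
Qed.

End ScalarBounds.

(** * Pointwise bounds for the fields and for the correction kernels *)

Section KernelBounds.
Variable R : realType.
Implicit Types (x y : 'rV[R]_4) (k : nat) (e s d : R).
Local Notation H x y := (ev (hsqE x) y).
Local Notation w x y := (ev (omE x) y).
Local Notation b x i y := (ev (bE x i) y).
Local Notation c x i y := (ev (cE x i) y).
Local Notation r2 y := (ev (@rsqE R) y).
Local Notation xh x y := (ev (xhE x) y).
Local Notation rho x y := (ev (rhoE x) y).
Local Notation n x y := (enorm (y - x)).

Lemma enorm_ge0 y : 0 <= enorm y. Proof. exact: sqrtr_ge0. Qed.

Lemma enorm_sqr y : enorm y ^+ 2 = r2 y.
Proof. by rewrite enormE sqr_sqrtr// rsq_ge0. Qed.

Lemma enorm_sub_sqr x y : n x y ^+ 2 = H x y.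
Proof. by rewrite enorm_sqr ev_rsqE ev_hsqE !mxE. Qed.

Lemma enorm_msq x : enorm x ^+ 2 = msq x.
Proof. by rewrite enorm_sqr ev_rsqE. Qed.

Lemma enorm_gt0 y : y != 0 -> 0 < enorm y.
Proof. by move=> y0; rewrite enormE sqrtr_gt0 rsq_gt0. Qed.

Lemma abs_le_mul (a p q : R) : 0 <= p -> 0 <= q -> a ^+ 2 <= p ^+ 2 * q ^+ 2 -> `|a| <= p * q.
Proof.
move=> p0 q0; rewrite -exprMn -(sqr_normr a) => h.
by rewrite -(@ler_pXn2r _ 2) ?nnegrE ?mulr_ge0.
Qed.

Lemma b_le x i y : (i < 3)%N -> `|b x i y| <= enorm y * n x y.
Proof.
move=> i3; apply: abs_le_mul; rewrite ?enorm_ge0// enorm_sqr enorm_sub_sqr.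
have := sum_b2 x y; have := sqr_ge0 (w x y); have := sqr_ge0 (b x 0 y).
have := sqr_ge0 (b x 1 y); have := sqr_ge0 (b x 2 y).
by case: i i3 => [|[|[|//]]] _; lra.
Qed.

Lemma c_le x i y : (i < 3)%N -> `|c x i y| <= enorm y * n x y.
Proof.
move=> i3; apply: abs_le_mul; rewrite ?enorm_ge0// enorm_sqr enorm_sub_sqr.
have := sum_c2 x y; have := sqr_ge0 (xh x y + H x y); have := sqr_ge0 (c x 0 y).
have := sqr_ge0 (c x 1 y); have := sqr_ge0 (c x 2 y).
by case: i i3 => [|[|[|//]]] _; lra.
Qed.

Lemma om_le x y : `|w x y| <= enorm y * n x y.
Proof. by have := @c_le x 0 y isT; rewrite c0_eq normrN. Qed.

(** After [rsq_eq] and [b0_eq], Parseval for [h] reads [|x|^2 H = xh^2 + w^2 + b_1^2 + b_2^2], with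
    [b_1], [b_2] the products with T_2 y and T_3 y. *)
Lemma om_xh_le x y : `|w x y| <= enorm x * n x y /\ `|xh x y| <= enorm x * n x y.
Proof.
have := sum_b2 x y; have := sqr_ge0 (w x y); have := sqr_ge0 (xh x y).
have := sqr_ge0 (b x 1 y); have := sqr_ge0 (b x 2 y).
rewrite b0_eq (rsq_eq x) => h1 h2 h3 h4 h5.
by split; apply: abs_le_mul; rewrite ?enorm_ge0// enorm_msq enorm_sub_sqr; nra.
Qed.

Lemma enorm_le x y : enorm y <= enorm x + n x y.
Proof.
rewrite -(@ler_pXn2r _ 2) ?nnegrE ?addr_ge0 ?enorm_ge0//.
rewrite enorm_sqr (rsq_eq x) sqrrD enorm_msq enorm_sub_sqr -mulr_natl.
by have [_ /ler_normlW] := om_xh_le x y; lra.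
Qed.

Lemma irt_mul_le (t a : R) : 0 < t -> 0 <= a -> a ^+ 4 <= t -> irt t * a <= 1.
Proof.
move=> t0 a0 at4; rewrite -(@ler_pXn2r _ 4) ?nnegrE ?mulr_ge0 ?irt_ge0// expr1n.
by rewrite exprMn -(irt4 t0) ler_wpM2l ?exprn_ge0 ?irt_ge0.
Qed.

Lemma irt_sq_le (t a : R) : 0 < t -> a ^+ 2 <= t -> irt t ^+ 2 * `|a| <= 1.
Proof.
move=> t0 at2; rewrite -(@ler_pXn2r _ 2) ?nnegrE ?mulr_ge0 ?exprn_ge0 ?irt_ge0// expr1n.
by rewrite exprMn sqr_normr -exprM -(irt4 t0) ler_wpM2l ?exprn_ge0 ?irt_ge0.
Qed.

Lemma rho_enorm x y : rho x y = n x y ^+ 4 + 4 * w x y ^+ 2.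
Proof. by rewrite rho_eq -enorm_sub_sqr -exprM. Qed.

Lemma irt_rho_le x y e : 0 <= e -> 0 < rho x y + e ->
  irt (rho x y + e) * n x y <= 1 /\ irt (rho x y + e) ^+ 2 * `|w x y| <= 1.
Proof.
move=> e0 re; have w2 := sqr_ge0 (w x y).
have n4 : 0 <= n x y ^+ 4 by rewrite exprn_ge0 ?enorm_ge0.
by split; [apply: irt_mul_le; rewrite ?enorm_ge0//|apply: irt_sq_le => //];
  move: re; rewrite rho_enorm; lra.
Qed.

(* The regularization [rho + |x|^4] keeps [psiE] smooth and comparable to
   [max(|x|, d(x, y))^-3]. *)
Definition sx x : R := enorm x ^+ 4.

Lemma rho_sx_gt0 x y : x != 0 -> 0 < rho x y + sx x.
Proof. by move=> x0; rewrite ltr_wpDl ?rho_ge0// exprn_gt0 ?enorm_gt0. Qed.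

Lemma irt_sx_le x y : x != 0 ->
  irt (rho x y + sx x) * enorm x <= 1 /\ irt (rho x y + sx x) * enorm y <= 2.
Proof.
move=> x0; have rs := rho_sx_gt0 y x0.
have h1 : irt (rho x y + sx x) * enorm x <= 1.
  by apply: irt_mul_le; rewrite ?enorm_ge0// lerDr rho_ge0.
split=> //; have [|h2 _] := @irt_rho_le x y (sx x) _ rs.
  by rewrite exprn_ge0 ?enorm_ge0.
apply: (@le_trans _ _ (irt (rho x y + sx x) * (enorm x + n x y))); last by lra.
by rewrite ler_wpM2l ?irt_ge0// enorm_le.
Qed.

Lemma ld_rho_le x i y : (i < 3)%N -> `|ev (ld (tc i) (rhoE x)) y| <=
  4 * n x y ^+ 2 * (enorm y * n x y) + 8 * `|w x y| * (enorm y * n x y).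
Proof.
move=> i3; rewrite ld_rho// -enorm_sub_sqr.
apply: (le_trans (ler_normB _ _)); apply: lerD.
  have n2 : 0 <= 4 * n x y ^+ 2 by rewrite mulr_ge0 ?sqr_ge0.
  by rewrite normrM (ger0_norm n2) ler_wpM2l// b_le.
rewrite normrM [`|8 * _|]normrM (ger0_norm (ler0n R 8)) ler_wpM2l//.
exact: c_le.
Qed.

Lemma a_le x e i y : (i < 3)%N -> 0 <= e -> 0 < rho x y + e -> x != 0 ->
  `|ev (aE x e (sx x) i) y| <=
    30 * (enorm y * irt (rho x y + e) ^+ 4 * irt (rho x y + sx x) ^+ 4).
Proof.
move=> i3 e0 re x0; have rs := rho_sx_gt0 y x0.
have [En Ew] := irt_rho_le e0 re.
have [|Sn Sw] := @irt_rho_le x y (sx x) _ rs; first by rewrite exprn_ge0 ?enorm_ge0.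
have FB j l k : (j < 3)%N -> (l < 3)%N -> (k < 3)%N -> _ := fun hj hl hk =>
  field_bound (enorm_ge0 (y - x)) (enorm_ge0 y) (irt_ge0 _) (irt_ge0 _) En Ew Sn Sw
    (@b_le x j y hj) (@c_le x l y hl) (@ld_rho_le x k y hk).
set E := irt (rho x y + e) in En Ew FB *; set S := irt (rho x y + sx x) in Sn Sw FB *.
set u := 5 / 4 * E ^+ 9 * S ^+ 4 + E ^+ 5 * S ^+ 8 in FB.
have u0 : 0 <= u by rewrite addr_ge0// !mulr_ge0 ?exprn_ge0 ?irt_ge0//; lra.
have tri (p q t : R) : `|p| + `|q| + `|w x y| * u * `|t| <= 30 * (enorm y * E ^+ 4 * S ^+ 4) ->
    `|p - q - w x y * u * t| <= 30 * (enorm y * E ^+ 4 * S ^+ 4).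
  apply: le_trans; apply: (le_trans (ler_normB _ _)); apply: lerD; first exact: ler_normB.
  by rewrite !normrM (ger0_norm u0).
have tri' (p q t : R) : `|p| + `|q| + `|w x y| * u * `|t| <= 30 * (enorm y * E ^+ 4 * S ^+ 4) ->
    `|p + q + w x y * u * t| <= 30 * (enorm y * E ^+ 4 * S ^+ 4).
  apply: le_trans; apply: (le_trans (ler_normD _ _)); apply: lerD; first exact: ler_normD.
  by rewrite !normrM (ger0_norm u0).
case: i i3 => [|[|[|//]]] _.
- have -> : ev (aE x e (sx x) 0) y = E ^+ 5 * S ^+ 4 * b x 0 y.
    by rewrite /aE /phiE /irE /= -/E -/S; ring.
  have := FB 0%N 0%N 0%N isT isT isT; apply: le_trans.
  by rewrite -addrA lerDl addr_ge0 ?normr_ge0// mulr_ge0 ?normr_ge0// mulr_ge0 ?normr_ge0.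
- have -> : ev (aE x e (sx x) 1) y = E ^+ 5 * S ^+ 4 * b x 1 y
      - E ^+ 5 * S ^+ 4 * c x 2 y - w x y * u * ev (ld (tc 2) (rhoE x)) y.
    by rewrite /aE /phiE /irE /= ld_om// -/E -/S /u; field.
  by apply: tri; exact: FB.
- have -> : ev (aE x e (sx x) 2) y = E ^+ 5 * S ^+ 4 * b x 2 y
      + E ^+ 5 * S ^+ 4 * c x 1 y + w x y * u * ev (ld (tc 1) (rhoE x)) y.
    by rewrite /aE /phiE /irE /= ld_om// -/E -/S /u; field.
  by apply: tri'; exact: FB.
Qed.

Lemma div_rest_le x e y : 0 <= e -> 0 < rho x y + e -> x != 0 ->
  `|div_rest x e (sx x) y| <=
    100 * (enorm y * irt (rho x y + e) ^+ 4 * irt (rho x y + sx x) ^+ 4).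
Proof.
move=> e0 re x0; have rs := rho_sx_gt0 y x0.
have [En Ew] := irt_rho_le e0 re.
have [|Sn Sw] := @irt_rho_le x y (sx x) _ rs; first by rewrite exprn_ge0 ?enorm_ge0.
have [_ Sr] := irt_sx_le y x0.
have := rest_bound (enorm_ge0 (y - x)) (enorm_ge0 y) (irt_ge0 _) (irt_ge0 _) En Ew Sn Sw Sr
  (@b_le x 0 y isT) (om_le x y).
by rewrite -rho_enorm enorm_sub_sqr enorm_sqr.
Qed.

(* [G N x i] is Z_i Gamma + K_i and [G0 N x] is f_x + K_0, where [N] stands for
   [normalizer x]. *)
Definition G N x (i : nat) y : R :=
  (enorm y)^-1 * ((CHR R)^-1 * ev (ld (tc i) (psiE x (sx x))) y)
  + N * ev (aE x 0 (sx x) i) y.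

Definition G0 N x y : R :=
  (CHR R)^-1 / r2 y * lap_psi x (sx x) y + N / enorm y * div_rest x 0 (sx x) y.

Lemma dist_pow x y : dist x y ^ (- Q + 1) = irt (rho x y) ^+ 4
  /\ dist y x ^ (- Q + 1) = irt (rho x y) ^+ 4.
Proof.
have [-> ->] := dist_rho x y; have -> : - Q + 1 = - 4%:Z by [].
by rewrite -exprnN exprVn invrK.
Qed.

Lemma dist0 y : dist y 0 = enorm y.
Proof.
have [_ ->] := dist_rho 0 y.
have -> : rho 0 y = enorm y ^+ 4.
  by rewrite rho_enorm subr0 ev_omE !mxE; ring.
have [y0|yn] := eqVneq (enorm y) 0; first by rewrite y0 expr0n irt0 invr0.
have e0 : 0 < enorm y by rewrite lt0r yn enorm_ge0.
have e4 : 0 < enorm y ^+ 4 by rewrite exprn_gt0.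
have p : irt (enorm y ^+ 4) * enorm y = 1.
  apply: (@pexpIrn _ 4); rewrite // ?nnegrE ?mulr_ge0 ?irt_ge0 ?enorm_ge0//.
  by rewrite exprMn irt4// expr1n.
by rewrite -[LHS]mulr1 -p mulKf// lt0r_neq0// irt_gt0.
Qed.

Lemma vact_Gam x y (i : 'I_3) : y != x -> y != 0 ->
  vact (Z i) (Gam x) y =
  (enorm y)^-1 * ((CHR R)^-1 * ev (ld (tc i) (psiE x 0)) y).
Proof.
move=> yx y0; rewrite /vact.
have -> : Gam x = ev (gamE x) by apply/funext => z; exact: (Gam_ev x z).1.
rewrite (@derive_scaled _ (tc i) _ _ _ (enorm y)^-1).
- by rewrite /gamE /=; ring.
- by move=> k; rewrite mxE ev_tc.
- by split=> //; apply: ok_psi; rewrite addr0 rho_gt0.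
Qed.

Lemma subX_rho x y k : y != x -> x != 0 ->
  `|irt (rho x y) ^+ k - irt (rho x y + sx x) ^+ k| <=
  k%:R * (irt (rho x y) ^+ k * (irt (rho x y + sx x) ^+ 4 * enorm x ^+ 4)).
Proof.
move=> yx x0; have r0 : 0 < rho x y by rewrite rho_gt0.
have rs := rho_sx_gt0 y x0.
apply: (@subX_irt _ _ _ _ (rho x y)); rewrite ?irt_gt0 ?irt4//.
by apply: irt_le => //; rewrite lerDl exprn_ge0 ?enorm_ge0.
Qed.

(** Replacing Gamma by Psi costs [D^7 - S^7], where [S^4 m^4 = (S m)^2 (S r)^2 m^2 / r^2] and 252 =
    3/4 * 7 * 12 * 4. For the field, [m^3 r S^4 = (S m) (S r)^3 m^2 / r^2] and 240 = 30 * 8. The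
    factors 4 and 8 come from [S r <= 2]. *)
Lemma G_bound N x (i : 'I_3) y cN : x != 0 -> y != x -> y != 0 ->
  `|N| <= cN * enorm x ^+ 3 -> 0 <= cN ->
  `|G N x i y - vact (Z i) (Gam x) y| <=
  (252 * `|(CHR R)^-1| + 240 * cN) * enorm x ^+ 2 * dist x y ^ (- Q + 1) * dist y 0 ^ (- Q + 3).
Proof.
move=> x0 yx y0 NcN cN0; rewrite vact_Gam// dist0 (dist_pow x y).1.
have -> : - Q + 3 = - 2%:Z by []; rewrite -exprnN.
have r0 := enorm_gt0 y0; have m0 := enorm_gt0 x0.
have rh0 : 0 < rho x y by rewrite rho_gt0.
have rs := rho_sx_gt0 y x0.
have D0 := irt_gt0 rh0; have S0 := irt_gt0 rs.
have [Sm Sr] := irt_sx_le y x0.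
have rh0' : 0 < rho x y + 0 by rewrite addr0.
have [Dn Dw] := irt_rho_le (lexx 0) rh0'; rewrite addr0 in Dn Dw.
have dX := subX_rho 7 yx x0.
have t_le := @ld_rho_le x i y (ltn_ord i).
have := @a_le x 0 i y (ltn_ord i) (lexx 0) rh0' x0; rewrite addr0.
rewrite /G !ev_ld_psi addr0.
set D := irt (rho x y) in D0 Dn Dw dX *; set S := irt _ in S0 Sm Sr dX *.
set t := ev (ld (tc i) (rhoE x)) y in t_le *; set a := ev (aE _ _ _ _) y.
set r := enorm y in r0 Sr t_le *; set m := enorm x in m0 Sm dX NcN *.
set ka := (CHR R)^-1; set v := `|w x y| in t_le Dw; set nn := n x y in t_le Dn.
have nn0 : 0 <= nn by exact: enorm_ge0.
have v0 : 0 <= v by exact: normr_ge0.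
move=> a_le.
pose B := m ^+ 2 * D ^+ 4 / r ^+ 2.
have B0 : 0 <= B by rewrite /B !mulr_ge0 ?invr_ge0 ?exprn_ge0 ?ltW.
have Sm1 : 0 <= S * m <= 1 by rewrite mulr_ge0 ?(ltW S0) ?(ltW m0).
have Dn1 : 0 <= D * nn <= 1 by rewrite mulr_ge0 ?(ltW D0).
have Dw1 : 0 <= D ^+ 2 * v <= 1 by rewrite mulr_ge0 ?exprn_ge0 ?(ltW D0).
have Sr1 : 0 <= S * r / 2 <= 1 by rewrite !mulr_ge0 ?(ltW S0) ?(ltW r0)//= ler_pdivrMr// mul1r.
have tD : D ^+ 3 * `|t| <= 12 * r.
  apply: (@le_trans _ _ (D ^+ 3 * (4 * nn ^+ 2 * (r * nn) + 8 * v * (r * nn)))).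
    by rewrite ler_wpM2l// exprn_ge0// ltW.
  have h1 : (D * nn) ^+ 3 * r <= r by apply: mul_le1; [in01|exact: ltW].
  have h2 : ((D ^+ 2 * v) * (D * nn)) * r <= r by apply: mul_le1; [in01|exact: ltW].
  have -> : D ^+ 3 * (4 * nn ^+ 2 * (r * nn) + 8 * v * (r * nn)) =
    4 * ((D * nn) ^+ 3 * r) + 8 * (((D ^+ 2 * v) * (D * nn)) * r) by ring.
  lra.
have -> : r^-1 * (ka * (- (3 / 4) * S ^+ 7 * t)) + N * a - r^-1 * (ka * (- (3 / 4) * D ^+ 7 * t))
  = ka * (3 / 4) * ((D ^+ 7 - S ^+ 7) * t / r) + N * a by field; rewrite gt_eqF.
apply: (le_trans (ler_normD _ _)).
rewrite [leRHS](_ : _ = 252 * `|ka| * B + 240 * cN * B); last first.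
  by rewrite /B -[_ ^- 2]/((_ ^+ 2)^-1); ring.
apply: lerD.
- rewrite normrM [`|ka * _|]normrM (ger0_norm (_ : 0 <= 3 / 4 :> R)); last by lra.
  have h : `|(D ^+ 7 - S ^+ 7) * t / r| <= 336 * B.
    rewrite normrM normrM normfV (ger0_norm (ltW r0)) ler_pdivrMr//.
    apply: (@le_trans _ _ (7%:R * (D ^+ 7 * (S ^+ 4 * m ^+ 4)) * `|t|)).
      by rewrite ler_wpM2r.
    have -> : 7%:R * (D ^+ 7 * (S ^+ 4 * m ^+ 4)) * `|t| =
      7 * (D ^+ 4 * (S ^+ 4 * m ^+ 4)) * (D ^+ 3 * `|t|) by ring.
    apply: (@le_trans _ _ (7 * (D ^+ 4 * (S ^+ 4 * m ^+ 4)) * (12 * r))).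
      by rewrite ler_wpM2l// !mulr_ge0 ?exprn_ge0 ?(ltW D0) ?(ltW S0) ?(ltW m0).
    have -> : 7 * (D ^+ 4 * (S ^+ 4 * m ^+ 4)) * (12 * r) =
      ((S * m) ^+ 2 * (S * r / 2) ^+ 2) * (336 * B * r) by rewrite /B; field; rewrite gt_eqF.
    by apply: mul_le1; [in01|exact: (mulr_ge0 (mulr_ge0 (ler0n _ _) B0) (ltW r0))].
  apply: (@le_trans _ _ (`|ka| * (3 / 4) * (336 * B))); last first.
    by rewrite le_eqVlt; apply/orP; left; apply/eqP; field.
  by rewrite ler_wpM2l ?mulr_ge0 ?normr_ge0//; lra.
- rewrite normrM.
  apply: (@le_trans _ _ (cN * m ^+ 3 * (30 * (r * D ^+ 4 * S ^+ 4)))).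
    by apply: ler_pM; rewrite ?normr_ge0.
  have -> : cN * m ^+ 3 * (30 * (r * D ^+ 4 * S ^+ 4)) =
    ((S * m) * (S * r / 2) ^+ 3) * (240 * cN * B) by rewrite /B; field; rewrite gt_eqF.
  by apply: mul_le1; [in01|exact: (mulr_ge0 (mulr_ge0 (ler0n _ _) cN0) B0)].
Qed.

Lemma G0_bound N x y cN : x != 0 -> y != x -> y != 0 ->
  `|N| <= cN * enorm x ^+ 3 -> 0 <= cN ->
  `|G0 N x y - frem x y| <=
  (3000 * `|(CHR R)^-1| + 800 * cN) * enorm x ^+ 2 * dist y x ^ (- Q + 1) * dist y 0 ^ (- Q + 2).
Proof.
move=> x0 yx y0 NcN cN0; rewrite frem_eq// dist0 (dist_pow x y).2.
have -> : - Q + 2 = - 3%:Z by []; rewrite -exprnN.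
have r0 := enorm_gt0 y0; have m0 := enorm_gt0 x0.
have rh0 : 0 < rho x y by rewrite rho_gt0.
have rs := rho_sx_gt0 y x0.
have D0 := irt_gt0 rh0; have S0 := irt_gt0 rs.
have [Sm Sr] := irt_sx_le y x0.
have rh0' : 0 < rho x y + 0 by rewrite addr0.
have [Dn Dw] := irt_rho_le (lexx 0) rh0'; rewrite addr0 in Dn Dw.
have [|Sn Sw] := @irt_rho_le x y (sx x) _ rs; first by rewrite exprn_ge0 ?enorm_ge0.
have [wm xm] := om_xh_le x y.
have SD : irt (rho x y + sx x) <= irt (rho x y).
  by apply: irt_le => //; rewrite lerDl exprn_ge0 ?enorm_ge0.
have LF := lap_frem_bound (enorm_ge0 (y - x)) r0 (enorm_ge0 x) D0 S0 SD Dn Dw Sn Sw Sr Sm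
  (om_le x y) wm xm (fun k => subX_rho k yx x0).
have := @div_rest_le x 0 y (lexx 0) rh0' x0; rewrite addr0.
have LE : lap_psi x (sx x) y - frem_val x y =
  - 21 * enorm y ^+ 2 * n x y ^+ 2 * enorm x ^+ 4 * irt (rho x y + sx x) ^+ 11
    + 6 * irt (rho x y + sx x) ^+ 7 * (n x y ^+ 2 * xh x y + xh x y ^+ 2 - w x y ^+ 2)
    - 21 * irt (rho x y + sx x) ^+ 11 * w x y ^+ 2 * (n x y ^+ 2 + 2 * xh x y) ^+ 2
   - (6 * irt (rho x y) ^+ 7 * xh x y * (n x y ^+ 2 - w x y ^+ 2 / enorm y ^+ 2)
      - 21 * irt (rho x y) ^+ 11 * w x y ^+ 2 * n x y ^+ 2 * (n x y ^+ 2 + 4 * xh x y)).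
  by rewrite /lap_psi /frem_val enorm_sub_sqr enorm_sqr.
move: LF; rewrite -LE /G0 -enorm_sqr {LE}.
set D := irt (rho x y) in D0 Dn Dw SD *; set S := irt (rho x y + sx x) in S0 Sm Sr Sn Sw SD *.
set lp := lap_psi _ _ _; set fv := frem_val x y; set e0 := div_rest _ _ _ _.
set r := enorm y in r0 Sr *; set m := enorm x in m0 Sm NcN *.
set ka := (CHR R)^-1 => LF e_le.
pose B := m ^+ 2 * D ^+ 4 / r ^+ 3.
have B0 : 0 <= B by rewrite /B !mulr_ge0 ?invr_ge0 ?exprn_ge0 ?ltW.
have Sm1 : 0 <= S * m <= 1 by rewrite mulr_ge0 ?(ltW S0) ?(ltW m0).
have Sr1 : 0 <= S * r / 2 <= 1 by rewrite !mulr_ge0 ?(ltW S0) ?(ltW r0)//= ler_pdivrMr// mul1r.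
have -> : ka / r ^+ 2 * lp + N / r * e0 - ka / r ^+ 2 * fv
  = ka * ((lp - fv) / r ^+ 2) + N * (e0 / r) by field; rewrite gt_eqF.
apply: (le_trans (ler_normD _ _)).
rewrite [leRHS](_ : _ = 3000 * `|ka| * B + 800 * cN * B); last first.
  by rewrite /B -[_ ^- 3]/((_ ^+ 3)^-1); ring.
apply: lerD.
- rewrite normrM (_ : 3000 * `|ka| * B = `|ka| * (3000 * B)); last by ring.
  rewrite ler_wpM2l// normrM (ger0_norm (_ : 0 <= (r ^+ 2)^-1)) ?invr_ge0 ?sqr_ge0//.
  rewrite ler_pdivrMr ?exprn_gt0// -(ler_pM2l r0).
  by apply: (le_trans LF); rewrite le_eqVlt; apply/orP; left; apply/eqP; rewrite /B; field; rewrite gt_eqF.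
- rewrite normrM.
  apply: (@le_trans _ _ (cN * m ^+ 3 * (100 * (D ^+ 4 * S ^+ 4)))).
    apply: ler_pM; rewrite ?normr_ge0// normrM normfV (ger0_norm (ltW r0)) ler_pdivrMr//.
    by apply: (le_trans e_le); rewrite le_eqVlt; apply/orP; left; apply/eqP; ring.
  have -> : cN * m ^+ 3 * (100 * (D ^+ 4 * S ^+ 4)) =
    ((S * m) * (S * r / 2) ^+ 3) * (800 * cN * B) by rewrite /B; field; rewrite gt_eqF.
  by apply: mul_le1; [in01|exact: (mulr_ge0 (mulr_ge0 (ler0n _ _) cN0) B0)].
Qed.

End KernelBounds.

(** * A uniformly integrable singularity on the line *)

Section OneDimensionalBounds.
Variable R : realType.
Local Notation L := (@lebesgue_measure R).
Implicit Types (d s t a b B : R).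

(** A smoothed [|s|^(-4/5)], integrable near 0 uniformly in [d]. The exponent reflects Q = 5: the
    function [1/rho] is split into powers 1/5 for each of three coordinates and 2/5 for [w], as [w]
    has weight 2. *)
Definition psi d s : R := (s ^+ 2 + d) `^ (- (2 / 5)).

Lemma sq_add_gt0 d s : 0 < d -> 0 < s ^+ 2 + d.
Proof. by move=> d0; rewrite ltr_wpDl ?sqr_ge0. Qed.

Lemma psi_gt0 d s : 0 < d -> 0 < psi d s.
Proof. by move=> d0; rewrite powR_gt0 ?sq_add_gt0. Qed.

Lemma powR_antitone (a b p : R) : 0 < a -> a <= b -> 0 <= p -> b `^ (- p) <= a `^ (- p).
Proof.
move=> a0 ab p0; have b0 := lt_le_trans a0 ab.
by rewrite !powRN lef_pV2 ?posrE ?powR_gt0// ge0_ler_powR ?nnegrE ?(ltW a0) ?(ltW b0).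
Qed.

(** A substitute for an antiderivative of [psi]: its derivative is at least [psi / 5], and its
    growth is at most linear uniformly in [d]. *)
Definition theta d s : R := s * psi d s.
Definition dtheta d s : R := psi d s * (5^-1 + 4 / 5 * d * (s ^+ 2 + d)^-1).

Lemma is_derive_psi d s : 0 < d ->
  is_derive s (1 : R) (psi d) (- (4 / 5) * s * psi d s / (s ^+ 2 + d)).
Proof.
move=> d0; have z0 := sq_add_gt0 s d0.
have Hz : is_derive s (1 : R) (fun s => s ^+ 2 + d) (2 * s).
  have -> : (fun s : R => s ^+ 2 + d) = (id * id + cst d : R -> R).
    by apply/funext => r; rewrite expr2.
  have hM := is_deriveM (is_derive_id s (1 : R)) (is_derive_id s (1 : R)).
  have h := is_deriveD hM (is_derive_cst d s (1 : R)).
  by apply: is_derive_eq h _; rewrite addr0 -![_ *: _]/(_ * _ : R) /= mulr1 mulr2n mulrDl mul1r.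
have := @is_derive1_comp _ _ (fun s => s ^+ 2 + d) s _ _ (is_derive1_powR (- (2 / 5)) z0) Hz.
rewrite -[_ \o _]/(psi d) => h; apply: is_derive_eq h _.
rewrite powRD; last by rewrite (gt_eqF z0) implybT.
rewrite powR_inv1 ?ltW// -/(psi d s); field; exact: lt0r_neq0.
Qed.

Lemma is_derive_theta d s : 0 < d -> is_derive s (1 : R) (theta d) (dtheta d s).
Proof.
move=> d0; have z0 := sq_add_gt0 s d0.
have h := is_deriveM (is_derive_id s (1 : R)) (is_derive_psi s d0).
apply: is_derive_eq h _.
rewrite /dtheta -![_ *: _]/(_ * _ : R) mulr1; field; exact: lt0r_neq0.
Qed.

Lemma psi_le_dtheta d s : 0 < d -> psi d s <= 5 * dtheta d s.
Proof.
move=> d0; have z0 := sq_add_gt0 s d0; have p0 := psi_gt0 s d0.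
have q0 : 0 <= 4 * d * (s ^+ 2 + d)^-1 by rewrite !mulr_ge0 ?invr_ge0 ?(ltW d0) ?(ltW z0).
rewrite (_ : 5 * dtheta d s = psi d s * (1 + 4 * d * (s ^+ 2 + d)^-1)).
  by rewrite ler_peMr ?(ltW p0)// lerDl.
by rewrite /dtheta; field; exact: lt0r_neq0.
Qed.

Lemma theta_le d s : 0 < d -> `|theta d s| <= 1 + `|s|.
Proof.
move=> d0; have z0 := sq_add_gt0 s d0; have s0 := normr_ge0 s.
have p0 : 0 <= 1 + `|s| by rewrite addr_ge0.
(* Fifth powers clear the exponent: [psi^5 = (s^2 + d)^-2], so the left side is at most [|s|]. *)
rewrite -(@ler_pXn2r _ 5) ?nnegrE//.
rewrite normrM exprMn (ger0_norm (ltW (psi_gt0 s d0))).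
have -> : psi d s ^+ 5 = (s ^+ 2 + d) ^- 2.
  rewrite -powR_mulrn ?ltW ?psi_gt0// -powRrM (_ : - (2 / 5) * 5%:R = - 2%:R); last by field.
  by rewrite powRN powR_mulrn// ltW.
apply: (@le_trans _ _ `|s|); last first.
  apply: (@le_trans _ _ (1 + `|s|)); first by rewrite lerDr.
  by rewrite ler_eXnr// lerDl.
rewrite ler_pdivrMr ?exprn_gt0// exprS ler_wpM2l//.
rewrite -[4%N]/(2 * 2)%N exprM real_normK ?num_real//.
by rewrite lerXn2r ?nnegrE ?sqr_ge0 ?(ltW z0)// lerDl ltW.
Qed.

Lemma psi_continuous d : 0 < d -> continuous (psi d).
Proof.
by move=> d0 s; apply: differentiable_continuous; apply/derivable1_diffP;
  have [] := is_derive_psi s d0.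
Qed.

Lemma dtheta_continuous d : 0 < d -> continuous (dtheta d).
Proof.
move=> d0 s; have z0 := sq_add_gt0 s d0.
apply: cvgM; first exact: psi_continuous.
apply: cvgD; first exact: cvg_cst.
apply: cvgM; first exact: cvg_cst.
apply: cvgV; first exact: lt0r_neq0.
by apply: cvgD; [exact: exprn_continuous|exact: cvg_cst].
Qed.

Lemma affine_continuous a b : continuous (fun t : R => a * t + b).
Proof.
by move=> t; apply: cvgD; [exact: mulrl_continuous|exact: cvg_cst].
Qed.

Lemma integral_psi_le d a b B : 0 < d -> a != 0 -> 0 < B ->
  (\int[L]_(t in `[(- B)%R, B]) (psi d (a * t + b))%:E
    <= (10 / `|a| * (1 + `|a| * B + `|b|))%:E)%E.
Proof.
move=> d0 a0 B0.
have caf := @affine_continuous a b.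
have cF : continuous (fun t => 5 * dtheta d (a * t + b)).
  move=> t; apply: cvgM; first exact: cvg_cst.
  exact: (continuous_cvg _ (@dtheta_continuous d d0 (a * t + b)) (caf t)).
have cp : continuous (fun t => psi d (a * t + b)).
  by move=> t; exact: (continuous_cvg _ (@psi_continuous d d0 (a * t + b)) (caf t)).
pose F t := 5 / a * theta d (a * t + b).
have dF t : is_derive t (1 : R) F (5 * dtheta d (a * t + b)).
  have Ha : is_derive t (1 : R) (fun t => a * t + b) a.
    have hZ := is_deriveZ a (is_derive_id t (1 : R)).
    have h := is_deriveD hZ (is_derive_cst b t (1 : R)).
    by apply: is_derive_eq h _; rewrite addr0 -[_ *: _]/(_ * _ : R) mulr1.
  have h := is_deriveZ (5 / a) (@is_derive1_comp _ _ (fun t => a * t + b) t _ _ (is_derive_theta (a * t + b) d0) Ha).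
  by apply: is_derive_eq h _; rewrite -[_ *: _]/(_ * _ : R); field.
have BB : - B < B by lra.
apply: (@le_trans _ _ (\int[L]_(t in `[(- B)%R, B]) (5 * dtheta d (a * t + b))%:E)%E).
  apply: ge0_le_integral => //.
  - by move=> t _; rewrite lee_fin ltW// psi_gt0.
  - by apply/measurable_EFinP; apply: measurable_funTS; exact: continuous_measurable_fun.
  - by apply/measurable_EFinP; apply: measurable_funTS; exact: continuous_measurable_fun.
  - by move=> t _; rewrite lee_fin psi_le_dtheta.
have dFF t : derivable F t 1 by have [] := dF t.
have cFF : continuous F by move=> t; apply: differentiable_continuous; apply/derivable1_diffP.
rewrite (@continuous_FTC2 _ _ F)//; last 3 first.
- by apply: continuous_subspaceT.
- split; first by move=> t _; exact: dFF.
  + by apply: cvg_at_right_filter; exact: cFF.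
  + by apply: cvg_at_left_filter; exact: cFF.
- by move=> t _; rewrite derive1E; have [_ ->] := dF t.
rewrite -EFinB lee_fin /F -mulrBr.
apply: (le_trans (ler_norm _)); rewrite normrM.
have -> : `|5 / a| = 5 / `|a| by rewrite normrM normfV ger0_norm.
have na : 0 < `|a| by rewrite normr_gt0.
rewrite [leRHS](_ : _ = 5 / `|a| * (2 * (1 + `|a| * B + `|b|))); last by field; rewrite gt_eqF.
rewrite ler_wpM2l ?divr_ge0 ?ler0n//.
apply: (le_trans (ler_normB _ _)).
have tb t : `|t| = B -> `|theta d (a * t + b)| <= 1 + `|a| * B + `|b|.
  move=> tB; apply: (le_trans (theta_le _ d0)).
  by rewrite -addrA lerD2l (le_trans (ler_normD _ _))// normrM tB.
have h1 := tb B (ger0_norm (ltW B0)).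
have h2 : `|theta d (a * - B + b)| <= 1 + `|a| * B + `|b|.
  by apply: tb; rewrite normrN ger0_norm// ltW.
lra.
Qed.

End OneDimensionalBounds.

(** * Splitting the inverse of [rho] into four one-dimensional factors *)

Section InverseRhoIntegrable.
Variable R : realType.
Local Notation L := (@lebesgue_measure R).
Local Notation MR := (measurableTypeR R).
Local Notation LL := (prod_sigma_finite L L).
Local Notation LLL := (prod_sigma_finite LL L).
Local Notation R4 := (MR * MR * MR * MR)%type.
Implicit Types (x y : 'rV[R]_4) (d B : R).
Local Notation co x k := ((x : 'rV[R]_4) ord0 (inord k)).
Local Notation w x y := (ev (omE x) y).
Local Notation rho x y := (ev (rhoE x) y).

(** The inner bound is asked for only where [f a != 0]: in [integral_slot_maj] the constant term of
    [w] along a slice is controlled only if the other coordinates lie in the box. *)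
Lemma slice_le disp (A : measurableType disp) (m : {sigma_finite_measure set A -> \bar R})
    (f : A -> R) (g : A * MR -> R) (M K : R) :
  measurable_fun setT f -> measurable_fun setT g ->
  (forall a, 0 <= f a) -> (forall p, 0 <= g p) -> 0 <= K ->
  (forall a, f a != 0 -> (\int[L]_t (g (a, t))%:E <= K%:E)%E) ->
  (\int[m]_a (f a)%:E <= M%:E)%E ->
  (\int[m \x L]_p (f p.1 * g p)%:E <= (M * K)%:E)%E.
Proof.
move=> mf mg f0 g0 K0 gK fM.
have mfg : measurable_fun setT (fun p : A * MR => (f p.1 * g p)%:E).
  apply/measurable_EFinP; apply: measurable_funM => //.
  exact: (measurableT_comp mf measurable_fst).
have fg0 (p : A * MR) : (0 <= (f p.1 * g p)%:E)%E by rewrite lee_fin mulr_ge0.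
have -> := fubini_tonelli1 (m1 := m) (m2 := L) _ mfg fg0.
have mga a : measurable_fun setT (fun t : MR => (g (a, t))%:E).
  by apply/measurable_EFinP; apply: (measurableT_comp mg); exact: measurable_pair1.
apply: (@le_trans _ _ (\int[m]_a ((f a)%:E * K%:E))%E).
  apply: ge0_le_integral => //.
  - by move=> a _; apply: integral_ge0.
  - exact: (measurable_fun_fubini_tonelli_F (m2 := L) _ mfg fg0).
  - by apply/measurable_EFinP; apply: measurable_funM => //; exact: measurable_cst.
  - move=> a _; rewrite /fubini_F /=.
    under eq_integral do rewrite EFinM.
    rewrite ge0_integralZl_EFin//; last by move=> t _; rewrite lee_fin.
    have [->|fa] := eqVneq (f a) 0; first by rewrite !mul0e.
    by rewrite lee_wpmul2l ?lee_fin//; exact: gK.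
rewrite ge0_integralZr//; last 2 first.
- exact/measurable_EFinP.
- by move=> a _; rewrite lee_fin.
by rewrite EFinM lee_wpmul2r ?lee_fin.
Qed.

Definition cut B t : R := \1_(`[- B, B]%classic : set MR) t.

Lemma cut_ge0 B t : 0 <= cut B t. Proof. by rewrite /cut indicE ler0n. Qed.

Lemma cutE B t : cut B t = if `|t| <= B then 1 else 0.
Proof.
rewrite /cut indicE; case: ifPn => h.
  by rewrite mem_set//= in_itv /= -ler_norml.
by rewrite memNset//= in_itv /= -ler_norml; exact/negP.
Qed.

Lemma measurable_cut B : measurable_fun setT (cut B : MR -> R).
Proof. exact: measurable_indic. Qed.

Lemma integral_cut_psi d a b B : 0 < d -> a != 0 -> 0 < B ->
  (\int[L]_t (cut B t * psi d (a * t + b))%:E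
    <= (10 / `|a| * (1 + `|a| * B + `|b|))%:E)%E.
Proof.
move=> d0 a0 B0; apply: le_trans (integral_psi_le b d0 a0 B0).
rewrite [leRHS]integral_mkcond le_eqVlt; apply/orP; left; apply/eqP.
apply: eq_integral => t _; rewrite /patch /cut indicE.
by case: (t \in _); rewrite ?mul1r ?mul0r.
Qed.

Lemma measurable_psi_affine d a b : 0 < d ->
  measurable_fun setT (fun t : MR => psi d (a * t + b)).
Proof.
move=> d0; apply: continuous_measurable_fun => t.
exact: (continuous_cvg _ (@psi_continuous R d d0 (a * t + b)) (@affine_continuous R a b t)).
Qed.

(** [M = (H + d)^2 + w^2 + d] is at most [3 (rho + d)], dominates each [(h_i^2 + d)^2] and also
    [w^2 + d]. Then [M^-1] is distributed over the four factors with 1/5 + 1/5 + 1/5 + 2/5 = 1. *)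
Lemma inv_rho_le x y d (h0 h1 h2 : R) : 0 < d -> d <= 1 ->
  h0 ^+ 2 <= ev (hsqE x) y -> h1 ^+ 2 <= ev (hsqE x) y -> h2 ^+ 2 <= ev (hsqE x) y ->
  (rho x y + d)^-1 <= 3 * (psi d h0 * psi d h1 * psi d h2 * psi d (w x y)).
Proof.
move=> d0 d1 hh0 hh1 hh2.
set H := ev (hsqE x) y in hh0 hh1 hh2.
have H0 : 0 <= H by exact: hsq_ge0.
pose M := (H + d) ^+ 2 + w x y ^+ 2 + d.
have w2 := sqr_ge0 (w x y).
have Hd2 := sqr_ge0 (H + d).
have M0 : 0 < M by rewrite /M; lra.
have MT : M <= 3 * (rho x y + d).
  by rewrite rho_eq -/H /M; have := sqr_ge0 (H - d); nra.
have psiM h : h ^+ 2 <= H -> M `^ (- (1 / 5)) <= psi d h.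
  move=> hH; rewrite /psi.
  have z0 := sq_add_gt0 h d0.
  have -> : - (2 / 5) = 2%:R * (- (1 / 5)) :> R by field.
  rewrite powRrM powR_mulrn ?(ltW z0)//.
  apply: powR_antitone; rewrite ?exprn_gt0//.
  apply: (@le_trans _ _ ((H + d) ^+ 2)); last by rewrite /M; lra.
  by rewrite lerXn2r ?nnegrE ?(ltW z0)//; lra.
have psiw : M `^ (- (2 / 5)) <= psi d (w x y).
  by apply: powR_antitone; rewrite ?sq_add_gt0// /M; lra.
have P0 : 0 <= M `^ (- (1 / 5)) by exact: powR_ge0.
have Q0 : 0 <= M `^ (- (2 / 5)) by exact: powR_ge0.
have Minv : M^-1 = M `^ (- (1 / 5)) * M `^ (- (1 / 5)) * M `^ (- (1 / 5)) * M `^ (- (2 / 5)).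
  rewrite -!powRD; last 3 first.
  - by rewrite (gt_eqF M0) implybT.
  - by rewrite (gt_eqF M0) implybT.
  - by rewrite (gt_eqF M0) implybT.
  by rewrite -powR_inv1 ?(ltW M0)//; congr (_ `^ _); field.
have r0 : 0 < rho x y + d by rewrite ltr_wpDl ?rho_ge0.
apply: (@le_trans _ _ (3 * M^-1)).
  by rewrite ler_pdivlMr// ler_pdivrMl// mulrC.
rewrite ler_pM2l// Minv; apply: ler_pM => //; first by rewrite !mulr_ge0.
  apply: ler_pM => //; first by rewrite !mulr_ge0.
    by apply: ler_pM => //; exact: psiM.
  exact: psiM.
Qed.

(** The coordinates of [Jx], that is, the slopes of [w] in the coordinate directions. *)
Definition om_coef x (j : nat) : R := [:: - co x 2; - co x 3; co x 0; co x 1]`_j.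

Lemma om_slot x j (q : MR * MR * MR) (t : MR) : (j < 4)%N ->
  w x (pt (slot j (q, t))) = om_coef x j * t + w x (pt (slot j (q, 0))).
Proof.
move=> j4; rewrite !ev_omE !pt_slot_coord// !pt_coord//.
by case: j j4 => [|[|[|[|//]]]] _ /=; rewrite /om_coef /=; ring.
Qed.

Definition om_bd x B : R := (`|co x 0| + `|co x 1| + `|co x 2| + `|co x 3|) * B.

Lemma om_cube_le x B y : box B y -> `|w x y| <= om_bd x B.
Proof.
move=> By; rewrite ev_omE /om_bd.
have T (p q : R) k : (k < 4)%N -> `|p * co y k| <= `|p| * B.
  by move=> k4; rewrite normrM ler_wpM2l// By.
have h0 := T (co x 0) 0 2%N isT; have h1 := T (co x 1) 0 3%N isT.
have h2 := T (co x 2) 0 0%N isT; have h3 := T (co x 3) 0 1%N isT.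
by move: h0 h1 h2 h3; rewrite !ler_norml => /andP[? ?] /andP[? ?] /andP[? ?] /andP[? ?];
  apply/andP; split; lra.
Qed.

(* The three slots other than the last one carry the coordinates
   [if i == j then 3 else i]. *)
Definition slot_maj x j d B (p : R4) : R :=
  let s i := co x (if i == j then 3 else i) in
  (cut B p.1.1.1 * psi d (1 * p.1.1.1 - s 0%N)) * (cut B p.1.1.2 * psi d (1 * p.1.1.2 - s 1%N))
  * (cut B p.1.2 * psi d (1 * p.1.2 - s 2%N)) * (cut B p.2 * psi d (w x (pt (slot j p)))).

Definition slot_const x j B : R :=
  let K i := 10 / `|1| * (1 + `|1| * B + `|- co x (if i == j then 3 else i)|) in
  K 0%N * K 1%N * K 2%N
  * (10 / `|om_coef x j| * (1 + `|om_coef x j| * B + om_bd x B)).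

Lemma measurable_om_slot x j d : 0 < d ->
  measurable_fun setT (fun p : R4 => psi d (w x (pt (slot j p)))).
Proof.
move=> d0; apply: (@measurable_pt_slot R j (fun y => psi d (w x y))).
apply: measurable_continuous => y.
exact: (continuous_cvg _ (@psi_continuous R d d0 _) (ev_continuous (ok_om x y))).
Qed.

Lemma measurable_slot_maj x j d B : 0 < d -> measurable_fun setT (slot_maj x j d B).
Proof.
move=> d0.
have mc b : measurable_fun setT (fun t : MR => cut B t * psi d (1 * t - b)).
  by apply: measurable_funM; [exact: measurable_cut|exact: measurable_psi_affine].
have m11 : measurable_fun setT (fun p : R4 => p.1.1).
  by apply: measurableT_comp; [exact: measurable_fst|exact: measurable_fst].
apply: measurable_funM; last first.
  apply: measurable_funM; last exact: measurable_om_slot.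
  exact: (measurableT_comp (@measurable_cut B) measurable_snd).
apply: measurable_funM; last first.
  apply: (measurableT_comp (mc _)).
  by apply: measurableT_comp; [exact: measurable_snd|exact: measurable_fst].
apply: measurable_funM; apply: (measurableT_comp (mc _)).
- exact: (measurableT_comp measurable_fst m11).
- exact: (measurableT_comp measurable_snd m11).
Qed.

Lemma slot_maj_ge0 x j d B p : 0 < d -> 0 <= slot_maj x j d B p.
Proof.
by move=> d0; rewrite /slot_maj !mulr_ge0 ?cut_ge0 ?(ltW (psi_gt0 _ d0)).
Qed.

(** Along slot [j] the form [w] is affine with nonzero slope, so [w] can serve as the fourth
    variable and Tonelli's theorem reduces the integral to four applications of
    [integral_cut_psi]. *)
Lemma integral_slot_maj x j d B : (j < 4)%N -> 0 < d -> om_coef x j != 0 -> 0 < B ->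
  (\int[@leb4 R]_p (slot_maj x j d B p)%:E <= (slot_const x j B)%:E)%E.
Proof.
move=> j4 d0 a0 B0.
have one0 : 1 != 0 :> R by exact: oner_neq0.
have mc b : measurable_fun setT (fun t : MR => cut B t * psi d (1 * t - b)).
  by apply: measurable_funM; [exact: measurable_cut|exact: measurable_psi_affine].
have pos s t : 0 <= cut B t * psi d s by rewrite mulr_ge0 ?cut_ge0 ?(ltW (psi_gt0 _ d0)).
have K0 (a b : R) : 0 <= 10 / `|a| * (1 + `|a| * B + `|b|).
  by rewrite mulr_ge0 ?divr_ge0 ?ler0n// !addr_ge0// mulr_ge0// ltW.
have obd0 : 0 <= om_bd x B by rewrite mulr_ge0 ?(ltW B0)// !addr_ge0.
pose s i := co x (if i == j then 3 else i).
pose f1 (t : MR) : R := cut B t * psi d (1 * t - s 0%N).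
pose f2 (p : MR * MR) : R := f1 p.1 * (cut B p.2 * psi d (1 * p.2 - s 1%N)).
pose f3 (p : MR * MR * MR) : R := f2 p.1 * (cut B p.2 * psi d (1 * p.2 - s 2%N)).
have mf1 : measurable_fun setT f1 by exact: mc.
have mf2 : measurable_fun setT f2.
  apply: measurable_funM; first exact: (measurableT_comp mf1 measurable_fst).
  exact: (measurableT_comp (mc _) measurable_snd).
have mf3 : measurable_fun setT f3.
  apply: measurable_funM; first exact: (measurableT_comp mf2 measurable_fst).
  exact: (measurableT_comp (mc _) measurable_snd).
have f10 t : 0 <= f1 t by exact: pos.
have f20 p : 0 <= f2 p by rewrite mulr_ge0.
have f30 p : 0 <= f3 p by rewrite mulr_ge0.
have I1 := integral_cut_psi (- s 0%N) d0 one0 B0.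
have I2 : (\int[LL]_p (f2 p)%:E <= (10 / `|1| * (1 + `|1| * B + `|- s 0%N|) *
    (10 / `|1| * (1 + `|1| * B + `|- s 1%N|)))%:E)%E.
  apply: (@slice_le _ _ L f1 (fun p => cut B p.2 * psi d (1 * p.2 - s 1%N))) => //.
  - exact: (measurableT_comp (mc _) measurable_snd).
  - by move=> a _; exact: integral_cut_psi.
have I3 : (\int[LLL]_p (f3 p)%:E <= (10 / `|1| * (1 + `|1| * B + `|- s 0%N|) *
    (10 / `|1| * (1 + `|1| * B + `|- s 1%N|)) * (10 / `|1| * (1 + `|1| * B + `|- s 2%N|)))%:E)%E.
  apply: (@slice_le _ _ LL f2 (fun p => cut B p.2 * psi d (1 * p.2 - s 2%N))) => //.
  - exact: (measurableT_comp (mc _) measurable_snd).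
  - by move=> a _; exact: integral_cut_psi.
apply: (@slice_le _ _ LLL f3 (fun p => cut B p.2 * psi d (w x (pt (slot j p))))) => //.
- apply: measurable_funM; last exact: measurable_om_slot.
  exact: (measurableT_comp (@measurable_cut B) measurable_snd).
- by rewrite mulr_ge0 ?divr_ge0 ?ler0n// !addr_ge0// mulr_ge0// ltW.
- move=> q fq.
  under eq_integral do rewrite om_slot//.
  apply: (le_trans (integral_cut_psi _ d0 a0 B0)).
  rewrite lee_fin ler_wpM2l ?divr_ge0 ?ler0n// lerD2l om_cube_le//.
  have : [/\ `|q.1.1| <= B, `|q.1.2| <= B & `|q.2| <= B].
    move: fq; rewrite /f3 /f2 /f1 !cutE.
    by case: ifP => //; case: ifP => //; case: ifP; rewrite ?mul0r ?mulr0 ?mul0r ?eqxx.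
  move=> [q0 q1 q2].
  have hq k : (k < 4)%N -> `|pt (q, 0) ord0 (inord k)| <= B.
    by move=> k4; rewrite pt_coord//; case: k k4 => [|[|[|[|//]]]] _ //=; rewrite normr0 ltW.
  move=> k k4; rewrite pt_slot_coord//=.
  case: ifP => _; first by rewrite normr0 ltW.
  by case: ifP => _; exact: hq.
Qed.

End InverseRhoIntegrable.

(** * Local integrability of the inverse of [rho] *)

Section Domination.
Variable R : realType.
Local Notation MR := (measurableTypeR R).
Local Notation R4 := (MR * MR * MR * MR)%type.
Implicit Types (x y : 'rV[R]_4) (d B : R).
Local Notation co x k := ((x : 'rV[R]_4) ord0 (inord k)).
Local Notation rho x y := (ev (rhoE x) y).

Lemma om_coef_neq0 x : x != 0 -> exists2 j, (j < 4)%N & om_coef x j != 0.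
Proof.
move=> x0; apply: contrapT => h; move/eqP: x0; apply; apply: row4P => k k4.
rewrite mxE; apply/eqP; apply: contrapT => /negP xk; apply: h.
case: k k4 xk => [|[|[|[|//]]]] _ xk.
- by exists 2%N.
- by exists 3%N.
- by exists 0%N; rewrite // /om_coef /= oppr_eq0.
- by exists 1%N; rewrite // /om_coef /= oppr_eq0.
Qed.

Lemma indic_box B (p : R4) : \1_(@box R B) (pt p) = \1_(cube B) p :> R.
Proof.
rewrite !indicE (_ : (pt p \in box B) = (p \in cube B))//.
by apply/idP/idP; rewrite !inE => h; exact/cubeP.
Qed.

Lemma measurable_indic_box B : measurable_fun setT (fun p : R4 => \1_(@box R B) (pt p) : R).
Proof.
under eq_fun do rewrite indic_box.
by apply: measurable_indic; exact: measurable_cube.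
Qed.

Lemma rho_continuous x : continuous (ev (rhoE x)).
Proof. by move=> y; apply: ev_continuous; exact: ok_rho. Qed.

Lemma measurable_rho x : measurable_fun setT (fun p : R4 => rho x (pt p)).
Proof. exact: (measurable_continuous (@rho_continuous x)). Qed.

Definition invE x d : ex R := ((irE x d * irE x d) * (irE x d * irE x d))%E4.

Lemma ok_invE x d y : 0 < d -> ok (invE x d) y.
Proof.
by move=> d0; do ![split] => /=; try exact: ok_rho; rewrite ltr_wpDl ?rho_ge0.
Qed.

Lemma invE_inv x d y : 0 < d -> ev (invE x d) y = (rho x y + d)^-1.
Proof.
move=> d0; have r0 : 0 < rho x y + d by rewrite ltr_wpDl ?rho_ge0.
apply: (mulIf (lt0r_neq0 r0)); rewrite mulVf ?lt0r_neq0// -(irt4 r0).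
by rewrite /invE /irE /=; ring.
Qed.

Lemma measurable_inv_rho x d : 0 < d ->
  measurable_fun setT (fun p : R4 => (rho x (pt p) + d)^-1).
Proof.
move=> d0; under eq_fun do rewrite -invE_inv//.
by apply: measurable_continuous => y; apply: ev_continuous; exact: ok_invE.
Qed.

Lemma slot_dominates x j d B (p : R4) : (j < 4)%N -> 0 < d -> d <= 1 ->
  \1_(@box R B) (pt (slot j p)) * (rho x (pt (slot j p)) + d)^-1
  <= 3 * slot_maj x j d B p.
Proof.
move=> j4 d0 d1; rewrite indicE.
have [By|] := pselect (box B (pt (slot j p))); last first.
  by move=> nB; rewrite memNset// mul0r mulr_ge0 ?slot_maj_ge0.
rewrite mem_set// mul1r.
have [[[h0 h1] h2] h3] : cube B p.
  apply/cubeP => k k4.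
  have Bk := By k k4; have Bj := By j j4; have B3 := By 3%N isT.
  move: Bk Bj B3; rewrite !pt_slot_coord// !pt_coord// eqxx.
  by case: j j4 {By} => [|[|[|[|//]]]] _; case: k k4 => [|[|[|[|//]]]] _ /=.
rewrite /slot_maj !cutE.
have cuti t : [set` `[- B, B]] t -> `|t| <= B by rewrite /= in_itv /= -ler_norml.
rewrite !cuti// !mul1r.
apply: inv_rho_le => //; rewrite ev_hsqE; set y := pt (slot j p).
- have -> : p.1.1.1 = co y (if 0%N == j then 3 else 0)%N.
    by rewrite /y pt_slot_coord//; case: j j4 {By y} => [|[|[|[|//]]]] _ /=; rewrite ?pt_coord.
  by case: ifP => _; have := sqr_ge0 (co y 0 - co x 0); have := sqr_ge0 (co y 1 - co x 1);
    have := sqr_ge0 (co y 2 - co x 2); have := sqr_ge0 (co y 3 - co x 3); lra.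
- have -> : p.1.1.2 = co y (if 1%N == j then 3 else 1)%N.
    by rewrite /y pt_slot_coord//; case: j j4 {By y} => [|[|[|[|//]]]] _ /=; rewrite ?pt_coord.
  by case: ifP => _; have := sqr_ge0 (co y 0 - co x 0); have := sqr_ge0 (co y 1 - co x 1);
    have := sqr_ge0 (co y 2 - co x 2); have := sqr_ge0 (co y 3 - co x 3); lra.
- have -> : p.1.2 = co y (if 2%N == j then 3 else 2)%N.
    by rewrite /y pt_slot_coord//; case: j j4 {By y} => [|[|[|[|//]]]] _ /=; rewrite ?pt_coord.
  by case: ifP => _; have := sqr_ge0 (co y 0 - co x 0); have := sqr_ge0 (co y 1 - co x 1);
    have := sqr_ge0 (co y 2 - co x 2); have := sqr_ge0 (co y 3 - co x 3); lra.
Qed.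

Lemma integral_inv_rho_le x B : x != 0 -> 0 < B -> exists K : R, forall d, 0 < d -> d <= 1 ->
  (\int[@leb4 R]_p (\1_(@box R B) (pt p) * (rho x (pt p) + d)^-1)%:E <= K%:E)%E.
Proof.
move=> /om_coef_neq0[j j4 a0] B0; exists (3 * slot_const x j B) => d d0 d1.
have mF : measurable_fun setT
    (fun p : R4 => (\1_(@box R B) (pt p) * (rho x (pt p) + d)^-1)%:E).
  apply/measurable_EFinP; apply: measurable_funM; first exact: measurable_indic_box.
  exact: measurable_inv_rho.
have F0 (p : R4) : (0 <= (\1_(@box R B) (pt p) * (rho x (pt p) + d)^-1)%:E)%E.
  by rewrite lee_fin mulr_ge0 ?indicE// invr_ge0 addr_ge0 ?rho_ge0 ?ltW.
rewrite (ge0_integral_slot j mF F0).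
have mM := measurable_slot_maj x j B d0.
apply: (@le_trans _ _ (\int[@leb4 R]_p (3 * slot_maj x j d B p)%:E)%E).
  apply: ge0_le_integral => //.
  - exact: (measurableT_comp mF (@measurable_slot R j)).
  - by apply/measurable_EFinP; apply: measurable_funM.
  - by move=> p _; rewrite lee_fin; exact: slot_dominates.
under eq_integral do rewrite EFinM.
rewrite ge0_integralZl_EFin//; last 2 first.
- by move=> p _; rewrite lee_fin slot_maj_ge0.
- exact/measurable_EFinP.
by rewrite EFinM lee_pmul2l//; exact: integral_slot_maj.
Qed.

Lemma integrable_inv_rho x B : x != 0 -> 0 < B ->
  integrable4 (fun y => \1_(@box R B) y * (rho x y)^-1).
Proof.
move=> x0 B0; have [K KP] := integral_inv_rho_le x0 B0.
pose e n : R := n.+1%:R^-1.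
have e0 n : 0 < e n by rewrite invr_gt0 ltr0n.
have e1 n : e n <= 1 by rewrite invf_le1 ?ltr0n// ler1n.
have re n y : 0 < rho x y + e n by rewrite ltr_wpDl ?rho_ge0.
(* [rho / (rho + e)^2] instead of [1 / (rho + e)]: at the pole it is 0, the value of [0^-1], so
   convergence holds at every point and Fatou's lemma applies. *)
pose f n (p : R4) : \bar R :=
  (\1_(@box R B) (pt p) * (rho x (pt p) / (rho x (pt p) + e n) ^+ 2))%:E.
have mf n : measurable_fun setT (f n).
  apply/measurable_EFinP; apply: measurable_funM; first exact: measurable_indic_box.
  apply: measurable_funM; first exact: measurable_rho.
  under eq_fun do rewrite expr2 invfM.
  by apply: measurable_funM; exact: measurable_inv_rho.
have f0 n p : (0 <= f n p)%E.
  by rewrite lee_fin mulr_ge0 ?indicE// divr_ge0 ?rho_ge0// sqr_ge0.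
have cvge : e n @[n --> \oo] --> (0 : R) by exact: cvg_harmonic.
have cf p : f n p @[n --> \oo] --> (\1_(@box R B) (pt p) * (rho x (pt p))^-1)%:E.
  apply: cvg_EFin; first exact: nearW.
  apply: cvgM; first exact: cvg_cst.
  have [r0|r0] := eqVneq (rho x (pt p)) 0.
    by rewrite r0 invr0; under eq_fun do rewrite mul0r; exact: cvg_cst.
  have -> : (rho x (pt p))^-1 = rho x (pt p) / (rho x (pt p) + 0) ^+ 2.
    by rewrite addr0 expr2 invfM mulrA mulfV// mul1r.
  apply: cvgM; first exact: cvg_cst.
  have r2 : (rho x (pt p) + 0) ^+ 2 != 0 by rewrite addr0 sqrf_eq0.
  apply: cvgV; first exact: r2.
  under eq_fun do rewrite expr2; rewrite expr2.
  by apply: cvgM; apply: cvgD => //; exact: cvg_cst.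
have lf p : limn_einf (f ^~ p) = (\1_(@box R B) (pt p) * (rho x (pt p))^-1)%:E.
  exact: (cvg_limn_einf_sup (cf p)).1.
have mg : measurable_fun setT (fun p : R4 => (\1_(@box R B) (pt p) * (rho x (pt p))^-1)%:E).
  exact: (emeasurable_fun_cvg f _ mf (fun p _ => cf p)).
apply/integrableP; split=> //.
apply: (@le_lt_trans _ _ K%:E); last exact: ltry.
have -> : (\int[@leb4 R]_p `|(\1_(@box R B) (pt p) * (rho x (pt p))^-1)%:E|
    = \int[@leb4 R]_p limn_einf (f ^~ p))%E.
  apply: eq_integral => p _; rewrite lf gee0_abs// lee_fin mulr_ge0 ?indicE// invr_ge0.
  exact: rho_ge0.
apply: (le_trans (fatou _ measurableT mf (fun n p _ => f0 n p))).
rewrite limn_einf_lim; apply: lime_le; first exact: is_cvg_einfs.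
apply: nearW => n; apply: (@le_trans _ _ (\int[@leb4 R]_p f n p)%E).
  by apply: ereal_inf_lbound; exists n => //=.
apply: le_trans (KP (e n) (e0 n) (e1 n)).
apply: ge0_le_integral => //.
- apply/measurable_EFinP; apply: measurable_funM; first exact: measurable_indic_box.
  exact: measurable_inv_rho.
- move=> p _; rewrite lee_fin ler_wpM2l ?indicE// expr2 invfM mulrA ler_piMl//.
    by rewrite invr_ge0 ltW.
  by rewrite ler_pdivrMr// mul1r lerDl ltW.
Qed.

End Domination.

(** * Dominated convergence as the regularization is removed *)

Section Limits.
Variable R : realType.
Local Notation MR := (measurableTypeR R).
Local Notation R4 := (MR * MR * MR * MR)%type.
Implicit Types (x y : 'rV[R]_4) (d B C : R) (u : 'rV[R]_4 -> R).
Local Notation H x y := (ev (hsqE x) y).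
Local Notation w x y := (ev (omE x) y).
Local Notation b x i y := (ev (bE x i) y).
Local Notation c x i y := (ev (cE x i) y).
Local Notation rho x y := (ev (rhoE x) y).

(** The first term dominates integrands singular at [x], the second the bounded ones, also at [x]
    itself, where [rho^-1] is 0. *)
Definition major x B y : R := \1_(@box R B) y * (rho x y)^-1 + \1_(@box R B) y.

Lemma integrable_indic_box B : integrable4 (fun y => \1_(@box R B) y : R).
Proof.
apply: (@integrable_box _ _ B 1); first exact: measurable_indic_box.
- by move=> y By; rewrite indicE mem_set// normr1.
- by move=> y nBy; rewrite indicE memNset.
Qed.

Lemma integrable_major x B C : x != 0 -> 0 < B -> integrable4 (fun y => C * major x B y).
Proof.
move=> x0 B0; have i1 := integrable_inv_rho x0 B0; have i2 := integrable_indic_box B.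
rewrite /integrable4.
have -> : (fun p : R4 => (C * major x B (pt p))%:E) =
   (fun p : R4 => C%:E * ((\1_(@box R B) (pt p) * (rho x (pt p))^-1)%:E
     + (\1_(@box R B) (pt p))%:E))%E.
  by apply/funext => p; rewrite -EFinD -EFinM.
by apply: integrableZl => //; exact: integrableD.
Qed.

Lemma dominated_limit x B C (f_ : nat -> 'rV[R]_4 -> R) f : x != 0 -> 0 < B ->
  (forall n, measurable_fun setT (f_ n \o @pt R)) ->
  (forall y, f_ n y @[n --> \oo] --> f y) ->
  (forall n y, `|f_ n y| <= C * major x B y) ->
  [/\ forall n, integrable4 (f_ n), integrable4 f
    & integral4 [set: 'rV[R]_4] (f_ n) @[n --> \oo] --> integral4 [set: 'rV[R]_4] f].
Proof.
move=> x0 B0 mf cf fM.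
have iM := integrable_major C x0 B0.
pose F n (p : R4) : \bar R := (f_ n (pt p))%:E.
have mF n : measurable_fun setT (F n) by apply/measurable_EFinP; exact: mf.
have iF n : integrable4 (f_ n).
  apply: (le_integrable measurableT (mF n) _ iM) => p _ /=.
  rewrite lee_fin (le_trans (fM n (pt p)))// ger0_norm//.
  exact: le_trans (normr_ge0 _) (fM n (pt p)).
have cF (p : R4) : [set: R4] p -> F n p @[n --> \oo] --> (f (pt p))%:E.
  by move=> _; apply: cvg_EFin; [exact: nearW|exact: cf].
have mf' : measurable_fun setT (fun p : R4 => (f (pt p))%:E).
  exact: (emeasurable_fun_cvg F _ mF cF).
have FM : {ae @leb4 R, forall p, forall n, [set: R4] p -> (`|F n p| <= (C * major x B (pt p))%:E)%E}.
  by apply: aeW => p n _; rewrite lee_fin.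
have [ifl _ lim] := dominated_convergence measurableT mF mf' (aeW _ cF) iM FM.
split=> //.
rewrite /integral4 /Rintegral.
have fin : (\int[@leb4 R]_p (f (pt p))%:E)%E \is a fin_num by exact: integrable_fin_num.
by apply: fine_cvg; rewrite fineK.
Qed.

Definition Tu i u y : R := \sum_(k < 4) ev (tc i k) y * par k u y.

Lemma Tu_continuous B u i : C1c B u -> continuous (Tu i u).
Proof.
move=> [B0 du pu u0].
pose g k z := ev (tc i k) z * par k u z.
have cg k : (k < 4)%N -> continuous (g k).
  move=> k4 y; apply: (@continuousM _ _ (ev (tc i k)) (par k u)); last exact: pu.
  exact/ev_continuous/ok_tc.
have -> : Tu i u = fun z => g 0%N z + g 1%N z + g 2%N z + g 3%N z.
  by apply/funext => z; rewrite /Tu big_ord4 !inordK.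
move=> y; apply: (@continuousD _ _ _ (fun z => g 0%N z + g 1%N z + g 2%N z) (g 3%N)); last exact: cg.
apply: (@continuousD _ _ _ (fun z => g 0%N z + g 1%N z) (g 2%N)); last exact: cg.
by apply: (@continuousD _ _ _ (g 0%N) (g 1%N)); exact: cg.
Qed.

Lemma Tu_supp B u i y : C1c B u -> ~ box B y -> Tu i u y = 0.
Proof.
by move=> uC By; rewrite /Tu big1// => k _; rewrite (C1c_par k uC By) mulr0.
Qed.

Lemma Tu_bounded B u : C1c B u ->
  exists2 M, 0 <= M & forall i y, (i < 3)%N -> `|Tu i u y| <= M.
Proof.
move=> uC; have B0 : 0 <= B by case: uC.
have H i := compact_support_bounded B0 (@Tu_continuous B u i uC) (fun y => @Tu_supp B u i y uC).
have [M0 M00 h0] := H 0%N; have [M1 M10 h1] := H 1%N; have [M2 M20 h2] := H 2%N.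
exists (M0 + M1 + M2); first by rewrite !addr_ge0.
case=> [|[|[|//]]] y _.
- by have := h0 y; lra.
- by have := h1 y; lra.
- by have := h2 y; lra.
Qed.

Lemma C1c_le B B' u : B <= B' -> C1c B u -> C1c B' u.
Proof.
move=> BB [B0 du pu u0]; split=> //; first exact: le_trans BB.
by move=> y nB; apply: u0 => By; apply: nB => k k4; exact: le_trans (By k k4) BB.
Qed.

Lemma indic_mul_le B (f M : R) y : 0 <= M -> (~ box B y -> f = 0) -> `|f| <= M ->
  `|f| <= M * \1_(@box R B) y.
Proof.
move=> M0 f0 fM; rewrite indicE; have [By|nB] := pselect (box B y).
  by rewrite mem_set// mulr1.
by rewrite f0// normr0 mulr_ge0.
Qed.

Definition eps (n : nat) : R := n.+1%:R^-1.

Lemma eps_gt0 n : 0 < eps n. Proof. by rewrite invr_gt0 ltr0n. Qed.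

Lemma cvg_eps : eps n @[n --> \oo] --> (0 : R).
Proof. exact: cvg_harmonic. Qed.

Lemma cvg_irt (t : R) : 0 < t -> irt (t + eps n) @[n --> \oo] --> irt t.
Proof.
move=> t0; have [dt _] := diff_irt 0 t0.
have ct : {for t, continuous (@irt R)} by exact: differentiable_continuous.
suff h : t + eps n @[n --> \oo] --> t by exact: (continuous_cvg _ ct h).
by rewrite -[X in _ --> X]addr0; apply: cvgD; [exact: cvg_cst|exact: cvg_eps].
Qed.

(** [aA] collects what multiplies [phi] in the field and [aB] what multiplies [- d phi / d rho];
    neither depends on [e], so limits in [e] concern powers of [irt] only. *)
Definition aA x i y : R :=
  nth 0 [:: b x 0 y; b x 1 y - c x 2 y; b x 2 y + c x 1 y] i.
Definition aB x i y : R := w x y *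
  nth 0 [:: 0; - ev (ld (tc 2) (rhoE x)) y; ev (ld (tc 1) (rhoE x)) y] i.

Lemma ev_aE x e s i y : (i < 3)%N -> ev (aE x e s i) y =
  irt (rho x y + e) ^+ 5 * (irt (rho x y + s) ^+ 4 * aA x i y)
  + (5 / 4 * irt (rho x y + e) ^+ 9 * irt (rho x y + s) ^+ 4
     + irt (rho x y + e) ^+ 5 * irt (rho x y + s) ^+ 8) * aB x i y.
Proof.
by case: i => [|[|[|//]]] _; rewrite /aE /phiE /irE /= ?ld_om// /aA /aB /=; field.
Qed.

Lemma pole x : [/\ rho x x = 0, w x x = 0, H x x = 0 & forall i, (i < 3)%N ->
  b x i x = 0 /\ aA x i x = 0].
Proof.
have H0 : H x x = 0 by rewrite ev_hsqE; ring.
have w0 : w x x = 0 by rewrite ev_omE; ring.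
have n0 : enorm (x - x) = 0 by apply/eqP; rewrite -sqrf_eq0 enorm_sub_sqr H0.
have b0 i : (i < 3)%N -> b x i x = 0.
  by move=> i3; apply/eqP; rewrite -normr_le0; have := b_le x x i3; rewrite n0 mulr0.
have c0 i : (i < 3)%N -> c x i x = 0.
  by move=> i3; apply/eqP; rewrite -normr_le0; have := c_le x x i3; rewrite n0 mulr0.
split=> //; first by rewrite rho_eq H0 w0; ring.
move=> i i3; split; first exact: b0.
by case: i i3 => [|[|[|//]]] _; rewrite /aA /= ?b0// ?c0// ?subr0 ?addr0.
Qed.

(** At the pole [irt e] blows up as [e] tends to 0, but it multiplies coefficients that vanish
    there; hence pointwise convergence has no exceptional point. *)
Lemma a_pole x e s i : (i < 3)%N -> ev (aE x e s i) x = 0.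
Proof.
move=> i3; have [r0 w0 _ h] := pole x.
by rewrite ev_aE// (h i i3).2 /aB w0 !mul0r !mulr0 addr0.
Qed.

Lemma div_rest_pole x e s : div_rest x e s x = 0.
Proof.
have [r0 w0 H0 h] := pole x; rewrite /div_rest r0 w0 H0 (h 0%N isT).1; ring.
Qed.

Lemma cvg_pow (a : nat -> R) (l : R) k : a n @[n --> \oo] --> l -> a n ^+ k @[n --> \oo] --> l ^+ k.
Proof.
move=> al; exact: (continuous_cvg _ (@exprn_continuous R k l) al).
Qed.

Lemma cvg_aE x i y : (i < 3)%N ->
  ev (aE x (eps n) (sx x) i) y @[n --> \oo] --> ev (aE x 0 (sx x) i) y.
Proof.
move=> i3; have [->|yx] := eqVneq y x.
  by rewrite a_pole//; under eq_fun do rewrite a_pole//; exact: cvg_cst.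
rewrite ev_aE//; under eq_fun do rewrite ev_aE//.
rewrite addr0; have cE := cvg_irt (_ : 0 < rho x y); rewrite rho_gt0 in cE.
have {}cE := cE yx.
apply: cvgD; first by apply: cvgM; [exact: cvg_pow|exact: cvg_cst].
apply: cvgM; last exact: cvg_cst.
apply: cvgD; last by apply: cvgM; [exact: cvg_pow|exact: cvg_cst].
apply: cvgM; last exact: cvg_cst.
by apply: cvgM; [exact: cvg_cst|exact: cvg_pow].
Qed.

Lemma cvg_div_rest x y :
  div_rest x (eps n) (sx x) y @[n --> \oo] --> div_rest x 0 (sx x) y.
Proof.
have [->|yx] := eqVneq y x.
  by rewrite div_rest_pole; under eq_fun do rewrite div_rest_pole; exact: cvg_cst.
have cE : irt (rho x y + eps n) @[n --> \oo] --> irt (rho x y + 0).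
  by rewrite addr0; apply: cvg_irt; rewrite rho_gt0.
rewrite /div_rest; apply: cvgB; first apply: cvgB.
- apply: cvgM; last exact: cvg_cst.
  by apply: cvgM; [exact: cvg_pow|exact: cvg_cst].
- apply: cvgM; last exact: cvg_cst.
  by apply: cvgM; [exact: cvg_cst|exact: cvg_pow].
- apply: cvgM; last exact: cvg_cst.
  apply: cvgD; last by apply: cvgM; [exact: cvg_pow|exact: cvg_cst].
  apply: cvgM; last exact: cvg_cst.
  by apply: cvgM; [exact: cvg_cst|exact: cvg_pow].
Qed.

End Limits.

(** * Integration by parts for Psi *)

Section GreenFormula.
Variable R : realType.
Local Notation MR := (measurableTypeR R).
Local Notation R4 := (MR * MR * MR * MR)%type.
Implicit Types (x y : 'rV[R]_4) (d B C : R) (u : 'rV[R]_4 -> R).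
Local Notation w x y := (ev (omE x) y).
Local Notation r2 y := (ev (@rsqE R) y).
Local Notation xh x y := (ev (xhE x) y).
Local Notation rho x y := (ev (rhoE x) y).
Local Notation I4 F := (integral4 [set: 'rV[R]_4] F).

Lemma integral4D (f g : 'rV[R]_4 -> R) : integrable4 f -> integrable4 g ->
  integrable4 (fun y => f y + g y) /\ I4 (fun y => f y + g y) = I4 f + I4 g.
Proof.
move=> fi gi; split; last exact: (RintegralD measurableT fi gi).
rewrite /integrable4.
have -> : (fun p : R4 => (f (pt p) + g (pt p))%:E) =
  (fun p : R4 => (f (pt p))%:E + (g (pt p))%:E)%E by apply/funext.
exact: integrableD.
Qed.

Lemma integral4Z (k : R) (f : 'rV[R]_4 -> R) : integrable4 f ->
  integrable4 (fun y => k * f y) /\ I4 (fun y => k * f y) = k * I4 f.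
Proof.
move=> fi; split; last exact: (RintegralZl k measurableT fi).
rewrite /integrable4.
have -> : (fun p : R4 => (k * f (pt p))%:E) =
  (fun p : R4 => k%:E * (f (pt p))%:E)%E by apply/funext.
exact: integrableZl.
Qed.

Lemma comb_Tu g0 g1 g2 u y : \sum_(k < 4) ev (comb g0 g1 g2 k) y * par k u y =
  ev g0 y * Tu 0 u y + ev g1 y * Tu 1 u y + ev g2 y * Tu 2 u y.
Proof.
rewrite /Tu !mulr_sumr -!big_split; apply: eq_bigr => k _.
by rewrite /comb /=; ring.
Qed.

Lemma ld_psi_le x i y : (i < 3)%N -> x != 0 ->
  `|ev (ld (tc i) (psiE x (sx x))) y| <= 9 * (enorm y * irt (rho x y + sx x) ^+ 4).
Proof.
move=> i3 x0; have rs := rho_sx_gt0 y x0.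
have [|Sn Sw] := @irt_rho_le R x y (sx x) _ rs; first by rewrite exprn_ge0 ?enorm_ge0.
rewrite ev_ld_psi; set S := irt _ in Sn Sw *.
have S0 : 0 <= S by exact: irt_ge0.
have r0 := enorm_ge0 y; have n0 := enorm_ge0 (y - x).
set r := enorm y in r0 *.
have Sn1 : 0 <= S * enorm (y - x) <= 1 by rewrite mulr_ge0.
have Sw1 : 0 <= S ^+ 2 * `|w x y| <= 1 by rewrite mulr_ge0 ?exprn_ge0.
have B0 : 0 <= r * S ^+ 4 by rewrite mulr_ge0 ?exprn_ge0.
have := ld_rho_le x y i3; rewrite -/r => t_le.
have S7 : 0 <= 3 / 4 * S ^+ 7 by rewrite mulr_ge0 ?exprn_ge0//; lra.
rewrite normrM mulNr normrN (ger0_norm S7).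
apply: (le_trans (ler_wpM2l S7 t_le)).
have k1 : (S * enorm (y - x)) ^+ 3 * (r * S ^+ 4) <= r * S ^+ 4 by apply: mul_le1; [in01|].
have k2 : (S ^+ 2 * `|w x y|) * (S * enorm (y - x)) * (r * S ^+ 4) <= r * S ^+ 4.
  by apply: mul_le1; [in01|].
have -> : 3 / 4 * S ^+ 7 * (4 * enorm (y - x) ^+ 2 * (r * enorm (y - x))
    + 8 * `|w x y| * (r * enorm (y - x))) =
  3 * ((S * enorm (y - x)) ^+ 3 * (r * S ^+ 4))
  + 6 * ((S ^+ 2 * `|w x y|) * (S * enorm (y - x)) * (r * S ^+ 4)) by field.
lra.
Qed.

(** The factor [|y|] offsets the weight [1/|y|] at the characteristic point. The constant 300 rounds
    up 42 + 6 + 6 + 189. *)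
Lemma lap_psi_le x y : x != 0 ->
  `|lap_psi x (sx x) y| <= 300 * (enorm y * irt (rho x y + sx x) ^+ 4).
Proof.
move=> x0; have rs := rho_sx_gt0 y x0.
have [|Sn Sw] := @irt_rho_le R x y (sx x) _ rs; first by rewrite exprn_ge0 ?enorm_ge0.
have [Sm Sr] := irt_sx_le y x0.
have [wm xm] := om_xh_le x y; have wr := om_le x y.
have bn := @b_le R x 0 y isT; rewrite b0_eq in bn.
rewrite /lap_psi /sx -enorm_sqr -enorm_sub_sqr; rewrite -enorm_sub_sqr in bn.
rewrite -/(sx x); set S := irt _ in Sn Sw Sm Sr *.
set r := enorm y in wr bn Sr *; set n := enorm (y - x) in Sn wm xm wr bn *.
set m := enorm x in Sm wm xm *; set v := w x y in Sw wr wm *; set z := xh x y in xm bn *.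
have S0 : 0 <= S by exact: irt_ge0.
have r0 : 0 <= r by exact: enorm_ge0.
have n0 : 0 <= n by exact: enorm_ge0.
have m0 : 0 <= m by exact: enorm_ge0.
have v0 := normr_ge0 v.
have Sn1 : 0 <= S * n <= 1 by rewrite mulr_ge0.
have Sm1 : 0 <= S * m <= 1 by rewrite mulr_ge0.
have Sw1 : 0 <= S ^+ 2 * `|v| <= 1 by rewrite mulr_ge0 ?exprn_ge0.
have Sr1 : 0 <= S * r / 2 <= 1 by rewrite mulr_ge0 ?mulr_ge0// ler_pdivrMr// mul1r.
have B0 : 0 <= r * S ^+ 4 by rewrite mulr_ge0 ?exprn_ge0.
set Bd := r * S ^+ 4 in B0 *.
have k1 : r ^+ 2 * n ^+ 2 * m ^+ 4 * S ^+ 11 <= 2 * Bd.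
  have -> : r ^+ 2 * n ^+ 2 * m ^+ 4 * S ^+ 11 =
    ((S * r / 2) * (S * n) ^+ 2 * (S * m) ^+ 4) * (2 * Bd) by rewrite /Bd; field.
  by apply: mul_le1; [in01|rewrite mulr_ge0].
have k1' : 0 <= r ^+ 2 * n ^+ 2 * m ^+ 4 * S ^+ 11 by rewrite !mulr_ge0 ?exprn_ge0.
(* [z + n^2 = xh + H] is the product [<h, T_1 y>]; this supplies the factor [r]. *)
have k2 : `|S ^+ 7 * (z * (z + n ^+ 2))| <= Bd.
  rewrite normrM ger0_norm ?exprn_ge0// normrM.
  apply: (@le_trans _ _ (S ^+ 7 * ((m * n) * (r * n)))).
    by rewrite ler_wpM2l ?exprn_ge0//; apply: ler_pM.
  have -> : S ^+ 7 * ((m * n) * (r * n)) = ((S * m) * (S * n) ^+ 2) * Bd by rewrite /Bd; ring.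
  by apply: mul_le1; [in01|].
have k3 : S ^+ 7 * v ^+ 2 <= Bd.
  rewrite -(sqr_normr v).
  apply: (@le_trans _ _ (S ^+ 7 * (`|v| * (r * n)))).
    by rewrite ler_wpM2l ?exprn_ge0// expr2 ler_wpM2l.
  have -> : S ^+ 7 * (`|v| * (r * n)) = ((S ^+ 2 * `|v|) * (S * n)) * Bd by rewrite /Bd; ring.
  by apply: mul_le1; [in01|].
have k3' : 0 <= S ^+ 7 * v ^+ 2 by rewrite mulr_ge0 ?sqr_ge0// exprn_ge0.
have k4 : S ^+ 11 * v ^+ 2 * (n ^+ 2 + 2 * z) ^+ 2 <= 9 * Bd.
  have q : (n ^+ 2 + 2 * z) ^+ 2 <= (n ^+ 2 + 2 * (m * n)) ^+ 2.
    rewrite -(sqr_normr (n ^+ 2 + 2 * z)) lerXn2r ?nnegrE//.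
      by rewrite addr_ge0 ?sqr_ge0// mulr_ge0// mulr_ge0.
    apply: (le_trans (ler_normD _ _)); rewrite ger0_norm ?sqr_ge0// lerD2l normrM ger0_norm//.
    by rewrite ler_pM2l.
  rewrite -(sqr_normr v).
  apply: (@le_trans _ _ (S ^+ 11 * (`|v| * (r * n)) * (n ^+ 2 + 2 * (m * n)) ^+ 2)).
    apply: ler_pM => //; [by rewrite mulr_ge0 ?exprn_ge0|exact: sqr_ge0|].
    by rewrite ler_wpM2l ?exprn_ge0// expr2 ler_wpM2l.
  have e1 : (S * n) ^+ 4 * ((S ^+ 2 * `|v|) * (S * n)) * Bd <= Bd by apply: mul_le1; [in01|].
  have e2 : (S * n) ^+ 3 * (S * m) * ((S ^+ 2 * `|v|) * (S * n)) * Bd <= Bd.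
    by apply: mul_le1; [in01|].
  have e3 : (S * n) ^+ 2 * (S * m) ^+ 2 * ((S ^+ 2 * `|v|) * (S * n)) * Bd <= Bd.
    by apply: mul_le1; [in01|].
  have -> : S ^+ 11 * (`|v| * (r * n)) * (n ^+ 2 + 2 * (m * n)) ^+ 2 =
    (S * n) ^+ 4 * ((S ^+ 2 * `|v|) * (S * n)) * Bd
    + 4 * ((S * n) ^+ 3 * (S * m) * ((S ^+ 2 * `|v|) * (S * n)) * Bd)
    + 4 * ((S * n) ^+ 2 * (S * m) ^+ 2 * ((S ^+ 2 * `|v|) * (S * n)) * Bd).
    by rewrite /Bd; ring.
  lra.
have k4' : 0 <= S ^+ 11 * v ^+ 2 * (n ^+ 2 + 2 * z) ^+ 2.
  by rewrite mulr_ge0 ?sqr_ge0// mulr_ge0 ?sqr_ge0// exprn_ge0.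
have -> : - 21 * r ^+ 2 * n ^+ 2 * sx x * S ^+ 11
    + 6 * S ^+ 7 * (n ^+ 2 * z + z ^+ 2 - v ^+ 2)
    - 21 * S ^+ 11 * v ^+ 2 * (n ^+ 2 + 2 * z) ^+ 2 =
  - 21 * (r ^+ 2 * n ^+ 2 * m ^+ 4 * S ^+ 11) + 6 * (S ^+ 7 * (z * (z + n ^+ 2)))
    - 6 * (S ^+ 7 * v ^+ 2) - 21 * (S ^+ 11 * v ^+ 2 * (n ^+ 2 + 2 * z) ^+ 2).
  by rewrite /sx -/m; ring.
by move: k2; rewrite !ler_norml => /andP[? ?]; apply/andP; split; lra.
Qed.

Lemma irt_sx4_le x y : x != 0 -> irt (rho x y + sx x) ^+ 4 <= (sx x)^-1.
Proof.
move=> x0; have rs := rho_sx_gt0 y x0; have s0 : 0 < sx x by rewrite exprn_gt0 ?enorm_gt0.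
have := irt4 rs; move/(canRL (mulfK (lt0r_neq0 rs))) => ->.
by rewrite mul1r lef_pV2// lerDr rho_ge0.
Qed.

Lemma w_bounds d y : 0 < d ->
  [/\ 0 <= ev (wE d) y, ev (wE d) y * enorm y <= 1
    & 0 <= 1 - r2 y * ev (wE d) y ^+ 2 <= 1].
Proof.
move=> d0; have rd : 0 < r2 y + d by rewrite ltr_wpDl ?rsq_ge0.
have W0 : 0 <= ev (wE d) y by rewrite /wE /= mulr_ge0 ?irt_ge0.
have W1 : ev (wE d) y * enorm y <= 1.
  rewrite -[enorm y]ger0_norm ?enorm_ge0// /wE /= -expr2.
  by apply: irt_sq_le => //; rewrite enorm_sqr; lra.
split=> //.
have h : 0 <= r2 y * ev (wE d) y ^+ 2 <= 1.
  rewrite -enorm_sqr -exprMn; apply: in01X.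
  by rewrite mulrC W1 andbT mulr_ge0 ?enorm_ge0.
by move: h => /andP[? ?]; apply/andP; split; lra.
Qed.

Lemma cvg_w y : y != 0 -> ev (wE (eps R n)) y @[n --> \oo] --> (enorm y)^-1.
Proof.
move=> y0; rewrite enorm_inv /wE /=.
have r0 : 0 < r2 y by rewrite rsq_gt0.
by apply: cvgM; rewrite addr0; exact: cvg_irt.
Qed.

Lemma continuous_measurable_pt (f : 'rV[R]_4 -> R) : continuous f ->
  measurable_fun setT (f \o @pt R).
Proof. exact: measurable_continuous. Qed.

(** The divergence formula is applied with the smooth weight [wE]. The integrands stay bounded as
    the weight tends to [1/|y|], because [T_i psi] and [lap_psi] are bounded by multiples of
    [|y|]. *)
Lemma green_psi x u B : x != 0 -> 0 < B -> C1c B u ->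
  let t i y := (enorm y)^-1 * ev (ld (tc i) (psiE x (sx x))) y * Tu i u y in
  let t3 y := (enorm y)^-1 * lap_psi x (sx x) y * u y in
  [/\ forall i, (i < 3)%N -> integrable4 (t i), integrable4 t3
    & I4 (t 0%N) + I4 (t 1%N) + I4 (t 2%N) + I4 t3 = 0].
Proof.
move=> x0 Bp uC t t3; have [B0 du pu u0] := uC.
have s0 : 0 < sx x by rewrite exprn_gt0 ?enorm_gt0.
have rs y := rho_sx_gt0 y x0.
have cu : continuous u by move=> y; exact: differentiable_continuous.
have [M M0 uM] := C1c_bounded uC.
have [M' M'0 TM] := Tu_bounded uC.
pose W n y := ev (wE (eps R n)) y.
pose lp i y := ev (ld (tc i) (psiE x (sx x))) y.
pose f i n y := W n y * lp i y * Tu i u y.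
pose f3 n y := W n y * (lap_psi x (sx x) y
  + (1 - r2 y * W n y ^+ 2) * lp 0%N y) * u y.
have okp y : ok (psiE x (sx x)) y by exact: ok_psi.
have okw n y : ok (wE (eps R n)) y.
  by apply: ok_w; rewrite ltr_wpDl ?rsq_ge0 ?eps_gt0.
have cW n : continuous (W n) by move=> y; exact: ev_continuous.
have clp i : continuous (lp i) by move=> y; apply: ev_continuous; exact: ok_ldt.
have S4 y := irt_sx4_le y x0.
have S40 y : 0 <= irt (rho x y + sx x) ^+ 4 by rewrite exprn_ge0 ?irt_ge0.
have Wr n y q : 0 <= q -> W n y * (q * (enorm y * irt (rho x y + sx x) ^+ 4)) <= q * (sx x)^-1.
  move=> q0; have [W0 W1 _] := w_bounds y (eps_gt0 R n).
  rewrite [leLHS](_ : _ = (W n y * enorm y) * (q * irt (rho x y + sx x) ^+ 4)); last by ring.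
  apply: (@le_trans _ _ (q * irt (rho x y + sx x) ^+ 4)).
    by apply: mul_le1; [rewrite W1 andbT mulr_ge0 ?enorm_ge0|rewrite mulr_ge0].
  by rewrite ler_wpM2l.
have box_major (C : R) y : 0 <= C -> C * \1_(@box R B) y <= C * major x B y.
  by move=> C0; rewrite ler_wpM2l// /major lerDr mulr_ge0 ?invr_ge0 ?rho_ge0// indicE.
(* [W n 0] diverges, so pointwise convergence at the origin rests on the vanishing of its
   cofactors. *)
have lp0 i : (i < 3)%N -> lp i 0 = 0.
  move=> i3; apply/eqP; rewrite -normr_le0; apply: (le_trans (ld_psi_le 0 i3 x0)).
  have -> : enorm (0 : 'rV[R]_4) = 0 by apply/eqP; rewrite -sqrf_eq0 enorm_sqr ev_rsqE !mxE; apply/eqP; ring.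
  by rewrite mul0r mulr0.
have lap0 : lap_psi x (sx x) 0 = 0.
  apply/eqP; rewrite -normr_le0; apply: (le_trans (lap_psi_le 0 x0)).
  have -> : enorm (0 : 'rV[R]_4) = 0 by apply/eqP; rewrite -sqrf_eq0 enorm_sqr ev_rsqE !mxE; apply/eqP; ring.
  by rewrite mul0r mulr0.
have Di i : (i < 3)%N -> [/\ forall n, integrable4 (f i n), integrable4 (t i)
    & I4 (f i n) @[n --> \oo] --> I4 (t i)].
  move=> i3; apply: (@dominated_limit R x B (9 * (sx x)^-1 * M')) => //.
  - move=> n; apply: continuous_measurable_pt => y.
    apply: (@continuousM _ _ (fun y => W n y * lp i y) (Tu i u)).
      by apply: (@continuousM _ _ (W n) (lp i)); [exact: cW|exact: clp].
    exact: (@Tu_continuous R B u i uC y).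
  - move=> y; rewrite /f /t -/(lp i y); have [->|y0] := eqVneq y 0.
      by rewrite lp0// mulr0 mul0r; under eq_fun do rewrite mulr0 mul0r; exact: cvg_cst.
    apply: cvgM; last exact: cvg_cst.
    by apply: cvgM; [exact: cvg_w|exact: cvg_cst].
  - move=> n y; have C0 : 0 <= 9 * (sx x)^-1 * M' by rewrite mulr_ge0// mulr_ge0 ?invr_ge0 ?ltW.
    apply: le_trans (box_major _ y C0); apply: indic_mul_le => //.
      by move=> nB; rewrite /f (Tu_supp i uC nB) mulr0.
    rewrite /f normrM; apply: ler_pM => //; last exact: TM.
    have [W0 _ _] := w_bounds y (eps_gt0 R n).
    rewrite normrM (ger0_norm W0); apply: le_trans (Wr n y 9 _) => //.
    by rewrite ler_wpM2l// ld_psi_le.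
(* 300 accounts for [lap_psi], 9 for the error term [(1 - |y|^2 w_d^2) T_1 psi] of [div_g]. *)
have [K KE K0] : exists2 K : R, K = 300 + 9 & 0 <= K
  by exists (300 + 9); [|exact: addr_ge0 (ler0n _ _) (ler0n _ _)].
have D3 : [/\ forall n, integrable4 (f3 n), integrable4 t3
    & I4 (f3 n) @[n --> \oo] --> I4 t3].
  apply: (@dominated_limit R x B (K * (sx x)^-1 * M)) => //.
  - move=> n; apply: continuous_measurable_pt => y.
    have okg i z : ok (gE x (sx x) (eps R n) i) z by split; [exact: okw|exact: ok_ldt].
    pose e := (ld (tc 0) (gE x (sx x) (eps R n) 0) + ld (tc 1) (gE x (sx x) (eps R n) 1)
       + ld (tc 2) (gE x (sx x) (eps R n) 2) + EC 4 * gE x (sx x) (eps R n) 0)%E4.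
    have -> : f3 n = fun z => ev e z * u z.
      apply/funext => z; rewrite /f3; congr (_ * _).
      have rd : 0 < r2 z + eps R n by rewrite ltr_wpDl ?rsq_ge0 ?eps_gt0.
      by rewrite -(div_g (rs z) rd).
    apply: (@continuousM _ _ (ev e) u); last exact: cu.
    apply: ev_continuous.
    exact: (conj (conj (conj (ok_ldt 0 (okg 0%N y)) (ok_ldt 1 (okg 1%N y)))
      (ok_ldt 2 (okg 2%N y))) (conj I (okg 0%N y))).
  - move=> y; rewrite /f3 /t3; have [->|y0] := eqVneq y 0.
      rewrite lap0 mulr0 mul0r; under eq_fun do rewrite lp0// mulr0 addr0 mulr0 mul0r.
      exact: cvg_cst.
    apply: cvgM; last exact: cvg_cst.
    apply: cvgM; first exact: cvg_w.
    rewrite -[X in _ --> X]addr0; apply: cvgD; first exact: cvg_cst.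
    rewrite -[X in _ --> X](mul0r (lp 0%N y)); apply: cvgM; last exact: cvg_cst.
    have -> : 0 = 1 - r2 y * (enorm y)^-1 ^+ 2.
      rewrite exprVn enorm_sqr mulfV ?subrr//; apply: lt0r_neq0; by rewrite rsq_gt0.
    apply: cvgB; first exact: cvg_cst.
    by apply: cvgM; [exact: cvg_cst|apply: cvg_pow; exact: cvg_w].
  - move=> n y; have C0 : 0 <= K * (sx x)^-1 * M by rewrite mulr_ge0// mulr_ge0 ?invr_ge0 ?(ltW s0).
    apply: le_trans (box_major _ y C0); apply: indic_mul_le => //.
      by move=> nB; rewrite /f3 (u0 _ nB) mulr0.
    rewrite /f3 normrM; apply: ler_pM => //; last by have [] := uM y.
    have [W0 _ Q] := w_bounds y (eps_gt0 R n).
    rewrite normrM (ger0_norm W0); apply: le_trans (Wr n y K _) => //.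
    rewrite ler_wpM2l//; apply: (le_trans (ler_normD _ _)).
    have h1 := lap_psi_le y x0.
    have h2 : `|(1 - r2 y * W n y ^+ 2) * lp 0%N y| <= 9 * (enorm y * irt (rho x y + sx x) ^+ 4).
      move/andP: (Q) => [Q0 Q1]; rewrite normrM (ger0_norm Q0).
      by apply: (le_trans (mul_le1 Q (normr_ge0 _))); exact: ld_psi_le.
    rewrite [leRHS](_ : _ = 300 * (enorm y * irt (rho x y + sx x) ^+ 4)
      + 9 * (enorm y * irt (rho x y + sx x) ^+ 4)); last by rewrite KE; ring.
    exact: lerD.
have [f0i t0i l0] := Di 0%N isT; have [f1i t1i l1] := Di 1%N isT.
have [f2i t2i l2] := Di 2%N isT; have [f3i t3i l3] := D3.
split=> //; first by case=> [|[|[|]]].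
have Z n : I4 (f 0%N n) + I4 (f 1%N n) + I4 (f 2%N n) + I4 (f3 n) = 0.
  pose g i := gE x (sx x) (eps R n) i.
  have okg i z : ok (g i) z by split; [exact: okw|exact: ok_ldt].
  have := divergence_formula (F := comb (g 0%N) (g 1%N) (g 2%N)) uC.
  have okc k y : (k < 4)%N -> ok (comb (g 0%N) (g 1%N) (g 2%N) k) y.
    by move=> _; exact: ok_comb.
  move=> /(_ okc) DF.
  have [i01 e01] := integral4D (f0i n) (f1i n).
  have [i012 e012] := integral4D i01 (f2i n).
  have [_ <-] := (integral4D (f0i n) (f1i n)).
  have [_ <-] := (integral4D i01 (f2i n)).
  have [_ <-] := (integral4D i012 (f3i n)).
  rewrite -[RHS]DF; congr (integral4 _ _); apply/funext => y.
  rewrite comb_Tu div_comb// div_g//; last by rewrite ltr_wpDl ?rsq_ge0 ?eps_gt0.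
have l : (fun n => I4 (f 0%N n) + I4 (f 1%N n) + I4 (f 2%N n) + I4 (f3 n)) @ \oo
    --> I4 (t 0%N) + I4 (t 1%N) + I4 (t 2%N) + I4 t3.
  by apply: cvgD => //; apply: cvgD => //; exact: cvgD.
rewrite (funext Z) in l.
by have := cvg_lim (@Rhausdorff R) l; rewrite (lim_cst (@Rhausdorff R)) => <-.
Qed.

End GreenFormula.

(** * Concentration of the divergence at [x] *)

Section Flux.
Variable R : realType.
Local Notation MR := (measurableTypeR R).
Local Notation R4 := (MR * MR * MR * MR)%type.
Implicit Types (x y : 'rV[R]_4) (d B C : R) (u : 'rV[R]_4 -> R).
Local Notation co x k := ((x : 'rV[R]_4) ord0 (inord k)).
Local Notation r2 y := (ev (@rsqE R) y).
Local Notation rho x y := (ev (rhoE x) y).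
Local Notation I4 F := (integral4 [set: 'rV[R]_4] F).

Lemma coord_le_enorm y k : (k < 4)%N -> `|co y k| <= enorm y.
Proof.
move=> k4; rewrite -(@ler_pXn2r _ 2) ?nnegrE ?enorm_ge0// sqr_normr enorm_sqr ev_rsqE.
have := sqr_ge0 (co y 0); have := sqr_ge0 (co y 1); have := sqr_ge0 (co y 2).
have := sqr_ge0 (co y 3).
by case: k k4 => [|[|[|[|//]]]] _; lra.
Qed.

Lemma enorm_box B y : 0 <= B -> box B y -> enorm y <= 2 * B.
Proof.
move=> B0 By; rewrite -(@ler_pXn2r _ 2) ?nnegrE ?enorm_ge0 ?mulr_ge0// enorm_sqr ev_rsqE.
have sq k : (k < 4)%N -> co y k ^+ 2 <= B ^+ 2.
  by move=> k4; rewrite -(sqr_normr (co y k)) lerXn2r ?nnegrE// By.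
have := sq 0%N isT; have := sq 1%N isT; have := sq 2%N isT; have := sq 3%N isT.
by rewrite exprMn; lra.
Qed.

Lemma lipschitz B u : C1c B u ->
  exists2 L, 0 <= L & forall x y, `|u y - u x| <= L * enorm (y - x).
Proof.
move=> uC; have [B0 du pu u0] := uC; have [M M0 uM] := C1c_bounded uC.
exists (4 * M); first by rewrite mulr_ge0.
move=> x y; pose h := y - x; pose g (t : R) := u (x + t *: h).
have dg t : is_derive t (1 : R) g ('D_h u (x + t *: h)) by exact: is_derive_line.
have cg : {within `[0, 1], continuous g}.
  apply: continuous_subspaceT => t; apply: differentiable_continuous.
  by apply/derivable1_diffP; have [] := dg t.
have [t _ gt] := MVT ltr01 (fun t _ => dg t) cg.
have -> : u y - u x = 'D_h u (x + t *: h).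
  have g1 : g 1 = u y by rewrite /g /h scale1r addrC subrK.
  have g0 : g 0 = u x by rewrite /g scale0r addr0.
  by rewrite -g1 -g0 gt subr0 mulr1.
rewrite derive_par//; apply: (le_trans (ler_norm_sum _ _ _)).
rewrite (_ : 4 * M * enorm (y - x) = \sum_(k < 4) M * enorm h); last first.
  by rewrite sumr_const card_ord -mulrA mulr_natl.
apply: ler_sum => k _; rewrite normrM mulrC; apply: ler_pM => //.
- by have [_ ->] := uM (x + t *: h).
- by have := @coord_le_enorm h k (ltn_ord k); rewrite inord_val.
Qed.

Lemma ok_aE x e i y : x != 0 -> 0 < e -> ok (aE x e (sx x) i) y.
Proof.
move=> x0 e0; have re : 0 < rho x y + e by rewrite ltr_wpDl ?rho_ge0.
have rs := rho_sx_gt0 y x0.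
have oE : ok (irE x e) y by exact: ok_irE.
have oS : ok (irE x (sx x)) y by exact: ok_irE.
have oP : ok (phiE x e (sx x)) y.
  exact: (conj (conj (conj oE oE) (conj oE (conj oE oE))) (conj (conj oS oS) (conj oS oS))).
have oO : ok (omE x * phiE x e (sx x))%E4 y by exact: (conj (ok_om x y) oP).
have ob j : ok (phiE x e (sx x) * bE x j)%E4 y by exact: (conj oP (ok_b x j y)).
case: i => [|[|[|i]]].
- exact: ob.
- exact: (conj (ob 1%N) (ok_ldt 2 oO)).
- exact: (conj (ob 2%N) (conj I (ok_ldt 1 oO))).
- by rewrite /aE /= nth_nil.
Qed.

(** An unnormalized approximate identity at [x]: of order [eps * eps^(-9/4)] on a region whose
    volume is of order [eps^(5/4)]. *)
Definition lead x (n : nat) y : R :=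
  5 * r2 y * eps R n * irt (rho x y + eps R n) ^+ 9 * irt (rho x y + sx x) ^+ 4.

Definition leadE x (n : nat) : ex R :=
  let E := irE x (eps R n) in let S := irE x (sx x) in
  (EC 5 * rsqE * EC (eps R n) * ((E * E * E) * (E * E * E) * (E * E * E)) * (S * S * S * S))%E4.

Lemma lead_ev x n y : lead x n y = ev (leadE x n) y.
Proof. by rewrite /lead /leadE /irE /=; ring. Qed.

Lemma ok_leadE x n y : x != 0 -> ok (leadE x n) y.
Proof.
move=> x0; have re : 0 < rho x y + eps R n by rewrite ltr_wpDl ?rho_ge0 ?eps_gt0.
have oE : ok (irE x (eps R n)) y by exact: ok_irE.
have oS : ok (irE x (sx x)) y by apply: ok_irE; exact: rho_sx_gt0.
have oE3 := conj (conj oE oE) oE.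
exact: (conj (conj (conj (conj I (ok_rsq y)) I) (conj (conj oE3 oE3) oE3))
  (conj (conj (conj oS oS) oS) oS)).
Qed.

Lemma lead_continuous x n : x != 0 -> continuous (lead x n).
Proof.
move=> x0; have -> : lead x n = ev (leadE x n) by apply/funext => y; exact: lead_ev.
by move=> y; apply: ev_continuous; exact: ok_leadE.
Qed.

Definition divaE x (n : nat) : ex R :=
  (ld (tc 0) (aE x (eps R n) (sx x) 0) + ld (tc 1) (aE x (eps R n) (sx x) 1)
   + ld (tc 2) (aE x (eps R n) (sx x) 2) + EC 4 * aE x (eps R n) (sx x) 0)%E4.

Lemma divaE_eq x n y : x != 0 ->
  ev (divaE x n) y = lead x n y + div_rest x (eps R n) (sx x) y.
Proof.
move=> x0; rewrite -[LHS]/(ev (ld (tc 0) (aE x (eps R n) (sx x) 0)) y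
  + ev (ld (tc 1) (aE x (eps R n) (sx x) 1)) y + ev (ld (tc 2) (aE x (eps R n) (sx x) 2)) y
  + 4 * ev (aE x (eps R n) (sx x) 0) y) div_a//.
- by rewrite ltr_wpDl ?rho_ge0 ?eps_gt0.
- exact: rho_sx_gt0.
Qed.

Lemma divaE_continuous x n : x != 0 -> continuous (ev (divaE x n)).
Proof.
move=> x0 y; apply: ev_continuous.
have oa i : ok (aE x (eps R n) (sx x) i) y by apply: ok_aE => //; exact: eps_gt0.
exact: (conj (conj (conj (ok_ldt 0 (oa 0%N)) (ok_ldt 1 (oa 1%N)))
  (ok_ldt 2 (oa 2%N))) (conj I (oa 0%N))).
Qed.

(** On the box [|y| <= 2 B], and the two fourth powers are at most [1/rho] and [1/|x|^4]. The point
    [y = x] is separate because [rho^-1] is 0 there. *)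
Lemma pole_dominated x B (q e g : R) y : x != 0 -> 0 < B -> 0 <= q -> 0 < e ->
  (y = x -> g = 0) -> (~ box B y -> g = 0) ->
  `|g| <= q * (enorm y * irt (rho x y + e) ^+ 4 * irt (rho x y + sx x) ^+ 4) ->
  `|g| <= q * (2 * B * (sx x)^-1) * major x B y.
Proof.
move=> x0 B0 q0 e0 gx gB gl.
have s0 : 0 < sx x by rewrite exprn_gt0 ?enorm_gt0.
have C0 : 0 <= q * (2 * B * (sx x)^-1).
  by rewrite !mulr_ge0 ?invr_ge0 ?(ltW B0) ?(ltW s0).
have m0 : 0 <= major x B y.
  by rewrite addr_ge0 ?mulr_ge0 ?invr_ge0 ?rho_ge0 ?indicE.
have [yx|yx] := eqVneq y x; first by rewrite gx// normr0 mulr_ge0.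
have [By|nB] := pselect (box B y); last by rewrite gB// normr0 mulr_ge0.
have r0 : 0 < rho x y by rewrite rho_gt0.
have re : 0 < rho x y + e by rewrite addr_gt0.
apply: (le_trans gl).
rewrite -[q * (2 * B / _) * _]mulrA ler_wpM2l//.
apply: (@le_trans _ _ (2 * B * (sx x)^-1 * (rho x y)^-1)); last first.
  rewrite ler_wpM2l ?mulr_ge0 ?invr_ge0 ?(ltW B0) ?(ltW s0)//.
  by rewrite /major indicE mem_set//= mul1r lerDl.
rewrite [leRHS](_ : _ = (2 * B) * (rho x y)^-1 * (sx x)^-1); last by ring.
apply: ler_pM; rewrite ?mulr_ge0 ?exprn_ge0 ?enorm_ge0 ?irt_ge0//; last exact: irt_sx4_le.
apply: ler_pM; rewrite ?exprn_ge0 ?enorm_ge0 ?irt_ge0//.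
  by rewrite enorm_box// ltW.
have := irt4 re; move/(canRL (mulfK (lt0r_neq0 re))) => ->.
by rewrite mul1r lef_pV2// lerDl ltW.
Qed.

(** It depends on [x] alone, so that [mass] does not involve [u]; points outside it are at distance
    at least 1 from [x]. *)
Definition box0 x : set 'rV[R]_4 := box (enorm x + 1).

Definition mass x (n : nat) : R := I4 (fun y => lead x n y * \1_(box0 x) y).

Lemma mass_integrable x n : x != 0 -> integrable4 (fun y => lead x n y * \1_(box0 x) y).
Proof.
move=> x0; have cl := @lead_continuous x n x0.
have [c _ cP] : exists2 c : 'rV[R]_4, c \in box0 x &
    forall t : 'rV[R]_4, t \in box0 x -> `|lead x n t| <= `|lead x n c|.
  apply: EVT_max_rV.
  - by exists 0 => k _; rewrite mxE normr0 addr_ge0 ?enorm_ge0.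
  - exact: box_compact.
  - apply: continuous_subspaceT => y; apply: continuous_comp; first exact: cl.
    exact: norm_continuous.
apply: (@integrable_box _ _ (enorm x + 1) (`|lead x n c|)).
- apply: measurable_funM; first exact: measurable_continuous.
  exact: measurable_indic_box.
- by move=> y By; rewrite indicE mem_set// mulr1; apply: cP; rewrite inE.
- by move=> y nB; rewrite indicE memNset// mulr0.
Qed.

(** The leading term is tested against [u = u(x) 1_box0 + v] with [|v| <= C |y - x|]. The factor
    [|y - x|] makes [lead * v] dominated; it tends to 0 pointwise, so only [u(x)] times the mass
    survives. *)
Lemma flux x u B : x != 0 -> enorm x + 1 <= B -> C1c B u ->
  let t i y := ev (aE x 0 (sx x) i) y * Tu i u y in
  let t3 y := div_rest x 0 (sx x) y * u y in
  [/\ forall i, (i < 3)%N -> integrable4 (t i), integrable4 t3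
    & u x * mass x n @[n --> \oo] --> - (I4 (t 0%N) + I4 (t 1%N) + I4 (t 2%N) + I4 t3)].
Proof.
move=> x0 xB uC t t3; have [_ du pu u0] := uC.
have B1 : 0 < B by apply: lt_le_trans xB; rewrite ltr_wpDl ?enorm_ge0.
have s0 : 0 < sx x by rewrite exprn_gt0 ?enorm_gt0.
have rs y := rho_sx_gt0 y x0.
have re n y : 0 < rho x y + eps R n by rewrite ltr_wpDl ?rho_ge0 ?eps_gt0.
have e0 n : 0 <= eps R n by rewrite ltW ?eps_gt0.
have cu : continuous u by move=> y; exact: differentiable_continuous.
have [M M0 uM] := C1c_bounded uC.
have [M' M'0 TM] := Tu_bounded uC.
have [L L0 uL] := lipschitz uC.
pose f i n y := ev (aE x (eps R n) (sx x) i) y * Tu i u y.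
pose f3 n y := div_rest x (eps R n) (sx x) y * u y.
pose v y := u y - u x * \1_(box0 x) y.
pose f4 n y := lead x n y * v y.
have oa i n y : ok (aE x (eps R n) (sx x) i) y by apply: ok_aE => //; exact: eps_gt0.
have Di i : (i < 3)%N -> [/\ forall n, integrable4 (f i n), integrable4 (t i)
    & I4 (f i n) @[n --> \oo] --> I4 (t i)].
  move=> i3; apply: (@dominated_limit R x B ((M' * 30) * (2 * B * (sx x)^-1))) => //.
  - move=> n; apply: measurable_continuous => y.
    apply: (@continuousM _ _ (ev (aE x (eps R n) (sx x) i)) (Tu i u)).
      exact: ev_continuous.
    exact: (@Tu_continuous R B u i uC y).
  - by move=> y; apply: cvgM; [exact: cvg_aE|exact: cvg_cst].
  - move=> n y; apply: (pole_dominated x0 B1 _ (eps_gt0 R n)).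
    + by rewrite mulr_ge0.
    + by move=> ->; rewrite /f a_pole// mul0r.
    + by move=> nB; rewrite /f (Tu_supp i uC nB) mulr0.
    + rewrite /f normrM mulrC -[leRHS]mulrA; apply: ler_pM => //; first exact: TM.
      exact: a_le.
have D3 : [/\ forall n, integrable4 (f3 n), integrable4 t3
    & I4 (f3 n) @[n --> \oo] --> I4 t3].
  apply: (@dominated_limit R x B ((M * 100) * (2 * B * (sx x)^-1))) => //.
  - move=> n; apply: measurable_funM; last exact: measurable_continuous.
    have -> : (fun p : R4 => div_rest x (eps R n) (sx x) (pt p)) =
      (fun p : R4 => ev (divaE x n) (pt p) - lead x n (pt p)).
      by apply/funext => p; rewrite divaE_eq// addrAC subrr add0r.
    apply: measurable_funB; apply: measurable_continuous.
      exact: divaE_continuous.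
    exact: lead_continuous.
  - by move=> y; apply: cvgM; [exact: cvg_div_rest|exact: cvg_cst].
  - move=> n y; apply: (pole_dominated x0 B1 _ (eps_gt0 R n)).
    + by rewrite mulr_ge0// ler0n.
    + by move=> ->; rewrite /f3 div_rest_pole mul0r.
    + by move=> nB; rewrite /f3 (u0 _ nB) mulr0.
    + rewrite /f3 normrM mulrC -[leRHS]mulrA; apply: ler_pM => //; first by have [] := uM y.
      exact: div_rest_le.
have vL y : `|v y| <= (L + M) * enorm (y - x).
  rewrite /v indicE; have [yb|nb] := pselect (box0 x y).
    rewrite mem_set// mulr1; apply: (le_trans (uL x y)).
    by rewrite ler_wpM2r ?enorm_ge0// lerDl.
  rewrite memNset// mulr0 subr0.
  have n1 : 1 <= enorm (y - x).
    move/existsNP: nb => [k /not_implyP[k4 /negP]]; rewrite -ltNge => yk.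
    have := coord_le_enorm y k4; have := enorm_le x y; lra.
  apply: (@le_trans _ _ M); first by have [] := uM y.
  rewrite -[M in leLHS]mulr1; apply: ler_pM => //; lra.
have D4 : [/\ forall n, integrable4 (f4 n), integrable4 (cst 0 : 'rV[R]_4 -> R)
    & I4 (f4 n) @[n --> \oo] --> I4 (cst 0)].
  apply: (@dominated_limit R x B ((5 * (L + M) * (2 * B)) * (2 * B * (sx x)^-1))) => //.
  - move=> n; apply: measurable_funM; first by apply: measurable_continuous; exact: lead_continuous.
    apply: measurable_funB; first exact: measurable_continuous.
    by apply: measurable_funM; [exact: measurable_cst|exact: measurable_indic_box].
  - move=> y; have [->|yx] := eqVneq y x.
      have -> : (fun n => f4 n x) = cst 0; last exact: cvg_cst.
      apply/funext => n; rewrite /f4 /v indicE mem_set; first by rewrite mulr1 subrr mulr0.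
      by move=> k k4; apply: (le_trans (coord_le_enorm x k4)); rewrite lerDl.
    have r0 : 0 < rho x y by rewrite rho_gt0.
    rewrite /= -(mul0r (v y)); apply: cvgM; last exact: cvg_cst.
    rewrite -(mul0r (irt (rho x y + sx x) ^+ 4)); apply: cvgM; last exact: cvg_cst.
    rewrite -(mul0r (irt (rho x y) ^+ 9)); apply: cvgM; last first.
      by apply: cvg_pow; exact: cvg_irt.
    by rewrite -(mulr0 (5 * r2 y)); apply: cvgM; [exact: cvg_cst|exact: cvg_eps].
  - move=> n y; have LM : 0 <= L + M by rewrite addr_ge0.
    have q0 : 0 <= 5 * (L + M) * (2 * B) by rewrite !mulr_ge0// ltW.
    have fB : ~ box B y -> f4 n y = 0.
      move=> nB; rewrite /f4 /v (u0 _ nB) indicE memNset ?mulr0 ?subr0 ?mulr0//.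
      by move=> b0; apply: nB => k k4; apply: le_trans xB; exact: b0.
    apply: (pole_dominated x0 B1 q0 (eps_gt0 R n)) => //.
      move=> ->; rewrite /f4 /v indicE mem_set; first by rewrite mulr1 subrr mulr0.
      by move=> k k4; apply: (le_trans (coord_le_enorm x k4)); rewrite lerDl.
    have [By|nB] := pselect (box B y); last first.
      rewrite fB// normr0 mulr_ge0// !mulr_ge0 ?exprn_ge0 ?enorm_ge0 ?irt_ge0//.
    have [En _] := irt_rho_le (e0 n) (re n y).
    have E4 := irt4 (re n y).
    set E := irt (rho x y + eps R n) in En E4 *; set S := irt (rho x y + sx x).
    have E0 : 0 <= E by exact: irt_ge0.
    have S0 : 0 <= S by exact: irt_ge0.
    have r0 := enorm_ge0 y; have n0 := enorm_ge0 (y - x).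
    have eE : 0 <= E ^+ 4 * eps R n <= 1.
      rewrite mulr_ge0 ?exprn_ge0//= -E4 ler_wpM2l ?exprn_ge0// lerDr.
      exact: rho_ge0.
    have En1 : 0 <= E * enorm (y - x) <= 1 by rewrite mulr_ge0.
    have ld0 : 0 <= lead x n y by rewrite /lead !mulr_ge0 ?exprn_ge0 ?rsq_ge0.
    rewrite /f4 normrM (ger0_norm ld0).
    apply: (le_trans (ler_wpM2l ld0 (vL y))).
    rewrite /lead -/E -/S -enorm_sqr.
    (* Of the nine factors [E], four are spent on [eps] and one on [|y - x|]; the remaining [E^4] is
       at most [1/rho]. *)
    rewrite [leLHS](_ : _ = ((E ^+ 4 * eps R n) * (E * enorm (y - x)))
      * (5 * (L + M) * enorm y * (enorm y * E ^+ 4 * S ^+ 4))); last by ring.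
    apply: (@le_trans _ _ (5 * (L + M) * enorm y * (enorm y * E ^+ 4 * S ^+ 4))).
      by apply: mul_le1; [in01|rewrite !mulr_ge0 ?exprn_ge0].
    rewrite ler_wpM2r//; first by rewrite !mulr_ge0 ?exprn_ge0.
    by rewrite ler_wpM2l ?mulr_ge0// enorm_box// ltW.
have [f0i t0i l0] := Di 0%N isT; have [f1i t1i l1] := Di 1%N isT.
have [f2i t2i l2] := Di 2%N isT; have [f3i t3i l3] := D3; have [f4i _ l4] := D4.
split=> //; first by case=> [|[|[|]]].
have Z n : - (I4 (f 0%N n) + I4 (f 1%N n) + I4 (f 2%N n) + I4 (f3 n)) - I4 (f4 n)
    = u x * mass x n.
  pose g i := aE x (eps R n) (sx x) i.
  have okc k y : (k < 4)%N -> ok (comb (g 0%N) (g 1%N) (g 2%N) k) y.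
    by move=> _; apply: ok_comb; exact: oa.
  have DF := divergence_formula (F := comb (g 0%N) (g 1%N) (g 2%N)) uC okc.
  have [i5 e5] := integral4Z (u x) (mass_integrable n x0).
  have [i01 e01] := integral4D (f0i n) (f1i n).
  have [i012 e012] := integral4D i01 (f2i n).
  have [i0123 e0123] := integral4D i012 (f3i n).
  have [i4 e4] := integral4D i0123 (f4i n).
  have [i6 e6] := integral4D i4 i5.
  rewrite /mass -e5 -e01 -e012 -e0123 -opprD -e4.
  apply/eqP; rewrite eq_sym -addr_eq0 addrC -e6; apply/eqP.
  rewrite -[RHS]DF; congr (integral4 _ _); apply/funext => y.
  have := divaE_eq n y x0; rewrite -[ev (divaE x n) y]/(ev (ld (tc 0) (g 0%N)) y
    + ev (ld (tc 1) (g 1%N)) y + ev (ld (tc 2) (g 2%N)) y + 4 * ev (g 0%N) y) => DE.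
  rewrite comb_Tu div_comb; [|exact: oa|exact: oa|exact: oa].
  by rewrite DE /f /f3 /f4 /v /g; ring.
rewrite -(funext Z).
have -> : - (I4 (t 0%N) + I4 (t 1%N) + I4 (t 2%N) + I4 t3) =
  - (I4 (t 0%N) + I4 (t 1%N) + I4 (t 2%N) + I4 t3) - I4 (cst 0).
  have [_] := integral4Z 0 t3i; rewrite mul0r; under eq_fun do rewrite mul0r.
  by move=> ->; rewrite subr0.
apply: cvgB => //; apply: cvgN.
by apply: cvgD => //; apply: cvgD => //; exact: cvgD.
Qed.

End Flux.

(** * A lower bound for the concentrated mass *)

Section MassLowerBound.
Variable R : realType.
Local Notation L := (@lebesgue_measure R).
Local Notation MR := (measurableTypeR R).
Local Notation LL := (prod_sigma_finite L L).
Local Notation LLL := (prod_sigma_finite LL L).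
Local Notation R4 := (MR * MR * MR * MR)%type.
Implicit Types (x y : 'rV[R]_4) (e B : R).
Local Notation co x k := ((x : 'rV[R]_4) ord0 (inord k)).
Local Notation w x y := (ev (omE x) y).
Local Notation rho x y := (ev (rhoE x) y).

Lemma slice_ge disp (A : measurableType disp) (m : {sigma_finite_measure set A -> \bar R})
    (f : A -> R) (g : A * MR -> R) (M K : R) :
  measurable_fun setT f -> measurable_fun setT g ->
  (forall a, 0 <= f a) -> (forall p, 0 <= g p) -> 0 <= K ->
  (forall a, (K%:E <= \int[L]_t (g (a, t))%:E)%E) ->
  (M%:E <= \int[m]_a (f a)%:E)%E ->
  ((M * K)%:E <= \int[m \x L]_p (f p.1 * g p)%:E)%E.
Proof.
move=> mf mg f0 g0 K0 gK fM.
have mfg : measurable_fun setT (fun p : A * MR => (f p.1 * g p)%:E).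
  apply/measurable_EFinP; apply: measurable_funM => //.
  exact: (measurableT_comp mf measurable_fst).
have fg0 (p : A * MR) : (0 <= (f p.1 * g p)%:E)%E by rewrite lee_fin mulr_ge0.
have -> := fubini_tonelli1 (m1 := m) (m2 := L) _ mfg fg0.
have mga a : measurable_fun setT (fun t : MR => (g (a, t))%:E).
  by apply/measurable_EFinP; apply: (measurableT_comp mg); exact: measurable_pair1.
apply: (@le_trans _ _ (\int[m]_a ((f a)%:E * K%:E))%E).
  rewrite ge0_integralZr//; last 2 first.
  - exact/measurable_EFinP.
  - by move=> a _; rewrite lee_fin.
  by rewrite EFinM lee_wpmul2r ?lee_fin.
apply: ge0_le_integral => //.
- by move=> a _; rewrite -EFinM lee_fin mulr_ge0.
- by apply/measurable_EFinP; apply: measurable_funM => //; exact: measurable_cst.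
- exact: (measurable_fun_fubini_tonelli_F (m2 := L) _ mfg fg0).
- move=> a _; rewrite /fubini_F /=.
  under eq_integral do rewrite EFinM.
  rewrite ge0_integralZl_EFin//; last by move=> t _; rewrite lee_fin.
  by rewrite lee_wpmul2l ?lee_fin.
Qed.

Lemma measurable_cut_affine B a b : measurable_fun setT (fun t : MR => cut B (a * t + b)).
Proof.
apply: (measurableT_comp (@measurable_cut R B)).
apply: continuous_measurable_fun => t; exact: affine_continuous.
Qed.

Lemma integral_cut_ge B a b : 0 < B -> a != 0 ->
  ((2 * B / `|a|)%:E <= \int[L]_t (cut B (a * t + b))%:E)%E.
Proof.
move=> B0 a0; have na : 0 < `|a| by rewrite normr_gt0.
pose c := - b / a; pose I := (`[c - B / `|a|, c + B / `|a|]%classic : set MR).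
have mI : measurable I by exact: measurable_itv.
have LI : L I = (2 * B / `|a|)%:E.
  rewrite lebesgue_measure_itv /= lte_fin.
  have -> : c - B / `|a| < c + B / `|a| by rewrite ltrD2l gtrN// divr_gt0.
  by rewrite -EFinB; congr (_%:E); ring.
have -> : ((2 * B / `|a|)%:E = \int[L]_t (\1_I t)%:E)%E.
  by rewrite integral_indic// setIT; exact: esym LI.
apply: ge0_le_integral => //.
- by apply/measurable_EFinP; exact: measurable_indic.
- by apply/measurable_EFinP; exact: measurable_cut_affine.
- move=> t _; rewrite lee_fin cutE indicE.
  have [tI|nI] := pselect (I t); last by rewrite memNset//; case: ifP.
  have -> : a * t + b = a * (t - c) by rewrite /c; field.
  rewrite mem_set// normrM -ler_pdivlMl// mulrC ler_distl.
  by move: tI; rewrite /I /= in_itv /= => ->.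
Qed.

(** The indicator of an anisotropic box about [x], comparable to a d-ball: size [e] in three
    coordinates and [e^2] in [w]. The coordinates are numbered as in [slot_maj]. *)
Definition slot_min x j e (p : R4) : R :=
  let s i := co x (if i == j then 3 else i) in
  cut e (1 * p.1.1.1 - s 0%N) * cut e (1 * p.1.1.2 - s 1%N)
  * cut e (1 * p.1.2 - s 2%N) * cut (e ^+ 2) (w x (pt (slot j p))).

Lemma measurable_om_cut x j e :
  measurable_fun setT (fun p : R4 => cut (e ^+ 2) (w x (pt (slot j p)))).
Proof.
apply: (@measurable_pt_slot R j (fun y => cut (e ^+ 2) (w x y))).
apply: (measurableT_comp (@measurable_cut R _)).
by apply: measurable_continuous => y; exact: (ev_continuous (ok_om x y)).
Qed.

Lemma measurable_slot_min x j e : measurable_fun setT (slot_min x j e).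
Proof.
have m11 : measurable_fun setT (fun p : R4 => p.1.1).
  by apply: measurableT_comp; [exact: measurable_fst|exact: measurable_fst].
apply: measurable_funM; last exact: measurable_om_cut.
apply: measurable_funM; last first.
  apply: (measurableT_comp (measurable_cut_affine _ _ _)).
  by apply: measurableT_comp; [exact: measurable_snd|exact: measurable_fst].
apply: measurable_funM; apply: (measurableT_comp (measurable_cut_affine _ _ _)).
- exact: (measurableT_comp measurable_fst m11).
- exact: (measurableT_comp measurable_snd m11).
Qed.

Lemma slot_min_ge0 x j e p : 0 <= slot_min x j e p.
Proof. by rewrite /slot_min !mulr_ge0 ?cut_ge0. Qed.

Lemma integral_slot_min x j e : (j < 4)%N -> 0 < e -> om_coef x j != 0 ->
  ((16 * e ^+ 5 / `|om_coef x j|)%:E <= \int[@leb4 R]_p (slot_min x j e p)%:E)%E.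
Proof.
move=> j4 e0 a0; have one0 : 1 != 0 :> R by exact: oner_neq0.
have mc b := measurable_cut_affine e 1 b.
have K0 (B a : R) : 0 < B -> 0 <= 2 * B / `|a|.
  by move=> B0; rewrite divr_ge0// mulr_ge0// ltW.
pose s i := co x (if i == j then 3 else i).
pose f1 (t : MR) : R := cut e (1 * t - s 0%N).
pose f2 (p : MR * MR) : R := f1 p.1 * cut e (1 * p.2 - s 1%N).
pose f3 (p : MR * MR * MR) : R := f2 p.1 * cut e (1 * p.2 - s 2%N).
have mf1 : measurable_fun setT f1 by exact: mc.
have mf2 : measurable_fun setT f2.
  apply: measurable_funM; first exact: (measurableT_comp mf1 measurable_fst).
  exact: (measurableT_comp (mc _) measurable_snd).
have mf3 : measurable_fun setT f3.
  apply: measurable_funM; first exact: (measurableT_comp mf2 measurable_fst).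
  exact: (measurableT_comp (mc _) measurable_snd).
have f10 t : 0 <= f1 t by exact: cut_ge0.
have f20 p : 0 <= f2 p by rewrite mulr_ge0 ?cut_ge0.
have f30 p : 0 <= f3 p by rewrite mulr_ge0 ?cut_ge0.
have I1 := integral_cut_ge (- s 0%N) e0 one0.
have I2 : ((2 * e / `|1| * (2 * e / `|1|))%:E <= \int[LL]_p (f2 p)%:E)%E.
  apply: (@slice_ge _ _ L f1 (fun p => cut e (1 * p.2 - s 1%N))) => //.
  - exact: (measurableT_comp (mc _) measurable_snd).
  - exact: K0.
  - by move=> a; exact: integral_cut_ge.
have I3 : ((2 * e / `|1| * (2 * e / `|1|) * (2 * e / `|1|))%:E <= \int[LLL]_p (f3 p)%:E)%E.
  apply: (@slice_ge _ _ LL f2 (fun p => cut e (1 * p.2 - s 2%N))) => //.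
  - exact: (measurableT_comp (mc _) measurable_snd).
  - exact: K0.
  - by move=> a; exact: integral_cut_ge.
have -> : 16 * e ^+ 5 / `|om_coef x j| =
    2 * e / `|1| * (2 * e / `|1|) * (2 * e / `|1|) * (2 * e ^+ 2 / `|om_coef x j|).
  by rewrite normr1 invr1; ring.
apply: (@slice_ge _ _ LLL f3 (fun p => cut (e ^+ 2) (w x (pt (slot j p))))) => //.
- exact: measurable_om_cut.
- by apply: K0; rewrite exprn_gt0.
- move=> q; under eq_integral do rewrite om_slot//.
  by apply: integral_cut_ge; rewrite ?exprn_gt0.
Qed.

Lemma om_coef_sum x y : w x y = om_coef x 0 * (co y 0 - co x 0)
  + om_coef x 1 * (co y 1 - co x 1) + om_coef x 2 * (co y 2 - co x 2)
  + om_coef x 3 * (co y 3 - co x 3).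
Proof. by rewrite ev_omE /om_coef /=; ring. Qed.

Lemma om_coef_le x j : `|om_coef x j| <= enorm x.
Proof.
case: j => [|[|[|[|j]]]]; rewrite /om_coef /= ?normrN ?coord_le_enorm//.
by rewrite nth_nil normr0 enorm_ge0.
Qed.

Lemma enormN y : enorm (- y) = enorm y.
Proof. by rewrite !enormE !ev_rsqE !mxE !sqrrN. Qed.

Lemma enorm0 : enorm (0 : 'rV[R]_4) = 0.
Proof. by rewrite enormE ev_rsqE !mxE expr0n /= !addr0 sqrtr0. Qed.

(** [|Jx| = |x|], and there are four coordinates. A quantitative choice of [j] keeps the final
    constant independent of [x]. *)
Lemma om_coef_large x : exists2 j, (j < 4)%N & enorm x / 2 <= `|om_coef x j|.
Proof.
have [x0|x0] := eqVneq x 0.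
  by exists 0%N; rewrite // x0 enorm0 mul0r.
apply: contrapT => h; have lt k : (k < 4)%N -> om_coef x k ^+ 2 < (enorm x / 2) ^+ 2.
  move=> k4; rewrite -sqr_normr ltrXn2r// ?divr_ge0 ?enorm_ge0// ltNge; apply/negP => hk.
  by apply: h; exists k.
have := lt 0%N isT; have := lt 1%N isT; have := lt 2%N isT; have := lt 3%N isT.
by rewrite exprMn enorm_sqr ev_rsqE /om_coef /= !sqrrN; lra.
Qed.

(** With [|y - x| <= 16 e], the condition [17 e <= 1] places [y] in [box0 x], and [34 e <= |x|]
    gives [|y| >= |x| / 2] and [rho + |x|^4 <= 2 |x|^4]. *)
Lemma lead_ge x n j e y : x != 0 -> (j < 4)%N -> enorm x / 2 <= `|om_coef x j| ->
  0 < e -> e ^+ 4 = eps R n -> 34 * e <= enorm x -> 17 * e <= 1 ->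
  (forall k, (k < 4)%N -> k != j -> `|co y k - co x k| <= e) -> `|w x y| <= e ^+ 2 ->
  box0 x y /\ (17^-1) ^+ 9 / 16 / e ^+ 5 / enorm x ^+ 2 <= lead x n y.
Proof.
move=> x0 j4 aj e0 en em e1 hk wl; set m := enorm x in aj em *.
have m0 : 0 < m by rewrite enorm_gt0.
have ak k : (k < 4)%N -> k != j -> `|om_coef x k * (co y k - co x k)| <= m * e.
  by move=> k4 kj; rewrite normrM ler_pM ?om_coef_le ?hk.
(* The missing coordinate is recovered from [w]: its term is at most [e^2 + 3 m e <= 4 m e], and its
   slope is at least [m / 2]. *)
have hj : `|co y j - co x j| <= 8 * e.
  have aH : `|om_coef x j * (co y j - co x j)| <= 4 * m * e.
    have e2 : e ^+ 2 <= m * e by rewrite expr2 ler_wpM2r ?(ltW e0)//; lra.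
    move: wl; rewrite om_coef_sum => wl.
    case: j j4 ak {aj hk} wl => [|[|[|[|//]]]] _ ak wl.
    - have := ak 1%N isT isT; have := ak 2%N isT isT; have := ak 3%N isT isT; move: wl.
      rewrite !ler_norml => /andP[? ?] /andP[? ?] /andP[? ?] /andP[? ?]; apply/andP; split; lra.
    - have := ak 0%N isT isT; have := ak 2%N isT isT; have := ak 3%N isT isT; move: wl.
      rewrite !ler_norml => /andP[? ?] /andP[? ?] /andP[? ?] /andP[? ?]; apply/andP; split; lra.
    - have := ak 0%N isT isT; have := ak 1%N isT isT; have := ak 3%N isT isT; move: wl.
      rewrite !ler_norml => /andP[? ?] /andP[? ?] /andP[? ?] /andP[? ?]; apply/andP; split; lra.
    - have := ak 0%N isT isT; have := ak 1%N isT isT; have := ak 2%N isT isT; move: wl.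
      rewrite !ler_norml => /andP[? ?] /andP[? ?] /andP[? ?] /andP[? ?]; apply/andP; split; lra.
  rewrite normrM in aH.
  have m2 : 0 < m / 2 by rewrite divr_gt0.
  rewrite -(ler_pM2l m2); apply: (@le_trans _ _ (4 * m * e)); last lra.
  by apply: le_trans aH; rewrite ler_wpM2r.
have hsq k : (k < 4)%N -> (co y k - co x k) ^+ 2 <= 64 * e ^+ 2.
  move=> k4; have -> : 64 * e ^+ 2 = (8 * e) ^+ 2 by ring.
  rewrite -sqr_normr lerXn2r ?nnegrE ?mulr_ge0 ?(ltW e0)//.
  have [->//|kj] := eqVneq k j.
  by apply: (le_trans (hk k k4 kj)); lra.
have Hle : ev (hsqE x) y <= 256 * e ^+ 2.
  have := hsq 0%N isT; have := hsq 1%N isT; have := hsq 2%N isT; have := hsq 3%N isT.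
  by rewrite ev_hsqE; lra.
have H0 : 0 <= ev (hsqE x) y by exact: hsq_ge0.
have nh : enorm (y - x) <= 16 * e.
  rewrite -(@ler_pXn2r _ 2) ?nnegrE ?enorm_ge0 ?mulr_ge0 ?(ltW e0)// enorm_sub_sqr.
  by apply: (le_trans Hle); rewrite exprMn; lra.
have r0 : 0 <= rho x y by exact: rho_ge0.
(* [256^2 + 4 + 1 <= 289^2 = 17^4]. *)
have rle : rho x y + eps R n <= (17 * e) ^+ 4.
  have h2 : ev (hsqE x) y ^+ 2 <= (256 * e ^+ 2) ^+ 2.
    by rewrite lerXn2r ?nnegrE// mulr_ge0 ?sqr_ge0.
  have w2 : w x y ^+ 2 <= (e ^+ 2) ^+ 2.
    by rewrite -sqr_normr lerXn2r ?nnegrE ?sqr_ge0.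
  have -> : (17 * e) ^+ 4 = (289 * e ^+ 2) ^+ 2 by ring.
  have e2 : 0 <= (e ^+ 2) ^+ 2 by exact: sqr_ge0.
  rewrite rho_eq -en; apply: (@le_trans _ _ ((256 * e ^+ 2) ^+ 2 + 4 * (e ^+ 2) ^+ 2 + (e ^+ 2) ^+ 2)).
    have -> : e ^+ 4 = (e ^+ 2) ^+ 2 by ring.
    by rewrite lerD2r lerD// ler_wpM2l.
  by lra.
have re : 0 < rho x y + eps R n by rewrite ltr_wpDl ?eps_gt0.
have rs := rho_sx_gt0 y x0.
have tx := enorm_le x y.
split.
  move=> k k4; rewrite -/m.
  have ckx := coord_le_enorm x k4; rewrite -/m in ckx.
  have ckh := @coord_le_enorm R (y - x) k k4.
  have -> : co y k = co x k + co (y - x) k by rewrite !mxE; ring.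
  by apply: (le_trans (ler_normD _ _)); lra.
have E4 := irt4 re; have S4 := irt4 rs; have E0 := irt_ge0 (rho x y + eps R n).
rewrite /lead -enorm_sqr -en; set E := irt _ in E4 E0 *; set S := irt _ in S4 *.
have e17 : 0 < 17 * e by rewrite mulr_gt0.
have EE : (17 * e)^-1 <= E.
  rewrite -(@ler_pXn2r _ 4) ?nnegrE ?invr_ge0 ?(ltW e17)// exprVn.
  rewrite -(mulr1 (_^-1)) ler_pdivrMl ?exprn_gt0// -[leLHS]E4 mulrC.
  by rewrite ler_wpM2r ?exprn_ge0.
have SS : (2 * m ^+ 4)^-1 <= S ^+ 4.
  have ms : 0 < 2 * m ^+ 4 by rewrite mulr_gt0 ?exprn_gt0.
  rewrite -(mulr1 (_^-1)) ler_pdivrMl// -[leLHS]S4 mulrC ler_wpM2r ?exprn_ge0 ?irt_ge0//.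
  have : (17 * e) ^+ 4 <= m ^+ 4.
    by rewrite lerXn2r ?nnegrE ?(ltW e17) ?(ltW m0)//; lra.
  by rewrite /sx -/m; have := eps_gt0 R n; lra.
have yy : m ^+ 2 / 4 <= enorm y ^+ 2.
  have -> : m ^+ 2 / 4 = (m / 2) ^+ 2 by field.
  rewrite lerXn2r ?nnegrE ?enorm_ge0 ?divr_ge0 ?(ltW m0)//.
  have : m <= enorm y + enorm (y - x).
    by rewrite /m -(enormN (y - x)) opprB; exact: enorm_le.
  lra.
have E9 : (17 * e)^-1 ^+ 9 <= E ^+ 9.
  by rewrite lerXn2r ?nnegrE ?invr_ge0 ?(ltW e17).
(* A factor 10 is given away; the 16 in the lower bound is there to cancel the one in
   [integral_slot_min]. *)
apply: (@le_trans _ _ (5 * (m ^+ 2 / 4) * e ^+ 4 * (17 * e)^-1 ^+ 9 * (2 * m ^+ 4)^-1)).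
  have -> : 5 * (m ^+ 2 / 4) * e ^+ 4 * (17 * e)^-1 ^+ 9 * (2 * m ^+ 4)^-1
    = 10 * (17^-1 ^+ 9 / 16 / e ^+ 5 / m ^+ 2).
    rewrite invfM exprMn; set z := 17^-1 ^+ 9; field.
    by rewrite (gt_eqF m0) (gt_eqF e0).
  rewrite ler_peMl ?ler1n//.
  by rewrite !divr_ge0 ?exprn_ge0 ?invr_ge0 ?ler0n ?(ltW e0) ?(ltW m0).
have e40 : 0 <= e ^+ 4 by rewrite exprn_ge0 ?ltW.
have m40 : 0 <= m ^+ 2 / 4 by rewrite divr_ge0 ?sqr_ge0.
have z0 : 0 <= (17 * e)^-1 ^+ 9 by rewrite exprn_ge0 ?invr_ge0 ?(ltW e17).
have s0 : 0 <= (2 * m ^+ 4)^-1 by rewrite invr_ge0 mulr_ge0 ?exprn_ge0 ?(ltW m0).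
have p1 : 0 <= 5 * (m ^+ 2 / 4) by rewrite mulr_ge0.
have p2 : 0 <= 5 * (m ^+ 2 / 4) * e ^+ 4 by rewrite mulr_ge0.
apply: ler_pM => //; first by rewrite mulr_ge0.
apply: ler_pM => //.
  by rewrite ler_wpM2r// ler_wpM2l.
by rewrite en.
Qed.

Lemma mass_ge x : x != 0 -> \forall n \near \oo, 17^-1 ^+ 9 / enorm x ^+ 3 <= mass x n.
Proof.
move=> x0; have [j j4 aj] := om_coef_large x.
have m0 : 0 < enorm x by rewrite enorm_gt0.
have aj0 : 0 < `|om_coef x j| by apply: lt_le_trans aj; rewrite divr_gt0.
have d0 : 0 < Num.min (enorm x / 34) 17^-1.
  by rewrite lt_min divr_gt0//= invr_gt0.
have near_eps : \forall n \near \oo, eps R n < Num.min (enorm x / 34) 17^-1 ^+ 4.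
  have := @cvg_eps R; move/cvgr_lt; apply; rewrite exprn_gt0//.
apply: filterS near_eps => n nn.
(* The radius at which [rho] and [eps R n] balance. *)
pose e := Num.sqrt (Num.sqrt (eps R n)).
have e0 : 0 < e by rewrite !sqrtr_gt0 eps_gt0.
have e4 : e ^+ 4 = eps R n.
  by rewrite (exprM e 2 2) !sqr_sqrtr ?sqrtr_ge0// ltW ?eps_gt0.
have : e < Num.min (enorm x / 34) 17^-1.
  by rewrite -(@ltr_pXn2r _ 4) ?nnegrE ?(ltW e0) ?(ltW d0)// e4.
rewrite lt_min ltr_pdivlMr// => /andP[em e1].
have {}e1 : 17 * e <= 1 by rewrite mulrC -ler_pdivlMr// mul1r ltW.
have {}em : 34 * e <= enorm x by rewrite mulrC ltW.
pose kap := (17^-1) ^+ 9 / 16 / e ^+ 5 / enorm x ^+ 2.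
have k0 : 0 <= kap.
  by rewrite /kap !divr_ge0 ?exprn_ge0 ?invr_ge0 ?ler0n ?(ltW e0) ?(ltW m0).
pose F y := lead x n y * \1_(box0 x) y.
have F0 y : 0 <= F y.
  rewrite /F mulr_ge0 ?indicE// /lead !mulr_ge0 ?exprn_ge0 ?irt_ge0 ?rsq_ge0//.
  exact/ltW/eps_gt0.
have mF : measurable_fun setT (fun p : R4 => (F (pt p))%:E).
  by have /integrableP[] := mass_integrable n x0.
have Fge (p : R4) : kap * slot_min x j e p <= F (pt (slot j p)).
  rewrite /slot_min !cutE; set y := pt (slot j p).
  have [h0|] := boolP (_ <= e); last by rewrite !mul0r mulr0.
  have [h1|] := boolP (_ <= e); last by rewrite mulr0 !mul0r mulr0.
  have [h2|] := boolP (_ <= e); last by rewrite mulr0 mul0r mulr0.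
  have [h3|] := boolP (_ <= e ^+ 2); last by rewrite !mulr0.
  rewrite !mulr1 /F.
  have hk k : (k < 4)%N -> k != j -> `|co y k - co x k| <= e.
    move: h0 h1 h2; rewrite !mul1r => h0 h1 h2.
    move=> k4 kj; rewrite /y pt_slot_coord// (negbTE kj) !pt_coord//.
    by case: j j4 kj h0 h1 h2 {aj aj0 y h3} => [|[|[|[|//]]]] _;
      case: k k4 => [|[|[|[|//]]]] _ //=.
  have [By le] := lead_ge x0 j4 aj e0 e4 em e1 hk h3.
  by rewrite indicE mem_set// mulr1.
have fin : (\int[@leb4 R]_p (F (pt p))%:E)%E \is a fin_num.
  exact: (integrable_fin_num _ (mass_integrable n x0)).
rewrite /mass /integral4 /Rintegral -lee_fin.
rewrite (_ : [set p : R * R * R * R | _] = setT); last by apply/seteqP.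
rewrite fineK//.
have -> := ge0_integral_slot j mF (fun p => F0 (pt p)).
have mM := measurable_slot_min x j e.
apply: (@le_trans _ _ (\int[@leb4 R]_p (kap * slot_min x j e p)%:E)%E); last first.
  apply: ge0_le_integral => //.
  - by move=> p _; rewrite lee_fin mulr_ge0 ?slot_min_ge0.
  - by apply/measurable_EFinP; apply: measurable_funM.
  - exact: (measurableT_comp mF (@measurable_slot R j)).
  - by move=> p _; rewrite lee_fin; exact: Fge.
under eq_integral do rewrite EFinM.
rewrite ge0_integralZl_EFin//; last 2 first.
- by move=> p _; rewrite lee_fin slot_min_ge0.
- exact/measurable_EFinP.
have am : om_coef x j != 0 by rewrite -normr_gt0.
apply: (@le_trans _ _ (kap%:E * (16 * e ^+ 5 / `|om_coef x j|)%:E)%E); last first.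
  by rewrite lee_wpmul2l ?lee_fin//; exact: integral_slot_min.
rewrite -EFinM lee_fin /kap.
have -> : 17^-1 ^+ 9 / 16 / e ^+ 5 / enorm x ^+ 2 * (16 * e ^+ 5 / `|om_coef x j|)
    = 17^-1 ^+ 9 / (enorm x ^+ 2 * `|om_coef x j|).
  set z := 17^-1 ^+ 9; field.
  by rewrite (gt_eqF m0) (gt_eqF e0) (gt_eqF aj0).
rewrite ler_wpM2l ?exprn_ge0 ?invr_ge0// lef_pV2 ?posrE ?mulr_gt0 ?exprn_gt0//.
by rewrite [leRHS]exprSr ler_wpM2l ?exprn_ge0 ?(ltW m0)// om_coef_le.
Qed.

End MassLowerBound.

(** * Normalization and assembly of the kernels *)

Section Representation.
Variable R : realType.
Implicit Types (x y : 'rV[R]_4) (B : R) (u : 'rV[R]_4 -> R).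
Local Notation rho x y := (ev (rhoE x) y).
Local Notation I4 F := (integral4 [set: 'rV[R]_4] F).

(* Chosen from [mass] alone, hence independent of [u]; when [mass x] diverges
   [flux] forces [u x = 0] for every [u], and any value would do. *)
Definition normalizer x : R :=
  if `[< cvgn (mass x) >] then - (limn (mass x))^-1 else 0.

Lemma limn_mass_ge x : x != 0 -> cvgn (mass x) ->
  17^-1 ^+ 9 / enorm x ^+ 3 <= limn (mass x).
Proof. by move=> x0 cm; apply: limr_ge => //; exact: mass_ge. Qed.

Lemma mass_bound_gt0 x : x != 0 -> 0 < 17^-1 ^+ 9 / enorm x ^+ 3 :> R.
Proof.
by move=> x0; apply: divr_gt0; apply: exprn_gt0; [rewrite invr_gt0|exact: enorm_gt0].
Qed.

Lemma normalizer_le x : x != 0 -> `|normalizer x| <= 17 ^+ 9 * enorm x ^+ 3.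
Proof.
move=> x0; have c0 := mass_bound_gt0 x0.
have q0 : 0 <= 17 ^+ 9 * enorm x ^+ 3 :> R.
  by apply: mulr_ge0; apply: exprn_ge0; rewrite ?enorm_ge0.
rewrite /normalizer; case: ifPn => [/asboolP cm|_]; last by rewrite normr0.
have l0 := limn_mass_ge x0 cm.
have lp : 0 < limn (mass x) by exact: lt_le_trans l0.
rewrite normrN normfV (gtr0_norm lp).
have -> : 17 ^+ 9 * enorm x ^+ 3 = (17^-1 ^+ 9 / enorm x ^+ 3)^-1.
  by rewrite invfM invrK exprVn invrK.
by rewrite lef_pV2.
Qed.

(** If [u x] is nonzero, the hypothesis itself yields convergence of [mass x]; if [u x = 0], it
    forces [l = 0] and any normalization works. *)
Lemma normalizer_flux x u (l : R) : x != 0 ->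
  u x * mass x n @[n --> \oo] --> - l -> normalizer x * l = u x.
Proof.
move=> x0 ul; have [ux|ux] := eqVneq (u x) 0.
  have l0 : l = 0.
    have := cvg_lim (@Rhausdorff R) ul.
    under eq_fun do rewrite ux mul0r.
    by rewrite (lim_cst (@Rhausdorff R)) => h; apply: oppr_inj; rewrite -h oppr0.
  by rewrite l0 mulr0 ux.
have ml : mass x n @[n --> \oo] --> (u x)^-1 * - l.
  have E : mass x = fun n => (u x)^-1 * (u x * mass x n).
    by apply/funext => n; rewrite mulKf.
  by rewrite [X in X @ _]E; apply: cvgM => //; exact: cvg_cst.
have cm : cvgn (mass x) by apply/cvg_ex; exists ((u x)^-1 * - l).
have lE : limn (mass x) = (u x)^-1 * - l by exact: (cvg_lim (@Rhausdorff R) ml).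
have lp : 0 < limn (mass x).
  exact: lt_le_trans (mass_bound_gt0 x0) (limn_mass_ge x0 cm).
have l0 : l != 0.
  by apply/eqP => l0; move: lp; rewrite lE l0 oppr0 mulr0 ltxx.
rewrite /normalizer; case: ifPn => [_|/asboolPn//].
by rewrite lE; field; rewrite ux l0.
Qed.

Lemma vact_Z (i : 'I_3) u y : differentiable u y ->
  vact (Z i) u y = (enorm y)^-1 * Tu i u y.
Proof.
move=> du; rewrite /vact derive_par// /Tu mulr_sumr; apply: eq_bigr => k _.
by rewrite mxE ev_tc mulrA.
Qed.

Lemma G_integrand N x (i : 'I_3) u y : x != 0 -> differentiable u y ->
  G N x i y * vact (Z i) u y * enorm y =
  (CHR R)^-1 * ((enorm y)^-1 * ev (ld (tc i) (psiE x (sx x))) y * Tu i u y)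
  + N * (ev (aE x 0 (sx x) i) y * Tu i u y).
Proof.
move=> x0 du; rewrite vact_Z// /G; set ka := (CHR R)^-1.
set p := ev _ y; set a := ev (aE _ _ _ _) y; set t := Tu i u y.
(* At the origin the weights cannot be cancelled. The left side is 0 because of [enorm y], and on
   the right [0^-1 = 0] kills one term while [a_le] makes the field vanish. *)
have [y0|y0] := eqVneq y 0; last first.
  by have := enorm_gt0 y0 => r0; field; rewrite gt_eqF.
have r0 : 0 < rho x y + 0 by rewrite addr0 rho_gt0 y0 eq_sym.
have := @a_le R x 0 i y (ltn_ord i) (lexx 0) r0 x0.
have -> : enorm y = 0 by rewrite y0 enorm0.
rewrite !mul0r mulr0 normr_le0 => /eqP; rewrite -/a => ->.
by rewrite invr0; ring.
Qed.

Lemma G0_integrand N x u y : x != 0 ->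
  G0 N x y * u y * enorm y =
  (CHR R)^-1 * ((enorm y)^-1 * lap_psi x (sx x) y * u y)
  + N * (div_rest x 0 (sx x) y * u y).
Proof.
move=> x0; rewrite /G0 -enorm_sqr; set ka := (CHR R)^-1.
set p := lap_psi _ _ _; set a := div_rest _ _ _ _.
have [y0|y0] := eqVneq y 0; last first.
  by have := enorm_gt0 y0 => r0; field; rewrite gt_eqF.
have r0 : 0 < rho x y + 0 by rewrite addr0 rho_gt0 y0 eq_sym.
have := @div_rest_le R x 0 y (lexx 0) r0 x0.
have -> : enorm y = 0 by rewrite y0 enorm0.
rewrite !mul0r mulr0 normr_le0 => /eqP; rewrite -/a => ->.
by rewrite invr0; ring.
Qed.

(** At [x = 0] the bound contains [|x|^2 = 0] and leaves no choice but 0. *)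
Definition kernel (i : 'I_3) x y : R :=
  if x == 0 then 0 else G (normalizer x) x i y - vact (Z i) (Gam x) y.

Definition kernel0 x y : R :=
  if x == 0 then 0 else G0 (normalizer x) x y - frem x y.

Lemma representation u x : Cinfty0 u -> x != 0 ->
  let g i y := (vact (Z i) (Gam x) y + kernel i x y) * vact (Z i) u y * enorm y in
  let g0 y := (kernel0 x y + frem x y) * u y * enorm y in
  [/\ forall i, integrable4 (g i), integrable4 g0 & u x = \sum_(i < 3) I4 (g i) + I4 g0].
Proof.
move=> /Cinfty0_C1c[B' uB'] x0 g g0.
pose B := Num.max B' (enorm x + 1).
have xB : enorm x + 1 <= B by rewrite le_max lexx orbT.
have B0 : 0 < B by apply: lt_le_trans xB; rewrite ltr_wpDl ?enorm_ge0.
have uC : C1c B u by apply: C1c_le uB'; rewrite le_max lexx.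
have [_ du _ _] := uC.
have [ip ip3 sp] := green_psi x0 B0 uC.
have [ia ia3 /(normalizer_flux x0) sa] := flux x0 xB uC.
set N := normalizer x in sa; pose ka := (CHR R)^-1.
pose tp i y := (enorm y)^-1 * ev (ld (tc i) (psiE x (sx x))) y * Tu i u y.
pose ta i y := ev (aE x 0 (sx x) i) y * Tu i u y.
pose tp3 y := (enorm y)^-1 * lap_psi x (sx x) y * u y.
pose ta3 y := div_rest x 0 (sx x) y * u y.
have gE (i : 'I_3) : g i = fun y => ka * tp i y + N * ta i y.
  apply/funext => y; rewrite /g /kernel (negbTE x0) addrC subrK.
  exact: G_integrand.
have g0E : g0 = fun y => ka * tp3 y + N * ta3 y.
  apply/funext => y; rewrite /g0 /kernel0 (negbTE x0) subrK.
  exact: G0_integrand.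
have Hi i : (i < 3)%N -> integrable4 (fun y => ka * tp i y + N * ta i y)
    /\ I4 (fun y => ka * tp i y + N * ta i y) = ka * I4 (tp i) + N * I4 (ta i).
  move=> i3; have [p1 p2] := integral4Z ka (ip i i3); have [a1 a2] := integral4Z N (ia i i3).
  by have [s1 s2] := integral4D p1 a1; rewrite -p2 -a2.
have H3 : integrable4 g0 /\ I4 g0 = ka * I4 tp3 + N * I4 ta3.
  rewrite g0E; have [p1 p2] := integral4Z ka ip3; have [a1 a2] := integral4Z N ia3.
  by have [s1 s2] := integral4D p1 a1; rewrite -p2 -a2.
split; first by move=> i; rewrite gE; exact: (Hi i (ltn_ord i)).1.
  exact: H3.1.
rewrite H3.2 big_ord3 !gE.
rewrite (Hi 0%N isT).2 (Hi 1%N isT).2 (Hi 2%N isT).2.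
have P : I4 (tp 0%N) + I4 (tp 1%N) + I4 (tp 2%N) + I4 tp3 = 0 by exact: sp.
have A : N * (I4 (ta 0%N) + I4 (ta 1%N) + I4 (ta 2%N) + I4 ta3) = u x by exact: sa.
transitivity (ka * (I4 (tp 0%N) + I4 (tp 1%N) + I4 (tp 2%N) + I4 tp3)
  + N * (I4 (ta 0%N) + I4 (ta 1%N) + I4 (ta 2%N) + I4 ta3)); last by ring.
by rewrite P A mulr0 add0r.
Qed.

End Representation.

Theorem theorem1p2 (R : realType) :
  exists2 C : R, 0 < C &
  exists (K0 : 'rV[R]_4 -> 'rV[R]_4 -> R)
         (K : 'I_3 -> 'rV[R]_4 -> 'rV[R]_4 -> R),
  [/\ forall x y : 'rV[R]_4, y != x -> y != 0 ->
        `|K0 x y| <= C * enorm x ^+ 2 * dist y x ^ (- Q + 1)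
                       * dist y 0 ^ (- Q + 2),
      forall (i : 'I_3) (x y : 'rV[R]_4), y != x -> y != 0 ->
        `|K i x y| <= C * enorm x ^+ 2 * dist x y ^ (- Q + 1)
                        * dist y 0 ^ (- Q + 3)
    & forall (u : 'rV[R]_4 -> R) (x : 'rV[R]_4), Cinfty0 u -> x != 0 ->
      [/\ forall i : 'I_3, integrable4 (fun y =>
            (vact (Z i) (Gam x) y + K i x y) * vact (Z i) u y * enorm y),
          integrable4 (fun y => (K0 x y + frem x y) * u y * enorm y)
        & u x =
            \sum_(i < 3) integral4 [set: 'rV[R]_4] (fun y =>
              (vact (Z i) (Gam x) y + K i x y) * vact (Z i) u y * enorm y)
            + integral4 [set: 'rV[R]_4] (fun y =>
              (K0 x y + frem x y) * u y * enorm y)]].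
Proof.
pose ka := `|(CHR R)^-1|.
(* The constant of [G0_bound] with [cN = 17^9] from [normalizer_le]; it also exceeds that of
   [G_bound]. The 1 secures positivity even if [ka] were 0. *)
pose C : R := 3000 * ka + 800 * 17 ^+ 9 + 1.
have ka0 : 0 <= ka by exact: normr_ge0.
have c0 : 0 <= 17 ^+ 9 :> R by rewrite exprn_ge0.
have dist_ge0 (x y : 'rV[R]_4) (k : int) : 0 <= dist x y ^ k.
  by rewrite exprz_ge0// powR_ge0.
have x2 (x : 'rV[R]_4) : 0 <= enorm x ^+ 2 by exact: sqr_ge0.
exists C; first by rewrite /C; set c := 17 ^+ 9 in c0 *; lra.
exists (@kernel0 R), (fun i => @kernel R i).
split; last by move=> u x uC x0; exact: representation.
- move=> x y yx y0; rewrite /kernel0; case: ifPn => [/eqP ->|x0].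
    by rewrite normr0 enorm0 expr0n mulr0 !mul0r.
  apply: (le_trans (G0_bound x0 yx y0 (normalizer_le x0) c0)).
  rewrite -/ka; apply: ler_wpM2r; first exact: dist_ge0.
  apply: ler_wpM2r; first exact: dist_ge0.
  apply: ler_wpM2r; first exact: x2.
  by rewrite /C; set c := 17 ^+ 9 in c0 *; lra.
- move=> i x y yx y0; rewrite /kernel; case: ifPn => [/eqP ->|x0].
    by rewrite normr0 enorm0 expr0n mulr0 !mul0r.
  apply: (le_trans (G_bound i x0 yx y0 (normalizer_le x0) c0)).
  rewrite -/ka; apply: ler_wpM2r; first exact: dist_ge0.
  apply: ler_wpM2r; first exact: dist_ge0.
  apply: ler_wpM2r; first exact: x2.
  by rewrite /C; set c := 17 ^+ 9 in c0 *; lra.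
Qed.
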